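(* Let $1<p<\infty$. There is $\gamma_0=\gamma_0(p)>0$ such that for every $0<\gamma<\gamma_0$ the following holds: the canonical basis $(e^*_j)_{j=1}^\infty$ of the dual space $Ti^*(p,\gamma)$ is subsymmetric but not symmetric, and every subsymmetric basic sequence in $Ti^*(p,\gamma)$ is equivalent to $(e^*_j)_{j=1}^\infty$.
   Context: For $1<p<\infty$, $\frac1p+\frac1q=1$ and $0<\gamma<1$, the Tirilman space $Ti(p,\gamma)$ is the completion of $c_{00}$ (finitely supported real sequences) under the norm defined implicitly by $$\|a\|=\max\Big\{\|a\|_\infty,\ \gamma\sup\frac{\sum_{j=1}^n\|E_ja\|}{n^{1/q}}\Big\},$$ where the supremum is over all $n\in\mathbb{N}$ and all finite sets of consecutive natural numbers $E_1<\dots<E_n$, and $E_ja$ denotes the restriction of $a$ to $E_j$. $(e^*_j)$ is the sequence of biorthogonal functionals to the unit vector basis $(e_j)$, a basis of the dual $Ti^*(p,\gamma)$. Two basic sequences $(x_j),(y_j)$ are equivalent if $\sum a_jx_j$ converges iff $\sum a_jy_j$ converges. A basic sequence is symmetric if it is equivalent to all its permutations, and subsymmetric if it is unconditional and equivalent to all of its subsequences. *)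

(* Defs.v *)
From HB Require Import structures.
From mathcomp Require Import all_boot all_order all_algebra.
From mathcomp Require Import all_classical all_reals all_analysis.
From Stdlib Require ClassicalEpsilon.
Set Implicit Arguments. Unset Strict Implicit. Unset Printing Implicit Defensive.
Import Order.TTheory GRing.Theory Num.Theory.
Local Open Scope classical_set_scope.
Local Open Scope ring_scope.

Section Tirilman.
Variable R : realType.

(* real sequences, indexed by nat (index 0 plays the role of index 1) *)
Definition finsupp (a : nat -> R) : Prop :=
  exists m : nat, forall j : nat, (m <= j)%N -> a j = 0.

Definition supnorm (a : nat -> R) : R := sup [set `|a j| | j in [set: nat]].

Definition restr (E : nat * nat) (a : nat -> R) : nat -> R :=
  fun j => if (E.1 <= j <= E.2)%N then a j else 0.

Definition admissible (n : nat) (E : nat -> nat * nat) : Prop :=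
  (forall i, (i < n)%N -> ((E i).1 <= (E i).2)%N) /\
  (forall i, (i.+1 < n)%N -> ((E i).2 < (E i.+1).1)%N).

(* the set whose supremum defines the norm of a, in terms of N:
   { ||a||_oo } U { gamma * (sum_j N(E_j a)) / n^(1/q) }, with 1/q = 1 - 1/p *)
Definition ti_set (p gamma : R) (N : (nat -> R) -> R) (a : nat -> R) : set R :=
  [set x | x = supnorm a \/
     exists (n : nat) (E : nat -> nat * nat),
       (0 < n)%N /\ admissible n E /\
       x = gamma * (\sum_(i < n) N (restr (E i) a)) / ((n%:R : R) `^ (1 - p^-1))].

(* N satisfies the implicit equation ||a|| = max{ ||a||_oo, gamma sup ... }
   on c00 (written as: N a is the least upper bound of ti_set) *)
Definition is_Ti_norm (p gamma : R) (N : (nat -> R) -> R) : Prop :=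
  forall a, finsupp a ->
    ubound (ti_set p gamma N a) (N a) /\
    (forall u, ubound (ti_set p gamma N a) u -> N a <= u).

Definition tinorm (p gamma : R) : (nat -> R) -> R :=
  ClassicalEpsilon.epsilon (inhabits (fun _ => 0)) (is_Ti_norm p gamma).

(* Dual space Ti^*(p,gamma): a continuous functional f is identified with the
   sequence b = (f(e_j))_j; its norm is sup { |sum_j a_j b_j| : a in c00, ||a|| <= 1 }
   (c00 is dense in Ti(p,gamma)). *)
Definition dnorm (p gamma : R) (b : nat -> R) : \bar R :=
  ereal_sup [set z : \bar R | exists (m : nat) (a : nat -> R),
     (forall j, (m <= j)%N -> a j = 0) /\ tinorm p gamma a <= 1 /\
     z = (`| \sum_(j < m) a j * b j |)%:E].

Definition inTistar (p gamma : R) (b : nat -> R) : Prop :=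
  (dnorm p gamma b < +oo)%E.

Definition psum (x : nat -> nat -> R) (c : nat -> R) (n : nat) : nat -> R :=
  fun j => \sum_(k < n) c k * x k j.

Definition sums_to (p gamma : R) (x : nat -> nat -> R) (c : nat -> R) (y : nat -> R)
  : Prop :=
  inTistar p gamma y /\
  forall eps : R, 0 < eps -> exists N : nat, forall n : nat, (N <= n)%N ->
    (dnorm p gamma (fun j => (psum x c n j - y j)%R) <= eps%:E)%E.

Definition converges (p gamma : R) (x : nat -> nat -> R) (c : nat -> R) : Prop :=
  exists y, sums_to p gamma x c y.

Definition in_closed_span (p gamma : R) (x : nat -> nat -> R) (y : nat -> R) : Prop :=
  inTistar p gamma y /\
  forall eps : R, 0 < eps -> exists (n : nat) (c : nat -> R),
    (dnorm p gamma (fun j => (psum x c n j - y j)%R) <= eps%:E)%E.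

Definition basic (p gamma : R) (x : nat -> nat -> R) : Prop :=
  (forall k, inTistar p gamma (x k)) /\
  forall y, in_closed_span p gamma x y -> exists! c : nat -> R, sums_to p gamma x c y.

Definition equivalent (p gamma : R) (x y : nat -> nat -> R) : Prop :=
  forall c : nat -> R, converges p gamma x c <-> converges p gamma y c.

Definition unconditional (p gamma : R) (x : nat -> nat -> R) : Prop :=
  forall c : nat -> R, converges p gamma x c ->
    forall pi : nat -> nat, bijective pi -> converges p gamma (x \o pi) (c \o pi).

Definition symmetric_seq (p gamma : R) (x : nat -> nat -> R) : Prop :=
  basic p gamma x /\
  forall pi : nat -> nat, bijective pi -> equivalent p gamma x (x \o pi).

Definition subsymmetric (p gamma : R) (x : nat -> nat -> R) : Prop :=
  basic p gamma x /\ unconditional p gamma x /\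
  forall sigma : nat -> nat, (forall i j, (i < j)%N -> (sigma i < sigma j)%N) ->
    equivalent p gamma x (x \o sigma).

Definition estar (k : nat) : nat -> R := fun j => if j == k then 1 else 0.

End Tirilman.

(* Main.v *)
Require Import Defs.
From HB Require Import structures.
From mathcomp Require Import all_boot all_order all_algebra.
From mathcomp Require Import all_classical all_reals all_analysis.
From mathcomp Require Import ring lra zify.
From Stdlib Require ClassicalEpsilon.
Set Implicit Arguments. Unset Strict Implicit. Unset Printing Implicit Defensive.
Import Order.TTheory GRing.Theory Num.Theory.
Local Open Scope ring_scope.

(* Let 1/p + 1/q = 1.  The norm of Ti(p, gamma) is determined by its
   implicit equation, so it can be bounded coinductively.  For small gamma, blocks in
   Ti(p, gamma) have an upper p-estimate, hence blocks in the dual have a lower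
   q-estimate.  Combinations of averages of rapidly increasing lengths show that no blocks
   in Ti(p, gamma) have a lower p-estimate with constant 1/2, and by James' distortion
   argument no blocks in the dual have an upper q-estimate.  On the other hand, blocks in
   the dual whose coordinates tend to 0 fast have an upper q-estimate.

   A subsymmetric sequence in the dual is, by a gliding hump, a perturbation of blocks
   plus a fixed vector, which must vanish by unconditionality.  Such blocks are
   dominated by (e*_j).  If their sup norms do not tend to 0, they dominate (e*_j) too;
   otherwise subsymmetry gives an upper q-estimate, which is impossible.  Symmetry of
   (e*_j) is excluded likewise, as it would transfer the upper q-estimate of flat blocks
   to (e*_j). *)

(** The upper p-estimate comes straight from the implicit equation: a family of intervals cuts a
    block sequence into end pieces, controlled by Hölder's inequality, and whole blocks, controlled
    inductively with a factor gamma. The lower p-estimate is refuted for one constant only, since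
    the bound for the averages retains terms proportional to the fixed gamma and cannot be made
    arbitrarily small. This is the obstacle that calls for distortion: from an upper q-estimate in
    the dual with any constant one passes to blocks for which the constant is sharp up to a factor
    2, and against those the constant 1/2 is enough. In the dual, the lower q-estimate does two
    further jobs. It makes tails small, so that every sequence of finite dual norm is the sum of its
    expansion and convergence along the basis is mere boundedness. And it limits the number of large
    pieces into which a flat vector can be cut, while the implicit equation bounds a sum of n pieces
    by n^(1/q); together these give the upper q-estimate for flat blocks. *)

(** * Concavity and elementary estimates for real sequences *)

Section PowerMeans.
Variable R : realType.
Implicit Types (x y s : R).

(** Young's inequality for [x^s] and [1] with the exponents [1 / s] and [1 / (1 - s)]. *)
Lemma powR_tangent x s : 0 < s < 1 -> 0 <= x -> x `^ s <= s * x + (1 - s).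
Proof.
move=> /andP[s0 s1] x0.
have h := @conjugate_powR R (x `^ s) 1 s^-1 (1 - s)^-1 (powR_ge0 _ _) ler01.
have := h _ _ _; rewrite !invr_gt0 s0 subr_gt0 s1 !invrK => /(_ isT isT).
rewrite addrC subrK => /(_ erefl).
by rewrite mulr1 powR1 -powRrM mulfV ?gt_eqF// powRr1// mul1r (mulrC x).
Qed.

(** Hölder's inequality, as concavity: the tangent bound is applied at the mean [S / n] and
    summed. *)
Lemma sum_powR_le (I : Type) (l : seq I) (F : I -> R) s : 0 < s < 1 ->
  (forall i, 0 <= F i) ->
  \sum_(i <- l) F i `^ s <= (size l)%:R `^ (1 - s) * (\sum_(i <- l) F i) `^ s.
Proof.
move=> s01 F0; have /andP[s0 s1] := s01.
set S := \sum_(i <- l) F i.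
have S0 : 0 <= S by apply: sumr_ge0.
case: (eqVneq S 0) => [SE|Sn].
  rewrite SE powR0 ?gt_eqF// mulr0.
  suff -> : \sum_(i <- l) F i `^ s = 0 by [].
  move: SE; rewrite /S; rewrite {S S0}; elim: l => [|a l IH]; first by rewrite !big_nil.
  rewrite !big_cons => /eqP; rewrite paddr_eq0 ?sumr_ge0// => /andP[/eqP-> /eqP/IH ->].
  by rewrite powR0 ?gt_eqF// addr0.
have Sp : 0 < S by rewrite lt_neqAle eq_sym Sn.
have n0 : (0 < size l)%N.
  rewrite lt0n; apply: contra_neq Sn => /size0nil l0.
  by rewrite /S l0 big_nil.
set n : R := (size l)%:R.
have np : 0 < n by rewrite ltr0n.
have Ap : 0 < S / n by rewrite divr_gt0.
have -> : n `^ (1 - s) * S `^ s = (S / n) `^ s * n.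
  rewrite powRM ?invr_ge0 ?ltW// -powR_inv1 ?ltW// -powRrM mulN1r.
  rewrite [LHS]mulrC -mulrA; congr (_ * _).
  rewrite -[X in _ = _ * X](powRr1 (ltW np)) -powRD; last by rewrite (gt_eqF np) implybT.
  by rewrite addrC.
have step i : F i `^ s <= (S / n) `^ s * (s * (F i / (S / n)) + (1 - s)).
  have -> : F i `^ s = (S / n) `^ s * (F i / (S / n)) `^ s.
    rewrite -powRM ?(ltW Ap)//; last by rewrite divr_ge0// ltW.
    by rewrite mulrC divfK// gt_eqF.
  by rewrite ler_wpM2l ?powR_ge0// powR_tangent// divr_ge0// ltW.
apply: le_trans (ler_sum _ (fun i _ => step i)) _.
rewrite -mulr_sumr ler_wpM2l ?powR_ge0// big_split/= -mulr_sumr -mulr_suml -/S.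
have -> : S / (S / n) = n by rewrite invf_div mulrCA mulfV ?mulr1.
rewrite [X in _ + X]big_const_seq.
rewrite iter_addr addr0 count_predT -mulr_natr -/n.
by rewrite -mulrDl addrC subrK mul1r.
Qed.

End PowerMeans.

(** Multiplied by the sign of its first term, the sum lies between 0 and [1 / (m + 1)]; this
    two-sided form is what the induction on the number of terms needs. *)
Lemma alternating_harmonic (R : realType) m n :
  `|\sum_(m <= k < n) (-1) ^+ k / k.+1%:R| <= (m.+1%:R)^-1 :> R.
Proof.
have [nm|mn] := leqP n m; first by rewrite big_geq// normr0 invr_ge0.
rewrite -(subnKC (ltnW mn)); move: (n - m)%N => d {mn}.
suff : 0 <= (-1 : R) ^+ m * (\sum_(m <= k < m + d) (-1) ^+ k / k.+1%:R) <= m.+1%:R^-1.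
  move=> /andP[h1 h2]; apply: le_trans h2; rewrite -[leRHS]ger0_norm//.
  by rewrite normrM normrX normrN1 expr1n mul1r.
elim: d m => [|d IH] m; first by rewrite addn0 big_geq// mulr0 lexx invr_ge0/=.
have /andP[h1 h2] := IH m.+1.
rewrite big_ltn ?addnS ?ltnS ?leq_addr// -addSn mulrDr mulrA -expr2 sqrr_sign mul1r.
move: h1 h2; rewrite exprS mulN1r mulNr; set S := _ * _ => h1 h2.
have h3 : (m.+2%:R)^-1 <= (m.+1%:R)^-1 :> R by rewrite lef_pV2 ?posrE ?ltr0n// ler_nat.
by rewrite -lerBlDr sub0r (le_trans h2)//= gerDl -oppr_ge0.
Qed.

Lemma powR_mul_compl (R : realType) (x s : R) : 0 < x -> x `^ s * x `^ (1 - s) = x.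
Proof.
move=> x0; rewrite -powRD; last by rewrite (gt_eqF x0) implybT.
by rewrite addrC subrK powRr1// ltW.
Qed.

(** The limit is the supremum of the eventual lower bounds. *)
Lemma real_cauchy (R : realType) (u : nat -> R) :
  (forall eps, 0 < eps -> exists M, forall n, (M <= n)%N -> `|u n - u M| <= eps) ->
  exists l, forall eps, 0 < eps -> exists M, forall n, (M <= n)%N -> `|u n - l| <= eps.
Proof.
move=> hu; pose A : set R := [set x | exists M, forall n, (M <= n)%N -> x <= u n]%classic.
exists (sup A) => eps e0; have [M hM] := hu _ (divr_gt0 e0 (ltr0n R 2)).
have lo n : (M <= n)%N -> u M - eps / 2 <= u n.
  by move=> /hM; rewrite ler_norml lerBrDl => /andP[]; rewrite addrC.
have hi n : (M <= n)%N -> u n <= u M + eps / 2.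
  by move=> /hM; rewrite ler_norml lerBlDl => /andP[].
have ubA : ubound A (u M + eps / 2).
  move=> x [M' hM']; apply: le_trans (hM' (maxn M M') _) _; first exact: leq_maxr.
  exact/hi/leq_maxl.
have inA : A (u M - eps / 2) by exists M.
have l1 : u M - eps / 2 <= sup A by apply: ub_le_sup => //; exists (u M + eps / 2).
have l2 : sup A <= u M + eps / 2 by apply: ge_sup => //; exists (u M - eps / 2).
by exists M => n /[dup] /lo h1 /hi h2; rewrite ler_norml; apply/andP; split; lra.
Qed.

(** * Restrictions and admissible families of intervals *)

Section Sequences.
Variable R : realType.
Implicit Types (a b : nat -> R) (E F : nat * nat) (l : seq (nat * nat)).

(* Intervals are half-open, so that empty ones are allowed. *)
Definition keep (A : nat -> bool) a : nat -> R := fun j => if A j then a j else 0.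

Definition cut (lo hi : nat) a : nat -> R := keep (fun j => lo <= j < hi)%N a.

(** Families are lists rather than indexed sequences so that they can be filtered, regrouped by
    blocks and concatenated. *)
Definition adm l : bool :=
  all (fun E => (E.1 <= E.2)%N) l && pairwise (fun E F => (E.2 <= F.1)%N) l.

Lemma adm_cons E l :
  adm (E :: l) = [&& (E.1 <= E.2)%N, all (fun F => (E.2 <= F.1)%N) l & adm l].
Proof. by rewrite /adm/= -!andbA; do ![bool_congr]; case: all => //=; rewrite ?andbF. Qed.

Lemma adm_filter (Q : pred (nat * nat)) l : adm l -> adm [seq E <- l | Q E].
Proof.
elim: l => // E l IH; rewrite adm_cons => /and3P[E12 al /IH h] /=.
case: ifP => // _; rewrite adm_cons E12 h andbT/=.
by apply/allP => F; rewrite mem_filter => /andP[_]; apply: (allP al).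
Qed.

Lemma adm_cat l1 l2 (m : nat) : adm l1 -> adm l2 ->
  all (fun E => (E.2 <= m)%N) l1 -> all (fun E => (m <= E.1)%N) l2 -> adm (l1 ++ l2).
Proof.
move=> + h2 + al2; elim: l1 => //= E l IH; rewrite !adm_cons => /and3P[E12 al h] /andP[Em alm].
rewrite E12 IH// andbT/= all_cat al/=.
by apply: sub_all al2 => F; apply: leq_trans.
Qed.

Definition partition_seq (t : nat -> nat) (n : nat) := [seq (t i, t i.+1) | i <- iota 0 n].

Lemma adm_partition (t : nat -> nat) n : (forall i k, (i <= k)%N -> (t i <= t k)%N) ->
  adm (partition_seq t n).
Proof.
move=> t_le; apply/andP; split; first by apply/allP => _ /mapP[i _ ->]/=; exact: t_le.
rewrite pairwise_map; apply/(pairwiseP 0%N) => i k; rewrite !inE size_iota => iln kn ik /=.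
by rewrite nth_iota// nth_iota//; exact: t_le.
Qed.

Lemma finsupp_keep A a : finsupp a -> finsupp (keep A a).
Proof. by case=> m h; exists m => j mj; rewrite /keep h// if_same. Qed.

Lemma finsupp_cut lo hi a : finsupp (cut lo hi a).
Proof. by exists hi => j hj; rewrite /cut/keep ltnNge hj andbF. Qed.

Lemma finsuppD a b : finsupp a -> finsupp b -> finsupp (a \+ b).
Proof.
move=> [m hm] [n hn]; exists (maxn m n) => j; rewrite geq_max => /andP[mj nj].
by rewrite /= hm// hn// addr0.
Qed.

Lemma finsupp_bound a : finsupp a -> exists X : R, forall j, `|a j| <= X.
Proof.
move=> [m hm]; exists (\sum_(i < m) `|a i|) => j.
case: (ltnP j m) => jm; last by rewrite hm// normr0 sumr_ge0.
rewrite (bigD1 (Ordinal jm))//= lerDl sumr_ge0//.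
Qed.

Lemma keepK A B a : keep A (keep B a) = keep (fun j => A j && B j) a.
Proof. by apply/funext => j; rewrite /keep; case: (A j); case: (B j). Qed.

Lemma restrE E a : (E.1 <= E.2)%N -> restr E a = cut E.1 E.2.+1 a.
Proof. by move=> E12; apply/funext => j; rewrite /restr/cut/keep ltnS. Qed.

End Sequences.

(** Serves to renumber a range of block labels from 0. Truncation on both sides keeps the new label
    monotone and bounded for every argument, and [relabel_eq] recovers the old label inside the
    range. *)
Lemma relabel_le x y c n : (x <= y)%N -> (minn (x - c) n <= minn (y - c) n)%N.
Proof. by lia. Qed.

Lemma relabel_lt x c n : (0 < n)%N -> (minn (x - c) n.-1 < n)%N.
Proof. by lia. Qed.

Lemma relabel_eq x c d i : minn (x - c.+1) (d - c.+1).-1 = i -> (c < x < d)%N ->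
  x = (i + c.+1)%N.
Proof. by lia. Qed.

(** * Increasing sequences and the blocks between their terms *)

Lemma incr_step (T : nat -> nat) : (forall i, (T i < T i.+1)%N) ->
  forall i j, (i < j)%N -> (T i < T j)%N.
Proof.
move=> h i; elim=> // j IH; rewrite ltnS leq_eqVlt => /predU1P[->//|/IH ij].
exact: ltn_trans (h j).
Qed.

Lemma sum_nat_blocks (R : realType) (F : nat -> R) (Rb : nat -> nat) (m : nat) :
  (forall i, (Rb i <= Rb i.+1)%N) ->
  \sum_(Rb 0%N <= k < Rb m) F k = \sum_(i < m) \sum_(Rb i <= k < Rb i.+1) F k.
Proof.
move=> RbS; elim: m => [|m IH]; first by rewrite big_geq// big_ord0.
rewrite big_ord_recr/= -IH (big_cat_nat (n := Rb m) (p := Rb m.+1))//.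
by elim: m {IH} => // m; move/leq_trans; apply.
Qed.

Section Blocks.
Variable T : nat -> nat.
Hypothesis T_lt : forall i j, (i < j)%N -> (T i < T j)%N.

Lemma incr_ge j : (j <= T j)%N.
Proof. by elim: j => // j IH; apply: (leq_ltn_trans IH); apply: T_lt. Qed.

Lemma incr_leE i j : (T i <= T j)%N = (i <= j)%N.
Proof.
case: (leqP i j) => [|/T_lt]; last by rewrite ltnNge => /negbTE.
by rewrite leq_eqVlt => /predU1P[->|/T_lt/ltnW]; rewrite ?leqnn.
Qed.

Lemma incr_ltE i j : (T i < T j)%N = (i < j)%N.
Proof. by rewrite !ltnNge incr_leE. Qed.

(* The index of the block [[T k, T k.+1)] containing [j], and [0] if [j < T 0]. *)
Definition blk j := find (fun k => j < T k.+1)%N (iota 0 j.+1).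

Lemma blk_le j k : (blk j <= k)%N = (j < T k.+1)%N.
Proof.
have hj : has (fun k => j < T k.+1)%N (iota 0 j.+1).
  apply/hasP; exists j; first by rewrite mem_iota/= add0n ltnS.
  exact: leq_trans (ltnSn _) (incr_ge _).
apply/idP/idP => [bk|jk].
  have := nth_find 0%N hj; rewrite -/(blk j) nth_iota ?add0n; last first.
    by rewrite -[X in (_ < X)%N](size_iota 0) -has_find.
  by move/leq_trans; apply; rewrite incr_leE.
rewrite leqNgt; apply/negP => kb.
have := before_find 0%N kb; rewrite nth_iota ?add0n ?jk//.
by apply: leq_trans kb _; rewrite -[X in (_ <= X)%N](size_iota 0) find_size.
Qed.

Lemma blk_homo i j : (i <= j)%N -> (blk i <= blk j)%N.
Proof. by move=> ij; rewrite blk_le (leq_ltn_trans ij)// -blk_le. Qed.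

Lemma blk_eq j k : (T 0 <= j)%N -> (blk j == k) = (T k <= j < T k.+1)%N.
Proof.
move=> Tj; rewrite eqn_leq blk_le andbC; congr (_ && _); case: k => [|k]; first by rewrite Tj.
by rewrite ltnNge blk_le -leqNgt.
Qed.

Lemma blkP j : (T 0 <= j)%N -> (T (blk j) <= j < T (blk j).+1)%N.
Proof. by move=> Tj; rewrite -blk_eq. Qed.

Lemma blk_ltE j n : (T 0 <= j)%N -> (0 < n)%N -> (blk j < n)%N = (j < T n)%N.
Proof. by move=> Tj; case: n => // n _; rewrite ltnS blk_le. Qed.

Lemma sum_blocks (R : realType) (F : nat -> nat -> R) (m n j : nat) :
  \sum_(m <= k < n) (if (T k <= j < T k.+1)%N then F k j else 0) =
  if (T m <= j < T n)%N then F (blk j) j else 0.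
Proof.
case: (leqP (T 0) j) => Tj; last first.
  have jT k : (T k <= j)%N = false.
    by apply/negbTE; rewrite -ltnNge (leq_trans Tj)// incr_leE.
  by rewrite big1 ?jT// => k _; rewrite jT.
under eq_bigr => k _ do rewrite -blk_eq// eq_sym.
rewrite -big_mkcond/= -big_filter.
have -> : (T m <= j < T n)%N = (blk j \in index_iota m n).
  have /andP[b1 b2] := blkP Tj; rewrite mem_index_iota; apply/andP/andP => -[h1 h2]; split.
  - by rewrite -ltnS -incr_ltE (leq_ltn_trans h1).
  - by rewrite -incr_ltE (leq_ltn_trans b1).
  - by apply: leq_trans b1; rewrite incr_leE.
  - by apply: leq_trans b2 _; rewrite incr_leE.
case: ifPn => bj.
  rewrite (@eq_filter _ _ (pred1 (blk j)))//.
  by rewrite filter_pred1_uniq ?iota_uniq// big_seq1.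
rewrite big_filter big1_seq// => k /andP[/eqP ->]; by rewrite (negbTE bj).
Qed.

End Blocks.

(** * Weak-star cluster points, subsequences and block permutations *)

Section ClusterPoint.
Import numFieldNormedType.Exports.

(** Tychonoff's theorem for the cube with sides [[-M, M]]. A cluster point suffices, since the
    gliding hump only ever asks for one later index that is close on finitely many coordinates. *)
Lemma cluster_point (R : realType) (x : nat -> nat -> R) (M : R) :
  (forall k j, `|x k j| <= M) ->
  exists z : nat -> R, forall m (eps : R) K, 0 < eps ->
    exists k, (K <= k)%N /\ forall j, (j < m)%N -> `|x k j - z j| <= eps.
Proof.
move=> xM.
have cpt := @tychonoff nat (fun=> R : topologicalType) (fun=> `[- M, M]%classic)
  (fun=> @segment_compact R (- M) M).
pose F : set_system (prod_topology (fun _ : nat => R)) :=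
  fmap (x : nat -> prod_topology (fun _ : nat => R)) (nbhs \oo%classic).
have FF : ProperFilter F by exact: fmap_proper_filter.
have FA : F [set f | forall j, `[- M, M]%classic (f j)]%classic.
  by exists 0%N => // k _ j /=; rewrite in_itv/= -ler_norml.
have [z [_ cz]] := cpt F FF FA.
exists z => m eps K e0.
have nb : nbhs (z : prod_topology (fun _ : nat => R))
    [set f | forall j, (j < m)%N -> `|f j - z j| <= eps]%classic.
  pose zT : prod_topology (fun _ : nat => R) := z.
  have NF : Filter (nbhs zT) by exact: nbhs_filter.
  elim: m => [|m IH]; first by apply: (@filterS _ _ NF setT _ _ (@filterT _ _ NF)) => f _ j.
  have nm := @proj_continuous nat (fun=> R) m zT _ (nbhsx_ballx (z m) eps e0).
  apply: (@filterS _ _ NF _ _ _ (@filterI _ _ NF _ _ IH nm)) => f [fm fb] j.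
  rewrite ltnS leq_eqVlt => /predU1P[->|/fm//].
  by move: fb; rewrite /ball/= distrC => /ltW.
have FK : F [set f | exists2 k, (K <= k)%N & f = x k]%classic.
  by exists K => // k Kk; exists k.
by have [f [[k Kk ->] hf]] := cz _ _ FK nb; exists k.
Qed.

End ClusterPoint.

Lemma pick_incr (P : nat -> nat -> Prop) :
  (forall k K, exists j, (K <= j)%N /\ P k j) ->
  exists2 sigma : nat -> nat, forall i j, (i < j)%N -> (sigma i < sigma j)%N &
    forall k, P k (sigma k).
Proof.
move=> h; have /choice[g hg] : forall kK : nat * nat, exists j, (kK.2 <= j)%N /\ P kK.1 j.
  by move=> kK; exact: h.
pose fix sigma k := if k is k'.+1 then g (k, (sigma k').+1) else g (0, 0)%N.
exists sigma; first by apply: incr_step => i /=; case: (hg (i.+1, (sigma i).+1)).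
by case=> [|k] /=; [case: (hg (0, 0)%N)|case: (hg (k.+1, (sigma k).+1))].
Qed.

(* Rearranging the blocks [[t i, t i.+1)] so that the elements of [A] come first. *)
Lemma block_perm (t : nat -> nat) (A : nat -> bool) : t 0%N = 0%N ->
  (forall i, (t i < t i.+1)%N) ->
  exists2 pi : nat -> nat, bijective pi & forall i,
    exists2 q, (t i + q <= t i.+1)%N & forall (R : realType) (F : nat -> R),
      \sum_(t i <= k < t i + q) F (pi k) = \sum_(t i <= k < t i.+1 | A k) F k.
Proof.
move=> t0 tS; have t_lt := incr_step tS.
pose I i := index_iota (t i) (t i.+1).
pose S i := [seq k <- I i | A k] ++ [seq k <- I i | ~~ A k].
have pS i : perm_eq (S i) (I i) by rewrite /S perm_filterC.
have szS i : size (S i) = (t i.+1 - t i)%N by rewrite (perm_size (pS i)) size_iota.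
have uS i : uniq (S i) by rewrite (perm_uniq (pS i)) iota_uniq.
have mS i k : (k \in S i) = (t i <= k < t i.+1)%N by rewrite (perm_mem (pS i)) mem_index_iota.
pose b := blk t.
have T0 j : (t 0%N <= j)%N by rewrite t0.
have hb j : (t (b j) <= j < t (b j).+1)%N by exact: blkP.
have bE i j : (t i <= j < t i.+1)%N -> b j = i by move=> h; apply/eqP; rewrite /b blk_eq.
pose pi j := nth 0%N (S (b j)) (j - t (b j)).
have rlt j : (j - t (b j) < size (S (b j)))%N.
  by have /andP[h1 h2] := hb j; rewrite szS ltn_sub2r// tS.
have bpi j : b (pi j) = b j by apply: bE; rewrite -mS mem_nth.
have pi_inj : injective pi.
  move=> j j' e; have eb : b j = b j' by rewrite -bpi e bpi.
  have := rlt j; have := rlt j'; move: e; rewrite /pi eb => /eqP + h1 h2.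
  rewrite nth_uniq// => /eqP e.
  have /andP[k1 _] := hb j; have /andP[k2 _] := hb j'; rewrite eb in k1.
  by rewrite -(subnKC k1) e subnKC.
have /choice[rho rhoK] : forall j, exists k, pi k = j.
  move=> j; have jS : j \in S (b j) by rewrite mS.
  exists (t (b j) + index j (S (b j)))%N.
  have ix : (index j (S (b j)) < size (S (b j)))%N by rewrite index_mem.
  have e : b (t (b j) + index j (S (b j))) = b j.
    apply: bE; rewrite leq_addr/=; move: ix; rewrite szS => /leq_trans -/(_ _ (leqnn _)).
    by rewrite -ltn_subRL.
  by rewrite /pi e addKn nth_index.
exists pi; first by exists rho => // j; apply: pi_inj; rewrite rhoK.
move=> i; pose q := size [seq k <- I i | A k]; exists q.
  rewrite -leq_subRL ?(ltnW (tS i))// -szS /S size_cat; exact: leq_addr.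
move=> R F; rewrite -[RHS]big_filter (big_nth 0%N) -/q -{1}[t i]add0n big_addn addKn.
rewrite big_nat [RHS]big_nat; apply: eq_bigr => r /andP[_ rq].
have rs : (r < t i.+1 - t i)%N by rewrite -szS /S size_cat; apply: leq_trans rq (leq_addr _ _).
have e : b (r + t i)%N = i by apply: bE; rewrite leq_addl/= addnC -ltn_subRL.
by rewrite /pi e addnK /S nth_cat rq.
Qed.

(** * The implicit norm: existence and first properties *)

Section Norm.
Variable R : realType.
Variables p gamma : R.
Hypothesis hp : 1 < p.
Hypothesis hgamma : 0 < gamma < 1.
(* [s] is [1 / q], so that [s^-1] is the conjugate exponent [q]. *)
Let s : R := 1 - p^-1.
Implicit Types (a b : nat -> R) (l : seq (nat * nat)) (X : R).

Lemma s_gt0 : 0 < s.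
Proof. by rewrite subr_gt0 invf_lt1// (lt_trans ltr01). Qed.

Lemma s_lt1 : s < 1.
Proof. by rewrite ltrBlDr ltrDl invr_gt0 (lt_trans ltr01). Qed.

Lemma s_itv : 0 < s < 1. Proof. by rewrite s_gt0 s_lt1. Qed.

Lemma gamma_gt0 : 0 < gamma. Proof. by case/andP: hgamma. Qed.
Lemma gamma_lt1 : gamma < 1. Proof. by case/andP: hgamma. Qed.

Lemma sum_supp_indep (F : nat -> R) (m n : nat) :
  (forall j, (m <= j)%N -> F j = 0) -> (forall j, (n <= j)%N -> F j = 0) ->
  \sum_(j < m) F j = \sum_(j < n) F j.
Proof.
wlog mn : m n / (m <= n)%N => [H|] hm hn.
  by case: (leqP m n) => [/H|/ltnW/H h]; [exact|rewrite h].
rewrite -!(big_mkord xpredT F) (big_cat_nat (n := m) (p := n))//=.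
rewrite [X in _ + X]big1_seq ?addr0// => j /=; rewrite mem_index_iota => /andP[mj _].
exact: hm.
Qed.

Lemma sum_cut (lo hi m : nat) (F : nat -> R) : (hi <= m)%N ->
  \sum_(j < m) (if (lo <= j < hi)%N then F j else 0) = \sum_(lo <= j < hi) F j.
Proof.
move=> hm; rewrite [RHS](big_nat_widen _ _ _ _ _ hm) [RHS](big_nat_widenl _ 0)//.
rewrite big_mkord [RHS]big_mkcond/=.
by apply: eq_bigr => j _; rewrite andbC.
Qed.

Lemma powR_unbounded (t X : R) : 0 < t -> exists n : nat, (0 < n)%N /\ X < n%:R `^ t.
Proof.
move=> t0; set Y := (`|X| + 1) `^ t^-1.
have := archi_boundP (powR_ge0 (`|X| + 1) t^-1); rewrite -/Y; set n := Num.bound _ => Yn.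
have n0 : (0 < n)%N by rewrite -(ltr0n R) (le_lt_trans _ Yn)// powR_ge0.
exists n; split => //.
apply: (@le_lt_trans _ _ (Y `^ t)); last by apply: gt0_ltr_powR; rewrite ?nnegrE ?powR_ge0.
rewrite /Y -powRrM mulVf ?gt_eqF// powRr1 ?addr_ge0//.
by rewrite (le_trans (ler_norm _))// lerDl.
Qed.

Lemma size_powR_ge1 (n : nat) : (0 < n)%N -> 1 <= n%:R `^ s.
Proof.
move=> n0; apply: (@le_trans _ _ (1 `^ s)); first by rewrite powR1.
apply: ge0_ler_powR; rewrite ?nnegrE//.
- exact/ltW/s_gt0.
- by rewrite ler1n.
Qed.

Lemma supnormP a : finsupp a ->
  (forall j, `|a j| <= supnorm a) /\ (forall X, (forall j, `|a j| <= X) -> supnorm a <= X).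
Proof.
move=> /finsupp_bound[Y hY]; split => [j|X hX].
  by apply: ub_le_sup; [exists Y => _ [k _ <-]|exists j].
by apply: ge_sup; [exists `|a 0%N|, 0%N|move=> _ [k _ <-]].
Qed.

Section Existence.
Let super (Phi : (nat -> R) -> R) :=
  forall a, finsupp a -> ubound (ti_set p gamma Phi a) (Phi a).

Lemma finsupp_restr E a : finsupp a -> finsupp (restr E a).
Proof. exact: finsupp_keep. Qed.

Let ti_set_le Phi Psi a X : finsupp a -> (forall b, finsupp b -> Phi b <= Psi b) ->
  ubound (ti_set p gamma Psi a) X -> ubound (ti_set p gamma Phi a) X.
Proof.
move=> fa le ub x [->|[n [E [n0 [aE ->]]]]]; first by apply: ub; left.
apply: (@le_trans _ _ (gamma * (\sum_(i < n) Psi (restr (E i) a)) / n%:R `^ s)).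
  rewrite ler_wpM2r ?invr_ge0 ?powR_ge0// ler_wpM2l ?(ltW gamma_gt0)//.
  by apply: ler_sum => i _; apply: le; exact: finsupp_restr.
by apply: ub; right; exists n, E.
Qed.

(** A super-solution, so that the infimum in [is_Ti_norm_tinorm] is over a nonempty set. It has to
    be a total function, hence the dummy value off c00. *)
Let l1 a : R := if pselect (finsupp a) is left h then \sum_(j < sval (cid h)) `|a j| else 0.

Let l1E a m : (forall j, (m <= j)%N -> a j = 0) -> l1 a = \sum_(j < m) `|a j|.
Proof.
rewrite /l1 => hm; case: pselect => [h|]; last by case; exists m.
case: cid => n hn /=; apply: (sum_supp_indep (F := fun j => `|a j|)) => j jm.
  by rewrite hn// normr0.
by rewrite hm// normr0.
Qed.

Let in_one n (E : nat -> nat * nat) j : admissible n E ->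
  (\sum_(i < n) ((E i).1 <= j <= (E i).2) <= 1)%N.
Proof.
elim: n => [|n IH] [h1 h2]; first by rewrite big_ord0.
rewrite big_ord_recr/=; case: (boolP ((E n).1 <= j <= (E n).2)%N) => [/andP[jn _]|_]; last first.
  by rewrite addn0 IH//; split => i ?; [apply: h1|apply: h2]; exact: ltnW.
rewrite big1 // => i _; apply/eqP; rewrite eqb0; apply/negP => /andP[_ ji].
have : forall k, (i < k)%N -> (k < n.+1)%N -> ((E i).2 < (E k).1)%N.
  elim=> // k IHk; rewrite ltnS leq_eqVlt => /predU1P[<-|ik] kn; first exact: h2.
  by apply: (leq_trans (IHk ik (ltnW kn))); apply: (leq_trans (h1 _ (ltnW kn))); apply/ltnW/h2.
move=> /(_ n (ltn_ord i) (ltnSn n)) lt; move: (leq_trans lt jn); by rewrite ltnNge ji.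
Qed.

Let super_l1 : super l1.
Proof.
move=> a fa x; have [m hm] := fa; rewrite (l1E hm) => -[->|[n [E [n0 [aE ->]]]]].
  apply: (supnormP fa).2 => j; case: (ltnP j m) => jm; last by rewrite hm// normr0 sumr_ge0.
  by rewrite (bigD1 (Ordinal jm))//= lerDl sumr_ge0.
have s1 := size_powR_ge1 n0.
rewrite ler_pdivrMr ?(lt_le_trans ltr01)//.
apply: (@le_trans _ _ (\sum_(i < n) l1 (restr (E i) a))).
  rewrite ler_piMl ?(ltW gamma_lt1)// sumr_ge0// => i _; rewrite /l1; case: pselect => // h.
  exact: sumr_ge0.
apply: (@le_trans _ _ (\sum_(j < m) `|a j|)); last by rewrite ler_peMr// sumr_ge0.
have l1r i : l1 (restr (E i) a) = \sum_(j < m) `|restr (E i) a j|.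
  by apply: l1E => j mj; rewrite /restr hm// if_same.
rewrite (eq_bigr _ (fun i _ => l1r (nat_of_ord i))).
rewrite exchange_big/=; apply: ler_sum => j _.
rewrite (eq_bigr (fun i : 'I_n => `|a j| *+ ((E i).1 <= j <= (E i).2)%N)); last first.
  by move=> i _; rewrite /restr; case: ifP; rewrite ?mulr0n ?normr0.
by rewrite sumrMnr; case: (\sum_(_ | _) _)%N (in_one j aE) => [|[|//]] _; rewrite ?mulr0n.
Qed.

(** Since [tinorm] is chosen by epsilon, some solution must be exhibited. In the manner of Knaster
    and Tarski, the pointwise infimum [N] of all super-solutions is one: it is itself a
    super-solution, and so is the right-hand side [T] of the equation evaluated at [N], whence
    [N <= T] on c00. *)
Lemma is_Ti_norm_tinorm : is_Ti_norm p gamma (tinorm p gamma).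
Proof.
rewrite /tinorm; apply: ClassicalEpsilon.epsilon_spec.
pose N a := inf [set Phi a | Phi in super].
have lb a : finsupp a -> has_lbound [set Phi a | Phi in super].
  move=> fa; exists 0 => _ [Phi sPhi <-]; apply: le_trans (sPhi _ fa _ (or_introl erefl)).
  exact: le_trans ((supnormP fa).1 0%N).
have Nle Phi a : super Phi -> finsupp a -> N a <= Phi a.
  by move=> sPhi fa; apply: inf_lbound; [exact: lb|exists Phi].
have leN a X : (forall Phi, super Phi -> X <= Phi a) -> X <= N a.
  move=> h; apply: lb_le_inf; first by exists (l1 a); exists l1 => //; exact: super_l1.
  by move=> _ [Phi sPhi <-]; exact: h.
have sN : super N.
  move=> a fa x xN; apply: leN => Phi sPhi.
  by apply: (ti_set_le fa (fun b => Nle Phi b sPhi) (sPhi a fa)).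
exists N => a fa; split; first exact: sN.
pose T b := sup (ti_set p gamma N b).
have ub b : finsupp b -> has_ubound (ti_set p gamma N b) by move=> fb; exists (N b); exact: sN.
have TN b : finsupp b -> T b <= N b.
  by move=> fb; apply: ge_sup; [exists (supnorm b); left|exact: sN].
have sT : super T.
  move=> b fb; apply: (ti_set_le fb TN) => x xb; exact: (ub_le_sup (ub _ fb) xb).
move=> u hu; apply: (le_trans (Nle _ _ sT fa)).
by apply: ge_sup => //; exists (supnorm a); left.
Qed.

End Existence.

Let N := tinorm p gamma.

Lemma tinorm_coord a j : finsupp a -> `|a j| <= N a.
Proof.
move=> fa; apply: le_trans ((supnormP fa).1 j) _.
by apply: (is_Ti_norm_tinorm fa).1; left.
Qed.

Lemma finsupp0 : finsupp (fun=> 0 : R). Proof. by exists 0%N. Qed.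
Hint Resolve finsupp0 : core.

Lemma tinorm_ge0 a : finsupp a -> 0 <= N a.
Proof. by move=> fa; exact: le_trans (tinorm_coord 0%N fa). Qed.

(** All restrictions of 0 are 0, so [n] singletons give [gamma * n^(1 - s) * N 0 <= N 0]; as
    [n^(1 - s)] is unbounded, [N 0] cannot be positive. *)
Lemma tinorm0 : N (fun=> 0) = 0.
Proof.
apply/eqP; rewrite eq_le tinorm_ge0// andbT leNgt; apply/negP => N0.
have s1 : 0 < 1 - s by rewrite subr_gt0 s_lt1.
have [n [n0 hn]] := powR_unbounded gamma^-1 s1.
pose E (i : nat) := (i, i).
have ubE : gamma * (\sum_(i < n) N (restr (E i) (fun=> 0))) / n%:R `^ s <= N (fun=> 0).
  by apply: (is_Ti_norm_tinorm finsupp0).1; right; exists n, E.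
have r0 i : restr (E i) (fun=> 0 : R) = fun=> 0 by apply/funext => j; rewrite /restr if_same.
move: ubE; under eq_bigr => i _ do rewrite r0.
rewrite sumr_const card_ord -mulr_natl leNgt => /negP; apply.
have nR : (0 : R) < n%:R by rewrite ltr0n.
have ns0 : 0 < n%:R `^ s by rewrite powR_gt0.
rewrite mulr1 ltr_pdivlMr// -[N _ *+ n]mulr_natl -{2}(powR_mul_compl s nR) (mulrC (N _)) -!mulrA.
rewrite (mulrCA gamma) ltr_pM2l// mulrA ltr_pMl// -ltr_pdivrMl ?gamma_gt0//.
by rewrite mulr1.
Qed.

(** The upper-bound half of the implicit equation, without division and with empty intervals
    allowed: these contribute 0, and dropping them only lowers [size l]. *)
Lemma tinorm_cut_sum a l : finsupp a -> adm l ->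
  gamma * (\sum_(E <- l) N (cut E.1 E.2 a)) <= (size l)%:R `^ s * N a.
Proof.
move=> fa al.
pose l' := [seq E <- l | E.1 < E.2]%N.
have -> : \sum_(E <- l) N (cut E.1 E.2 a) = \sum_(E <- l') N (cut E.1 E.2 a).
  rewrite big_filter [RHS]big_mkcond; apply: eq_bigr => E _; case: ltnP => // EE.
  rewrite (_ : cut E.1 E.2 a = fun=> 0) ?tinorm0//.
  by apply/funext => j; rewrite /cut/keep; case: ifP => // /andP[j1 j2]; lia.
have l'l : (size l' <= size l)%N by rewrite size_filter count_size.
have al' : adm l' by exact: adm_filter.
apply: (@le_trans _ _ ((size l')%:R `^ s * N a)); last first.
  rewrite ler_wpM2r ?tinorm_ge0//; apply: ge0_ler_powR; rewrite ?nnegrE ?ler_nat//.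
  exact/ltW/s_gt0.
have ne : all (fun E : nat * nat => E.1 < E.2)%N l' by exact: filter_all.
move: (l') al' ne => {l'l al}l' /andP[al' pw] ne.
have [->|n0] := eqVneq l' [::].
  by rewrite big_nil mulr0 mulr_ge0 ?powR_ge0 ?tinorm_ge0.
rewrite -size_eq0 -lt0n in n0.
pose E i := let e := nth (0, 1)%N l' i in (e.1, e.2.-1).
have neE i : (i < size l')%N -> ((nth (0, 1) l' i).1 < (nth (0, 1) l' i).2)%N.
  by move=> il; exact: (all_nthP _ ne).
have := (is_Ti_norm_tinorm fa).1 (gamma * (\sum_(i < size l') N (restr (E i) a)) / (size l')%:R `^ s).
rewrite ler_pdivrMr ?powR_gt0 ?ltr0n// [X in _ <= X]mulrC.
rewrite (big_nth (0, 1)%N) big_mkord.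
have -> : \sum_(i < size l') N (cut (nth (0, 1)%N l' i).1 (nth (0, 1)%N l' i).2 a) =
    \sum_(i < size l') N (restr (E i) a).
  apply: eq_bigr => i _; congr (tinorm p gamma _).
  have lt := neE i (ltn_ord i); have := ltn_predK lt => pK.
  by rewrite restrE ?pK//= -ltnS pK.
apply; right; exists (size l'), E; split => //; split => //; split.
  by move=> i il /=; have := neE i il => lt; rewrite -ltnS (ltn_predK lt).
move=> i il /=; have lt := neE i (ltnW il); rewrite (ltn_predK lt).
by move/(pairwiseP (0, 1)%N): pw; apply; rewrite ?inE// ltnW.
Qed.

(** * Coinductive bounds for the norm *)

Lemma tinorm_least a X : finsupp a -> (forall j, `|a j| <= X) ->
  (forall l, adm l -> gamma * (\sum_(E <- l) N (cut E.1 E.2 a)) <= (size l)%:R `^ s * X) ->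
  N a <= X.
Proof.
move=> fa aX lX; apply: (is_Ti_norm_tinorm fa).2 => x [->|[n [E [n0 [[E1 E2] ->]]]]].
  exact: (supnormP fa).2.
rewrite ler_pdivrMr ?powR_gt0 ?ltr0n// [X in _ <= X]mulrC.
pose l := [seq ((E i).1, (E i).2.+1) | i <- iota 0 n].
have szl : size l = n by rewrite size_map size_iota.
have ltE i k : (i < k)%N -> (k < n)%N -> ((E i).2 < (E k).1)%N.
  elim: k => // k IHk; rewrite ltnS leq_eqVlt => /predU1P[<-|ik] kn; first exact: E2.
  by apply: (leq_trans (IHk ik (ltnW kn))); apply: (leq_trans (E1 _ (ltnW kn))); apply/ltnW/E2.
have al : adm l.
  apply/andP; split; first by apply/allP => _ /mapP[i + ->]; rewrite mem_iota => /E1/= /leqW.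
  rewrite pairwise_map; apply/(pairwiseP 0%N) => i k; rewrite !inE size_iota => iln kn ik /=.
  by rewrite !nth_iota//; exact: ltE.
have := lX _ al; rewrite szl; apply: le_trans; rewrite big_map.
rewrite (_ : iota 0 n = index_iota 0 n) ?big_mkord; last by rewrite /index_iota subn0.
by rewrite ler_wpM2l ?(ltW gamma_gt0).
Qed.

(** Induction on the number of nonzero coordinates of [a]. If every interval of an admissible family
    misses one of them, the induction hypothesis applies to all pieces. Otherwise one interval
    retains all of [a] and the others see 0; such a family yields at most [gamma * N a], which is
    absorbed because [gamma < 1]. *)
Lemma tinorm_coind (P : (nat -> R) -> R -> Prop) :
  (forall a X, P a X -> finsupp a /\ forall j, `|a j| <= X) ->
  (forall a X l, P a X -> adm l -> exists Xs : nat * nat -> R,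
     (forall E, E \in l -> P (cut E.1 E.2 a) (Xs E)) /\
     gamma * (\sum_(E <- l) Xs E) <= (size l)%:R `^ s * X) ->
  forall a X, P a X -> N a <= X.
Proof.
move=> P1 P2 a X PaX; have [[m hm] _] := P1 _ _ PaX.
have [k] := ubnP (count (fun j => a j != 0) (iota 0 m)).
elim: k a X PaX hm => // k IH a X PaX hm ltk.
have [fa aX] := P1 _ _ PaX; have X0 : 0 <= X by exact: le_trans (aX 0%N).
have g0 := gamma_gt0.
suff : N a <= Num.max X (gamma * N a).
  rewrite le_max => /orP[//|]; rewrite -subr_le0 -{1}[N a]mul1r -mulrBl pmulr_rle0 ?subr_gt0 ?gamma_lt1//.
  by move/le_trans; apply.
apply: tinorm_least => // [j|l al]; first by rewrite le_max aX.
have [[E0 E0l E0a]|ne] := pselect (exists2 E, E \in l & cut E.1 E.2 a = a).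
  have l1 : (0 < size l)%N by case: (l) E0l.
  apply: (@le_trans _ _ (gamma * N a)); last first.
    apply: (@le_trans _ _ (Num.max X (gamma * N a))); first by rewrite le_max lexx orbT.
    by rewrite ler_peMl ?size_powR_ge1// le_max X0.
  rewrite ler_wpM2l ?(ltW g0)//.
  have cut0 E : (E.2 <= E0.1)%N || (E0.2 <= E.1)%N -> N (cut E.1 E.2 a) = 0.
    move=> dis; rewrite -E0a /cut keepK -[RHS]tinorm0; congr (N _); apply/funext => j; rewrite /keep.
    case: ifP => // /andP[/andP[j1 j2] /andP[j3 j4]]; case/orP: dis => dis.
      by move: (leq_trans j2 dis); rewrite ltnNge j3.
    by move: (leq_trans j4 dis); rewrite ltnNge j1.
  case/splitPr: E0l al {l1} => l1 l2 /andP[_]; rewrite pairwise_cat/= allrel_consr.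
  move=> /and3P[/andP[/allP a1 _] _ /andP[/allP a2 _]].
  have s1 : \sum_(E <- l1) N (cut E.1 E.2 a) = 0.
    by rewrite big1_seq// => E /= El; rewrite cut0// a1.
  have s2 : \sum_(E <- l2) N (cut E.1 E.2 a) = 0.
    by rewrite big1_seq// => E /= El; rewrite cut0// a2 ?orbT.
  by rewrite big_cat big_cons/= E0a s1 s2 addr0 add0r.
have [Xs [PXs sXs]] := P2 _ _ _ PaX al.
apply: (@le_trans _ _ (gamma * \sum_(E <- l) Xs E)); last first.
  by apply: (le_trans sXs); rewrite ler_wpM2l ?powR_ge0// le_max lexx.
rewrite ler_wpM2l ?(ltW g0)// big_seq [leRHS]big_seq; apply: ler_sum => E El.
apply: (IH _ _ (PXs _ El)); first by move=> j mj; rewrite /cut/keep hm// if_same.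
rewrite (@leq_trans (count (fun j => a j != 0) (iota 0 m)))//.
have [j jm]: exists2 j, (j < m)%N & (a j != 0) && ~~ (E.1 <= j < E.2)%N.
  apply: contrapT => no; apply: ne; exists E => //; apply/funext => j; rewrite /cut/keep.
  case: ifP => // /negbT jE; apply/esym/eqP; apply: contrapT => /negP aj0; apply: no.
  exists j; last by rewrite aj0.
  by rewrite ltnNge; apply: contra aj0 => /hm ->.
move=> /andP[aj jE].
rewrite -(subnKC jm) addSnnS iotaD !count_cat /= add0n /cut /keep (negbTE jE) eqxx aj /= add0n add1n.
by rewrite addnS ltnS leq_add//; apply: sub_count => i /=; case: ifP => //; rewrite eqxx.
Qed.

Lemma tinorm_le a b : finsupp b -> (forall j, `|a j| <= `|b j|) -> N a <= N b.
Proof.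
move=> fb ab.
apply: (tinorm_coind (P := fun a X => exists b, [/\ finsupp b, forall j, `|a j| <= `|b j| & X = N b])).
- move=> {fb ab}a X [{}b [fb ab ->]]; split => [|j]; last exact: le_trans (ab j) (tinorm_coord j fb).
  by have [m hm] := fb; exists m => j mj; apply/eqP; rewrite -normr_le0 (le_trans (ab j))// hm// normr0.
- move=> {fb ab}a X l [{}b [fb ab ->]] al; exists (fun E => N (cut E.1 E.2 b)); split.
    move=> E _; exists (cut E.1 E.2 b); split => [|j|//]; first exact: finsupp_cut.
    by rewrite /cut/keep; case: ifP.
  exact: tinorm_cut_sum.
- by exists b.
Qed.

Lemma tinorm_keep A a : finsupp a -> N (keep A a) <= N a.
Proof. by move=> fa; apply: tinorm_le => // j; rewrite /keep; case: ifP => // _; rewrite normr0. Qed.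

Lemma tinormD a b : finsupp a -> finsupp b -> N (a \+ b) <= N a + N b.
Proof.
move=> fa fb.
apply: (tinorm_coind (P := fun c X =>
  exists a b, [/\ finsupp a, finsupp b, c = a \+ b & X = N a + N b])).
- move=> _ _ [{fa}a [{fb}b [fa fb -> ->]]]; split => [|j]; first exact: finsuppD.
  by rewrite (le_trans (ler_normD _ _))// lerD// tinorm_coord.
- move=> _ _ l [{fa}a [{fb}b [fa fb -> ->]]] al.
  exists (fun E => N (cut E.1 E.2 a) + N (cut E.1 E.2 b)); split.
    move=> E _; exists (cut E.1 E.2 a), (cut E.1 E.2 b); split => //; try exact: finsupp_cut.
    by apply/funext => j; rewrite /cut/keep/=; case: ifP => //; rewrite addr0.
  by rewrite big_split/= !mulrDr lerD// tinorm_cut_sum.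
- by exists a, b.
Qed.

Lemma finsuppZ (c : R) a : finsupp a -> finsupp (fun j => c * a j).
Proof. by move=> [m hm]; exists m => j mj; rewrite hm// mulr0. Qed.

Lemma tinormZ (c : R) a : finsupp a -> N (fun j => c * a j) <= `|c| * N a.
Proof.
move=> fa.
apply: (tinorm_coind (P := fun b X =>
  exists a, [/\ finsupp a, b = (fun j => c * a j) & X = `|c| * N a])).
- move=> _ _ [{fa}a [fa -> ->]]; split => [|j]; first exact: finsuppZ.
  by rewrite normrM ler_wpM2l// tinorm_coord.
- move=> _ _ l [{fa}a [fa -> ->]] al.
  exists (fun E => `|c| * N (cut E.1 E.2 a)); split.
    move=> E _; exists (cut E.1 E.2 a); split => //; try exact: finsupp_cut.
    by apply/funext => j; rewrite /cut/keep/=; case: ifP => //; rewrite mulr0.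
  by rewrite -mulr_sumr mulrCA [leRHS]mulrCA ler_wpM2l// tinorm_cut_sum.
- by exists a.
Qed.

Lemma sum_cut_norm_le l a j : adm l ->
  \sum_(E <- l) `|cut E.1 E.2 a j| <= `|a j|.
Proof.
elim: l => [|E l IH]; first by rewrite big_nil.
rewrite adm_cons big_cons => /and3P[E12 /allP al aal].
rewrite {1}/cut/keep; case: ifP => [/andP[_ jE]|_]; last by rewrite normr0 add0r IH.
rewrite big1_seq ?addr0// => F /= Fl; rewrite /cut/keep.
by rewrite leqNgt (leq_trans jE (al _ Fl))/= normr0.
Qed.

Lemma tinorm_l1 a (m : nat) : (forall j, (m <= j)%N -> a j = 0) ->
  N a <= \sum_(j < m) `|a j|.
Proof.
move=> hm.
apply: (tinorm_coind (P := fun a X =>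
  (forall j, (m <= j)%N -> a j = 0) /\ X = \sum_(j < m) `|a j|)) => //.
- move=> {hm}a _ [hm ->]; split => [|j]; first by exists m.
  case: (ltnP j m) => jm; last by rewrite hm// normr0 sumr_ge0.
  by rewrite (bigD1 (Ordinal jm))//= lerDl sumr_ge0.
- move=> {hm}a _ l [hm ->] al; exists (fun E => \sum_(j < m) `|cut E.1 E.2 a j|); split.
    by move=> E _; split => // j mj; rewrite /cut/keep hm ?if_same.
  case: l al => [|E l] al; first by rewrite big_nil mulr0 mulr_ge0 ?powR_ge0 ?sumr_ge0.
  apply: (@le_trans _ _ (\sum_(j < m) `|a j|)); last first.
    by rewrite ler_peMl ?size_powR_ge1// sumr_ge0.
  rewrite exchange_big/=; apply: (@le_trans _ _ (\sum_(j < m) \sum_(E <- E :: l) `|cut E.1 E.2 a j|)).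
    by rewrite ler_piMl ?(ltW gamma_lt1)// !sumr_ge0// => j _; rewrite sumr_ge0.
  by apply: ler_sum => j _; exact: sum_cut_norm_le.
Qed.

(** * Spreading invariance and block norms *)

Section Spread.
Variable sigma : nat -> nat.
Hypothesis sigma_lt : forall i j, (i < j)%N -> (sigma i < sigma j)%N.
Let incr_ge := incr_ge sigma_lt.
Let incr_leE := incr_leE sigma_lt.
Let incr_ltE := incr_ltE sigma_lt.

Lemma finsupp_comp_incr a : finsupp a -> finsupp (a \o sigma).
Proof. by move=> [m hm]; exists m => j mj /=; rewrite hm// (leq_trans mj)// incr_ge. Qed.

Lemma tinorm_comp_incr a : finsupp a -> N (a \o sigma) <= N a.
Proof.
move=> fa.
apply: (tinorm_coind (P := fun b X => exists a, [/\ finsupp a, b = a \o sigma & X = N a])).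
- move=> _ _ [{fa}a [fa -> ->]]; split => [|j]; first exact: finsupp_comp_incr.
  exact: (tinorm_coord (sigma j) fa).
- move=> _ _ l [{fa}a [fa -> ->]] al.
  exists (fun E => N (cut (sigma E.1) (sigma E.2) a)); split.
    move=> E _; exists (cut (sigma E.1) (sigma E.2) a); split => //; first exact: finsupp_cut.
    by apply/funext => j; rewrite /cut/keep/= incr_leE incr_ltE.
  have := tinorm_cut_sum (l := [seq (sigma E.1, sigma E.2) | E <- l]) fa.
  rewrite big_map size_map; apply; case/andP: al => al pw; apply/andP; split.
    by rewrite all_map; apply: sub_all al => E /=; rewrite incr_leE.
  by rewrite pairwise_map; apply: sub_pairwise pw => E F /=; rewrite incr_leE.
- by exists a.
Qed.

(** [c x] counts the [k] with [sigma k < x]; it pulls an interval [[lo, hi)] back to [[c lo, c hi)],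
    as [tinorm_spread] requires. *)
Lemma incr_inv : exists c : nat -> nat, forall x k, (k < c x)%N = (sigma k < x)%N.
Proof.
suff /choice[c hc] : forall x, exists c, forall k, (k < c)%N = (sigma k < x)%N by exists c.
move=> x; have ex : exists k, (x <= sigma k)%N by exists x; exact: incr_ge.
case: (ex_minnP ex) => c xc hc; exists c => k.
apply/idP/idP => [kc|kx]; last by rewrite -incr_ltE (leq_trans kx).
by rewrite ltnNge; apply: contraL kc => /hc; rewrite leqNgt.
Qed.

Lemma tinorm_spread b : finsupp b -> (forall j, (forall k, j <> sigma k) -> b j = 0) ->
  N b <= N (b \o sigma).
Proof.
move=> fb b0; have [c hc] := incr_inv.
apply: (tinorm_coind (P := fun b X =>
  [/\ finsupp b, forall j, (forall k, j <> sigma k) -> b j = 0 & X = N (b \o sigma)])) => //.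
- move=> {fb b0}b _ [fb b0 ->]; split => // j.
  have [[k ->]|nk] := pselect (exists k, j = sigma k).
    by apply: (tinorm_coord (a := b \o sigma)); exact: finsupp_comp_incr.
  rewrite b0 ?normr0 ?tinorm_ge0//; first exact: finsupp_comp_incr.
  by move=> k jk; apply: nk; exists k.
- move=> {fb b0}b _ l [fb b0 ->] al; exists (fun E => N (cut (c E.1) (c E.2) (b \o sigma))); split.
    move=> E _; split; first exact: finsupp_cut.
      by move=> j /b0 bj; rewrite /cut/keep bj if_same.
    by congr (N _); apply/funext => j; rewrite /cut/keep/= hc [(c _ <= j)%N]leqNgt hc -leqNgt.
  have := tinorm_cut_sum (l := [seq (c E.1, c E.2) | E <- l]) (finsupp_comp_incr fb).
  have cle x y : (x <= y)%N -> (c x <= c y)%N.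
    by move=> xy; rewrite leqNgt hc -leqNgt; apply: (leq_trans xy); rewrite leqNgt -hc ltnn.
  rewrite big_map size_map; apply; case/andP: al => al pw; apply/andP; split.
    by rewrite all_map; apply: sub_all al => E /=; exact: cle.
  by rewrite pairwise_map; apply: sub_pairwise pw => E F /=; exact: cle.
Qed.

(** An interval of block indices corresponds to a union of consecutive blocks, again an interval, so
    admissible families transfer to [Y]. Dually, this is why bounded blocks are dominated by the
    basis. *)
Lemma tinorm_block_norms Y : finsupp Y ->
  N (fun k => N (cut (sigma k) (sigma k.+1) Y)) <= N Y.
Proof.
move=> fY.
have fN Z : finsupp Z -> finsupp (fun k => N (cut (sigma k) (sigma k.+1) Z)).
  move=> [m hm]; exists m => k mk; rewrite (_ : cut _ _ _ = fun=> 0) ?tinorm0//.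
  apply/funext => j; rewrite /cut/keep; case: ifP => // /andP[kj _]; rewrite hm//.
  by apply: (leq_trans mk); apply: leq_trans kj; exact: incr_ge.
apply: (tinorm_coind (P := fun b X => exists Y, [/\ finsupp Y,
  b = (fun k => N (cut (sigma k) (sigma k.+1) Y)) & X = N Y])).
- move=> _ _ [Z [fZ -> ->]]; split => [|k]; first exact: fN.
  by rewrite ger0_norm ?tinorm_ge0 ?tinorm_keep//; exact: finsupp_cut.
- move=> _ _ l [Z [fZ -> ->]] al.
  exists (fun E => N (cut (sigma E.1) (sigma E.2) Z)); split.
    move=> E _; exists (cut (sigma E.1) (sigma E.2) Z); split => //; first exact: finsupp_cut.
    apply/funext => k; rewrite {1}/cut {1}/keep; case: ifP => [/andP[k1 k2]|kE].
      congr (N _); rewrite /cut keepK; apply/funext => j; rewrite /keep.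
      case: (boolP (sigma k <= j < sigma k.+1)%N) => //= /andP[j1 j2].
      by rewrite (leq_trans _ j1) ?incr_leE// (leq_trans j2)// incr_leE.
    rewrite -tinorm0; congr (N _); rewrite /cut keepK; apply/funext => j; rewrite /keep.
    case: ifP => // /andP[/andP[j1 j2] /andP[j3 j4]]; move: kE.
    rewrite -ltnS -incr_ltE (leq_ltn_trans j3 j2)/= -incr_ltE.
    by rewrite (leq_ltn_trans j1 j4).
  have := tinorm_cut_sum (l := [seq (sigma E.1, sigma E.2) | E <- l]) fZ.
  rewrite big_map size_map; apply; case/andP: al => al pw; apply/andP; split.
    by rewrite all_map; apply: sub_all al => E /=; rewrite incr_leE.
  by rewrite pairwise_map; apply: sub_pairwise pw => E F /=; rewrite incr_leE.
- by exists Y.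
Qed.

End Spread.

Lemma keep_nz (A : nat -> bool) a : (forall j, A j -> a j = 0) -> keep A a = fun=> 0.
Proof. by move=> h; apply/funext => j; rewrite /keep; case: ifP => // /h. Qed.

(** * Upper p-estimates for blocks *)

Section Splitting.
Variables (g : nat -> nat) (r : nat) (Y : nat -> R).
Hypothesis g_le : forall i j, (i <= j)%N -> (g i <= g j)%N.
Hypothesis g_lt : forall j, (g j < r)%N.
Hypothesis fY : finsupp Y.

(** The blocks are the level sets of [g]. By monotonicity, those whose labels lie strictly between
    the labels of the first and the last point of [E] are contained in [E]; the last point is
    [E.2.-1], as intervals are half-open. *)
Let mid E := keep (fun j => g E.1 < g j < g E.2.-1)%N Y.

Let split_cut E : (E.1 < E.2)%N -> N (cut E.1 E.2 Y) <=
  N (cut E.1 E.2 (keep (fun j => g j == g E.1) Y)) +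
  N (cut E.1 E.2 (keep (fun j => g j == g E.2.-1) Y)) + N (mid E).
Proof.
move=> E12.
set u := cut _ _ (keep _ _); set v := cut _ _ (keep _ _).
have fu : finsupp u by exact: finsupp_cut.
have fv : finsupp v by exact: finsupp_cut.
have fw : finsupp (mid E) by exact: finsupp_keep.
apply: (@le_trans _ _ (N ((u \+ v) \+ mid E))); last first.
  apply: le_trans (tinormD _ fw) _; first exact: finsuppD.
  by rewrite lerD2r tinormD.
apply: tinorm_le => [|j]; first exact: finsuppD (finsuppD fu fv) fw.
rewrite /= /u /v /mid /cut /keep; case: ifP => [/andP[j1 j2]|_]; last by rewrite normr0.
have j2' : (j <= E.2.-1)%N by rewrite -ltnS prednK// (leq_ltn_trans _ E12).
have h1 := g_le j1; have h2 := g_le j2'.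
case: (eqVneq (g j) (g E.1)) => [e1|n1].
  rewrite e1 ltnn/= addr0; case: ifP => _; last by rewrite addr0.
  by rewrite -mulr2n normrMn mulr2n lerDl.
case: (eqVneq (g j) (g E.2.-1)) => [e2|n2]; first by rewrite e2 ltnn andbF add0r addr0.
by rewrite !ltn_neqAle eq_sym n1 h1 n2 h2 add0r add0r.
Qed.

(** The label ranges of successive intervals overlap at most in their end points; [x] is the left
    bound that moves along in the induction. *)
Let sum_gap l : adm l -> all (fun E => E.1 < E.2)%N l ->
  forall x, all (fun E => x <= E.1)%N l -> (\sum_(E <- l) (g E.2.-1 - g E.1) + g x <= r)%N.
Proof.
elim: l => [|E l IH]; first by move=> _ _ x _; rewrite big_nil add0n ltnW.
rewrite adm_cons big_cons /= => /and3P[_ al aal] /andP[E12 ne] x /andP[xE _].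
have p2 : E.2.-1.+1 = E.2 by rewrite prednK// (leq_ltn_trans _ E12).
have {}IH := IH aal ne E.2.-1 _.
have /IH{}IH : all (fun F => E.2.-1 <= F.1)%N l.
  by apply: sub_all al => F /=; apply: leq_trans; rewrite -{2}p2.
have h1 := g_le xE.
have h2 : (g E.1 <= g E.2.-1)%N by apply: g_le; rewrite -ltnS p2.
by lia.
Qed.

(** Groups the intervals by the block [f E] that contains one of their end pieces. [B i k] bounds
    what [k] intervals can extract from block [i]; it is kept abstract because [flat_averages] uses
    different bounds in different blocks. *)
Let labels_sum (f : nat * nat -> nat) (B : nat -> nat -> R) l : adm l ->
  (forall E, (f E < r)%N) ->
  (forall i l', (i < r)%N -> adm l' -> (size l' <= size l)%N ->
     gamma * (\sum_(E <- l') N (cut E.1 E.2 (keep (fun j => g j == i) Y))) <= B i (size l')) ->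
  gamma * (\sum_(E <- l) N (cut E.1 E.2 (keep (fun j => g j == f E) Y))) <=
  \sum_(i < r) B i (count (fun E => f E == i) l).
Proof.
move=> al fr hB.
have -> : \sum_(E <- l) N (cut E.1 E.2 (keep (fun j => g j == f E) Y)) =
    \sum_(i < r) \sum_(E <- l | f E == i) N (cut E.1 E.2 (keep (fun j => g j == i) Y)).
  under [RHS]eq_bigr => i _ do rewrite big_mkcond.
  rewrite exchange_big/=; apply: eq_bigr => E _; rewrite -big_mkcond/=.
  by rewrite (big_pred1 (Ordinal (fr E)))// => i; rewrite -val_eqE/= eq_sym.
rewrite mulr_sumr; apply: ler_sum => i _.
rewrite -big_filter -size_filter; apply: hB => //; first exact: adm_filter.
by rewrite size_filter count_size.
Qed.

Let sum_count (f : nat * nat -> nat) l : (forall E, (f E < r)%N) ->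
  (\sum_(i < r) count (fun E => f E == i) l)%N = size l.
Proof.
move=> fr; under eq_bigr => i _ do rewrite -sum1_count big_mkcond.
rewrite exchange_big/= -sum1_size; apply: eq_bigr => E _; rewrite -big_mkcond/=.
by rewrite (big_pred1 (Ordinal (fr E)))// => i; rewrite -val_eqE/= eq_sym.
Qed.

(* Each interval of [l] consists of a left piece, a right piece and full blocks
   in between; [m1 i] and [m2 i] count the pieces contained in the block [i]. *)
Lemma split_sum (B : nat -> nat -> R) (K : R) l : adm l -> 0 <= K ->
  (forall i l', (i < r)%N -> adm l' -> (size l' <= size l)%N ->
     gamma * (\sum_(E <- l') N (cut E.1 E.2 (keep (fun j => g j == i) Y))) <= B i (size l')) ->
  (forall c d, (d < r)%N ->
     N (keep (fun j => c < g j < d)%N Y) <= K * (d - c.+1)%:R `^ (1 - s)) ->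
  exists m1 m2 : nat -> nat,
    [/\ (\sum_(i < r) m1 i <= size l)%N, (\sum_(i < r) m2 i <= size l)%N &
     gamma * (\sum_(E <- l) N (cut E.1 E.2 Y)) <=
     \sum_(i < r) B i (m1 i) + \sum_(i < r) B i (m2 i) +
     gamma * K * ((size l)%:R `^ s * r%:R `^ (1 - s))].
Proof.
move=> + K0; pose l0 := [seq E <- l | E.1 < E.2]%N => al hB hK.
have szl0 : (size l0 <= size l)%N by rewrite size_filter count_size.
have al0 : adm l0 by exact: adm_filter.
have ne0 : all (fun E => E.1 < E.2)%N l0 by exact: filter_all.
exists (fun i => count (fun E => g E.1 == i) l0), (fun i => count (fun E => g E.2.-1 == i) l0).
rewrite (sum_count (f := fun E => g E.1))// (sum_count (f := fun E => g E.2.-1))//; split => //.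
have -> : \sum_(E <- l) N (cut E.1 E.2 Y) = \sum_(E <- l0) N (cut E.1 E.2 Y).
  rewrite big_filter [RHS]big_mkcond; apply: eq_bigr => E _; case: ltnP => // EE.
  by rewrite /cut keep_nz ?tinorm0// => j /andP[j1 j2]; lia.
have le1 : \sum_(E <- l0) N (cut E.1 E.2 Y) <= 
    \sum_(E <- l0) N (cut E.1 E.2 (keep (fun j => g j == g E.1) Y)) +
    \sum_(E <- l0) N (cut E.1 E.2 (keep (fun j => g j == g E.2.-1) Y)) +
    \sum_(E <- l0) N (mid E).
  rewrite -!big_split/= big_seq [leRHS]big_seq; apply: ler_sum => E El; apply: split_cut.
  exact: (allP ne0).
apply: (le_trans (ler_wpM2l (ltW gamma_gt0) le1)); rewrite !mulrDr -mulrA.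
have hB0 i l' : (i < r)%N -> adm l' -> (size l' <= size l0)%N ->
     gamma * (\sum_(E <- l') N (cut E.1 E.2 (keep (fun j => g j == i) Y))) <= B i (size l').
  by move=> ir al' l'l; apply: hB => //; apply: leq_trans szl0.
rewrite !lerD//.
- exact: (labels_sum (f := fun E => g E.1)).
- exact: (labels_sum (f := fun E => g E.2.-1)).
rewrite ler_wpM2l ?(ltW gamma_gt0)//.
have s1 : 0 < 1 - s by rewrite subr_gt0 s_lt1.
apply: (@le_trans _ _ (\sum_(E <- l0) K * (g E.2.-1 - (g E.1).+1)%:R `^ (1 - s))).
  by apply: ler_sum => E _; exact: hK.
rewrite -mulr_sumr ler_wpM2l//.
have s1' : 0 < 1 - s < 1 by rewrite s1 gtrBl s_gt0.
(* Concavity with exponent [1 - s]; the gaps add up to at most [r] by [sum_gap]. *)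
apply: (le_trans (sum_powR_le l0 s1' (fun E => ler0n _ _))).
rewrite opprB addrC subrK ler_pM ?powR_ge0//.
  by apply: ge0_ler_powR; rewrite ?nnegrE ?ler_nat// ltW// s_gt0.
rewrite -natr_sum; apply: ge0_ler_powR; rewrite ?nnegrE ?ler_nat ?(ltW s1)//.
have := sum_gap al0 ne0 (x := 0) (sub_all _ (all_predT _)); rewrite /=.
move=> /(_ (fun _ _ => isT)) h; apply: leq_trans (leq_trans (leq_addr _ _) h).
by apply: leq_sum => E _; rewrite leq_sub2l.
Qed.

End Splitting.

Hypothesis gamma_le3 : gamma <= 3^-1.

Let upper (r : nat) := forall (g : nat -> nat) Y (theta : R),
  (forall i j, (i <= j)%N -> (g i <= g j)%N) -> (forall j, (g j < r)%N) -> finsupp Y ->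
  (forall i, N (keep (fun j => g j == i) Y) <= theta) -> N Y <= 3 * theta * r%:R `^ (1 - s).

Let upper_between (g : nat -> nat) Y (theta : R) (c d : nat) : 0 <= theta ->
  upper (d - c.+1) -> (forall i j, (i <= j)%N -> (g i <= g j)%N) -> finsupp Y ->
  (forall i, N (keep (fun j => g j == i) Y) <= theta) ->
  N (keep (fun j => c < g j < d)%N Y) <= 3 * theta * (d - c.+1)%:R `^ (1 - s).
Proof.
move=> th0 up g_le fY gY; have [dc|cd] := leqP d c.+1.
  rewrite keep_nz ?tinorm0 ?mulr_ge0 ?powR_ge0// => j /andP[j1 j2].
  by move: (leq_trans j2 dc); rewrite ltnS leqNgt j1.
have n0 : (0 < d - c.+1)%N by rewrite subn_gt0.
apply: (up (fun j => minn (g j - c.+1) (d - c.+1).-1)).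
- by move=> i j /g_le; exact: relabel_le.
- by move=> j; exact: relabel_lt.
- exact: finsupp_keep.
- move=> i; apply: le_trans (gY (i + c.+1)%N); apply: tinorm_le; first exact: finsupp_keep.
  move=> j; rewrite keepK /keep; case: ifP => [/andP[/eqP e1 e2]|]; last by rewrite normr0.
  by rewrite (relabel_eq e1 e2) eqxx.
Qed.

(** Strong induction on [r], as the middle blocks of an interval are fewer than [r]. In units of
    [theta * n^s * r^(1 - s)] for [n] intervals, the left and the right pieces contribute 1 each by
    Hölder and the middle blocks [3 * gamma]; the constant 3 reproduces itself because
    [2 + 3 * gamma <= 3]. *)
Lemma tinorm_upper (g : nat -> nat) (r : nat) Y (theta : R) :
  (forall i j, (i <= j)%N -> (g i <= g j)%N) -> (forall j, (g j < r)%N) -> finsupp Y ->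
  (forall i, N (keep (fun j => g j == i) Y) <= theta) -> N Y <= 3 * theta * r%:R `^ (1 - s).
Proof.
elim/ltn_ind: r g Y theta => r IH g Y theta g_le g_lt fY gY.
have th0 : 0 <= theta by apply: le_trans (gY 0%N); apply/tinorm_ge0/finsupp_keep.
have r0 : (0 < r)%N by exact: leq_ltn_trans (g_lt 0%N).
have s1 : 0 < 1 - s by rewrite subr_gt0 s_lt1.
have s1' : 0 < 1 - s < 1 by rewrite s1 gtrBl s_gt0.
have r1 : 1 <= r%:R `^ (1 - s).
  apply: (@le_trans _ _ (1 `^ (1 - s))); first by rewrite powR1.
  by apply: ge0_ler_powR; rewrite ?nnegrE ?ler1n// ltW.
apply: tinorm_least => // [j|l al].
  apply: (@le_trans _ _ theta).
    apply: le_trans (gY (g j)); have := tinorm_coord j (finsupp_keep (fun i => g i == g j) fY).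
    by rewrite {1}/keep eqxx.
  by rewrite -[leLHS]mul1r -mulrA ler_pM// ?ler_peMr// ler1n.
have [|c d dr|m1 [m2 [sm1 sm2 hsum]]] := split_sum (K := 3 * theta) g_le g_lt fY
  (B := fun i m => m%:R `^ s * theta) al (mulr_ge0 (ler0n _ _) th0).
- move=> i l' ir al' _.
  apply: le_trans (tinorm_cut_sum _ al') _; first exact: finsupp_keep.
  by rewrite ler_wpM2l ?powR_ge0.
- apply: upper_between => // g' Y' th'; apply: IH.
  exact: leq_ltn_trans (leq_subr _ _) dr.
apply: (le_trans hsum).
have pw m : (\sum_(i < r) m i <= size l)%N ->
    \sum_(i < r) ((m i)%:R `^ s * theta) <= (size l)%:R `^ s * theta * r%:R `^ (1 - s).
  move=> sm; rewrite -mulr_suml mulrAC ler_wpM2r//.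
  apply: le_trans (sum_powR_le (index_enum _) s_itv (fun i => ler0n _ _)) _.
  rewrite [X in size X]/index_enum -enumT size_enum_ord mulrC ler_wpM2r ?powR_ge0//.
  by apply: ge0_ler_powR; rewrite ?nnegrE -?natr_sum ?ler_nat// ltW// s_gt0.
apply: le_trans (lerD (lerD (pw _ sm1) (pw _ sm2)) (lexx _)) _.
set A := _ `^ s; set D := _ `^ (1 - s); have A0 : 0 <= A by exact: powR_ge0.
have AD : 0 <= theta * (A * D) by rewrite !mulr_ge0// powR_ge0.
suff : (gamma * 3) * (theta * (A * D)) <= 1 * (theta * (A * D)) by lra.
by rewrite ler_wpM2r// -ler_pdivlMr// mul1r.
Qed.

(** Here [k] end pieces in one block are bounded by [k * theta], and no Hölder factor in [r] arises.
    When there are few intervals compared with [r], the first term is negligible and the second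
    carries the small factor [gamma]. *)
Lemma tinorm_flat (g : nat -> nat) (r : nat) Y (theta : R) l :
  (forall i j, (i <= j)%N -> (g i <= g j)%N) -> (forall j, (g j < r)%N) -> finsupp Y ->
  (forall i, N (keep (fun j => g j == i) Y) <= theta) -> adm l ->
  gamma * (\sum_(E <- l) N (cut E.1 E.2 Y)) <=
  2 * (size l)%:R * theta + 3 * gamma * theta * ((size l)%:R `^ s * r%:R `^ (1 - s)).
Proof.
move=> g_le g_lt fY gY al.
have th0 : 0 <= theta by apply: le_trans (gY 0%N); apply/tinorm_ge0/finsupp_keep.
have [|c d dr|m1 [m2 [sm1 sm2 hsum]]] := split_sum (K := 3 * theta) g_le g_lt fY
  (B := fun i m => m%:R * theta) al (mulr_ge0 (ler0n _ _) th0).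
- move=> i l' ir al' _.
  apply: le_trans (tinorm_cut_sum _ al') _; first exact: finsupp_keep.
  rewrite ler_pM ?powR_ge0//; first by apply/tinorm_ge0/finsupp_keep.
  have [->|] := posnP (size l'); first by rewrite powR0// gt_eqF ?s_gt0.
  by move=> sz; rewrite ler1_powR ?ler1n// ltW// s_lt1.
- by apply: upper_between => // g' Y' th'; exact: tinorm_upper.
apply: (le_trans hsum).
have pw m : (\sum_(i < r) m i <= size l)%N -> \sum_(i < r) ((m i)%:R * theta) <= (size l)%:R * theta.
  by move=> sm; rewrite -mulr_suml ler_wpM2r// -natr_sum ler_nat.
apply: le_trans (lerD (lerD (pw _ sm1) (pw _ sm2)) (lexx _)) _.
by lra.
Qed.

(** * Failure of the lower p-estimate with constant 1/2 *)

Section FlatAverages.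
Hypothesis gamma_le : gamma <= 100^-1.
Variables (u : nat -> R) (T : nat -> nat).
Hypothesis T_lt : forall i j, (i < j)%N -> (T i < T j)%N.
Hypothesis Nu : forall i, N (cut (T i) (T i.+1) u) <= 1.

Let u_le1 j : (T 0 <= j)%N -> `|u j| <= 1.
Proof.
move=> Tj; apply: le_trans (Nu (blk T j)).
have := tinorm_coord j (finsupp_cut (T (blk T j)) (T (blk T j).+1) u).
by rewrite {1}/cut {1}/keep blkP.
Qed.

Let s1 : 0 < 1 - s. Proof. by rewrite subr_gt0 s_lt1. Qed.

(** Each length is chosen after the l1 norm of all preceding coordinates. Thus, once the number [m]
    of intervals exceeds [delta] times this length, that l1 norm is at most [m^s]. *)
Let fast_growth (delta : R) : 0 < delta -> exists Rb : nat -> nat,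
  [/\ Rb 0%N = 0%N, forall i, (Rb i < Rb i.+1)%N,
   forall i, (Rb i.+1 - Rb i <= Rb i.+2 - Rb i.+1)%N &
   forall i, \sum_(j < T (Rb i)) `|u j| <= (delta * (Rb i.+1 - Rb i)%:R) `^ s].
Proof.
move=> d0.
have /choice[rho hrho] : forall m, exists n, [/\ (0 < n)%N, (m <= n)%N &
    \sum_(j < T m) `|u j| <= (delta * n%:R) `^ s].
  move=> m; have [n [n0 hn]] := powR_unbounded ((\sum_(j < T m) `|u j|) / delta `^ s) s_gt0.
  exists (maxn m n); rewrite !leq_max n0 orbT leqnn; split => //.
  rewrite powRM ?ler0n ?(ltW d0)// -ler_pdivrMl ?powR_gt0// mulrC.
  apply: (le_trans (ltW hn)); apply: ge0_ler_powR; rewrite ?nnegrE ?ler_nat ?leq_maxr//.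
  exact/ltW/s_gt0.
pose Rb i := iter i (fun m => m + rho m)%N 0%N.
have RbS i : Rb i.+1 = (Rb i + rho (Rb i))%N by [].
have dR i : (Rb i.+1 - Rb i)%N = rho (Rb i) by rewrite RbS addKn.
exists Rb; split => // i; rewrite ?dR.
- by rewrite RbS -[X in (X < _)%N]addn0 ltn_add2l; case: (hrho (Rb i)).
- apply: leq_trans (_ : Rb i.+1 <= _)%N; first by rewrite RbS leq_addl.
  by case: (hrho (Rb i.+1)).
- by case: (hrho (Rb i)).
Qed.

Let p0 : 0 < p. Proof. exact: lt_trans ltr01 hp. Qed.

(* Use [r] consecutive averages of lengths [Rb i.+1 - Rb i], growing so fast that a
   family of [n] intervals can split at most one of them efficiently. *)
Lemma flat_averages : exists (n : nat) (a : nat -> R),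
  [/\ forall k, 0 <= a k, \sum_(k < n) a k `^ p = 1 &
      N (fun j => \sum_(0 <= k < n) a k * cut (T k) (T k.+1) u j) < 2^-1].
Proof.
(* With this [delta], any [k <= delta * L] satisfies [k <= k^s * L^(1 - s) / 40], which makes the
   first term of [tinorm_flat] small for a group of length [L]. *)
pose delta : R := (40^-1) `^ (1 - s)^-1.
have d0 : 0 < delta by rewrite powR_gt0// invr_gt0.
have dE : delta `^ (1 - s) = 40^-1.
  by rewrite -powRrM mulVf ?gt_eqF// powRr1// invr_ge0.
have [Rb [Rb0 RbS Rbmono Rbl1]] := fast_growth d0.
have [r [r0 hr]] := powR_unbounded 80 s1.
have Rb_lt := incr_step RbS.
pose G := blk Rb; pose ri i := (Rb i.+1 - Rb i)%N.
have ri0 i : (0 < ri i)%N by rewrite subn_gt0.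
pose eps : R := (r%:R `^ (1 - s))^-1.
have eps0 : 0 < eps by rewrite invr_gt0 powR_gt0// ltr0n.
have eps80 : eps <= 80^-1 by rewrite lef_pV2 ?posrE ?powR_gt0 ?ltr0n// ltW.
have epsr : eps * r%:R `^ (1 - s) = 1 by rewrite mulVf// gt_eqF// powR_gt0// ltr0n.
(* The coefficient in group [i]. As [1 - s = 1 / p], every group has l_p norm [eps], and the [r]
   groups together have l_p norm 1. *)
pose th i : R := eps * ((ri i)%:R `^ (1 - s))^-1.
have th0 i : 0 <= th i by rewrite mulr_ge0 ?invr_ge0 ?powR_ge0// ltW.
have ri1 i : 1 <= (ri i)%:R `^ (1 - s).
  apply: (@le_trans _ _ (1 `^ (1 - s))); first by rewrite powR1.
  by apply: ge0_ler_powR; rewrite ?nnegrE ?ler1n// ltW.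
have th_le i : th i <= eps by rewrite ger_pMr// invf_le1// (lt_le_trans ltr01).
have thr i : th i * (ri i)%:R `^ (1 - s) = eps.
  by rewrite -mulrA mulVf ?mulr1// gt_eqF// (lt_le_trans ltr01).
pose n := Rb r; pose a k := th (G k).
exists n, a; split => [k||]; first exact: th0.
  rewrite -(big_mkord xpredT (fun k => a k `^ p)).
  have -> : \sum_(0 <= k < n) a k `^ p = \sum_(i < r) \sum_(Rb i <= k < Rb i.+1) a k `^ p.
    by rewrite -sum_nat_blocks ?Rb0// => i; exact/ltnW.
  have ipp : (1 - s) * p = 1 by rewrite /s opprB addrC subrK mulVf// gt_eqF.
  have epsp i : th i `^ p = (r%:R * (ri i)%:R)^-1.
    rewrite /th /eps -invfM -powRM ?ler0n// -powRN -powRrM mulNr ipp.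
    by rewrite powR_inv1// mulr_ge0.
  rewrite (eq_bigr (fun=> r%:R^-1)) => [|i _].
    by rewrite sumr_const card_ord -[LHS]mulr_natl mulfV// gt_eqF// ltr0n.
  rewrite big_seq (eq_bigr (fun=> (r%:R * (ri i)%:R)^-1)) => [|k].
    rewrite -big_seq big_const_seq count_predT size_iota iter_addr addr0 -/(ri i).
    by rewrite -[LHS]mulr_natr invfM -mulrA mulVf ?mulr1// gt_eqF// ltr0n.
  rewrite mem_index_iota => kR; rewrite /a epsp; congr (_ * (ri _)%:R)^-1.
  by apply/eqP; rewrite /G blk_eq// Rb0.
pose g := blk T.
pose Y j := if (T 0 <= j < T n)%N then a (g j) * u j else 0.
have -> : (fun j => \sum_(0 <= k < n) a k * cut (T k) (T k.+1) u j) = Y.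
  apply/funext => j; rewrite /Y -(sum_blocks T_lt (fun k j => a k * u j)).
  by apply: eq_bigr => k _; rewrite /cut /keep; case: ifP => //; rewrite mulr0.
have fY : finsupp Y by exists (T n) => j nj; rewrite /Y ltnNge nj andbF.
have Yle j : `|Y j| <= eps * (if (T 0 <= j)%N then `|u j| else 0).
  rewrite /Y; case: (leqP (T 0) j) => Tj /=; last by rewrite normr0 mulr0.
  case: ifP => _; last by rewrite normr0 mulr_ge0// ltW.
  by rewrite normrM (ger0_norm (th0 _ : 0 <= a (g j))) ler_wpM2r// th_le.
have g_le : {homo g : i j / (i <= j)%N} by move=> i j; exact: blk_homo.
have G_le : {homo G : i j / (i <= j)%N} by move=> i j; exact: blk_homo.
pose Gg j := minn (G (g j)) r.-1.
have Gg_le i j : (i <= j)%N -> (Gg i <= Gg j)%N.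
  by move/g_le/G_le => h; rewrite /Gg leq_min geq_minr geq_min h.
have Gg_lt j : (Gg j < r)%N by rewrite /Gg -[X in (_ < X)%N](prednK r0) ltnS geq_minr.
have Ysupp j : Y j != 0 -> [/\ (T 0 <= j)%N, (g j < n)%N, Gg j = G (g j) & Y j = th (Gg j) * u j].
  rewrite /Y; case: ifP => [/andP[Tj jn]|]; last by rewrite eqxx.
  have gn : (g j < n)%N by rewrite blk_ltE// (leq_trans _ (Rb_lt _ _ r0)).
  have Ggr : Gg j = G (g j).
    by apply/minn_idPl; rewrite -ltnS prednK// /G blk_ltE// Rb0.
  by split => //; rewrite Ggr.
have v_block i : (i < r)%N -> forall k,
    N (keep (fun j => (g j - Rb i == k)%N) (keep (fun j => Gg j == i) Y)) <= th i.
  move=> ir k; apply: (@le_trans _ _ (N (fun j => th i * cut (T (Rb i + k)) (T (Rb i + k).+1) u j))).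
    apply: tinorm_le; first exact/finsuppZ/finsupp_cut.
    move=> j; rewrite keepK /keep; case: ifP => [/andP[/eqP e1 /eqP e2]|]; last by rewrite normr0.
    have [->|/Ysupp[Tj gn GgE ->]] := eqVneq (Y j) 0; first by rewrite normr0.
    rewrite e2 /cut/keep.
    have Rg : (Rb i <= g j)%N by move/eqP: GgE; rewrite e2 eq_sym /G blk_eq ?Rb0// => /andP[].
    have -> : (T (Rb i + k) <= j < T (Rb i + k).+1)%N by rewrite -blk_eq// -e1 subnKC.
    by [].
  apply: le_trans (tinormZ _ _) _; first exact: finsupp_cut.
  by rewrite ger0_norm// ler_piMr.
have relab i : (i < r)%N -> [/\
    (forall x y, (x <= y)%N -> (minn (g x - Rb i) (ri i).-1 <= minn (g y - Rb i) (ri i).-1)%N),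
    (forall j, (minn (g j - Rb i) (ri i).-1 < ri i)%N) &
    forall k, N (keep (fun j => minn (g j - Rb i) (ri i).-1 == k) (keep (fun j => Gg j == i) Y)) <= th i].
  move=> ir; split => [x y /g_le|j|k]; [exact: relabel_le|exact: relabel_lt|].
  apply: le_trans (v_block i ir k); apply: tinorm_le; first exact/finsupp_keep/finsupp_keep.
  move=> j; rewrite /keep; case: ifP => [|]; last by rewrite normr0.
  case: ifP => [/eqP e2 /eqP <-|]; last by rewrite normr0.
  have [->|/Ysupp[Tj gn GgE YE]] := eqVneq (Y j) 0; first by rewrite normr0.
  have : (Rb i <= g j < Rb i.+1)%N by rewrite -blk_eq ?Rb0// -/(G _) -GgE e2.
  move=> /andP[h1 h2]; suff -> : minn (g j - Rb i) (ri i).-1 = (g j - Rb i)%N by rewrite eqxx.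
  by apply/minn_idPl; rewrite -ltnS prednK// ltn_sub2r// RbS.
have fv i : finsupp (keep (fun j => Gg j == i) Y) by exact: finsupp_keep.
have V1 i : N (keep (fun j => Gg j == i) Y) <= 3 * eps.
  have [ri_|ir] := leqP r i.
    by rewrite keep_nz ?tinorm0 ?mulr_ge0 ?(ltW eps0)// => j /eqP e; move: (Gg_lt j); rewrite e ltnNge ri_.
  have [h1 h2 h3] := relab _ ir.
  by apply: le_trans (tinorm_upper h1 h2 (fv i) h3) _; rewrite -mulrA thr.
have Yle1 j : `|Y j| <= eps.
  by apply: (le_trans (Yle j)); rewrite ger_pMr//; case: ifP => // /u_le1.
pose kap : R := 2 * 40^-1 + 3 * gamma.
have kap0 : 0 <= kap by rewrite addr_ge0// mulr_ge0// ltW// gamma_gt0.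
pose A i : R := \sum_(T (Rb i) <= j < T (Rb i.+1)) `|u j|.
(* The bound obtained at the end is [2 * (kap + 4 * eps) + 9 * gamma]; for [gamma <= 1/100] and
   [eps <= 1/80] this is at most [26/100 + 9/100]. *)
apply: (@le_lt_trans _ _ (7 / 20)); last by lra.
apply: tinorm_least => // [j|l al]; first by apply: (le_trans (Yle1 j)); lra.
have [/size0nil ->|] := posnP (size l).
  by rewrite big_nil mulr0 powR0 ?mul0r// gt_eqF ?s_gt0.
set m := size l => m0.
have ms0 : 0 <= m%:R `^ s by exact: powR_ge0.
have ex : exists i, (r <= i)%N || (m%:R <= delta * (ri i)%:R) by exists r; rewrite leqnn.
case: (ex_minnP ex) => q hq qmin {ex}.
have hlt i : (i < q)%N -> (i < r)%N /\ delta * (ri i)%:R < m%:R.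
  move=> iq; suff : ~~ ((r <= i)%N || (m%:R <= delta * (ri i)%:R)).
    by rewrite negb_or -ltnNge -ltNge => /andP[].
  by apply: contraL iq => /qmin; rewrite leqNgt.
have ri_homo i k : (i <= k)%N -> (ri i <= ri k)%N.
  elim: k => [|k IH]; first by rewrite leqn0 => /eqP->.
  rewrite leq_eqVlt => /predU1P[->//|ik]; exact: leq_trans (IH ik) (Rbmono k).
have hge i : (q <= i)%N -> (i < r)%N -> m%:R <= delta * (ri i)%:R.
  move=> qi ir; have /orP[rq|/le_trans] := hq; first by move: (leq_ltn_trans qi ir); rewrite ltnNge rq.
  by apply; rewrite ler_pM2l// ler_nat ri_homo.
(* Three regimes for [m] intervals. Groups from [q] on are long against [m], and [tinorm_flat] gives
   the small factor [kap]. Group [q - 1] is bounded by its norm. All earlier groups are bounded by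
   their l1 norms, whose sum the length of group [q - 1] controls. *)
pose B i (k : nat) : R := if (q <= i)%N then eps * kap * k%:R `^ s
  else if i.+1 == q then 3 * eps * m%:R `^ s else eps * A i.
have A0 i : 0 <= A i by exact: sumr_ge0.
have HB i l' : (i < r)%N -> adm l' -> (size l' <= m)%N ->
    gamma * (\sum_(E <- l') N (cut E.1 E.2 (keep (fun j => Gg j == i) Y))) <= B i (size l').
  move=> ir al' l'm; rewrite /B; case: leqP => [qi|iq].
    have [h1 h2 h3] := relab _ ir.
    apply: (le_trans (tinorm_flat h1 h2 (fv i) h3 al')).
    set k := size l'; set K := k%:R `^ s; set D := (ri i)%:R `^ (1 - s).
    have kK : k%:R <= K * (40^-1 * D).
      have [->|k0] := posnP k; first by rewrite mulr_ge0 ?powR_ge0// mulr_ge0 ?powR_ge0.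
      rewrite -[leLHS](powR_mul_compl s) ?ltr0n// ler_wpM2l ?powR_ge0// -dE -powRM ?(ltW d0)//.
      apply: ge0_ler_powR; rewrite ?nnegrE ?(ltW s1) ?mulr_ge0 ?(ltW d0)//.
      by apply: le_trans (hge _ qi ir); rewrite ler_nat.
    have -> : eps * kap * K = 2 * (K * (40^-1 * D)) * th i + 3 * gamma * th i * (K * D).
      by rewrite -(thr i) /kap -/D; ring.
    by rewrite lerD2r ler_wpM2r// ler_wpM2l.
  case: eqP => [_|iq'].
    apply: le_trans (tinorm_cut_sum (fv i) al') _.
    rewrite [leRHS]mulrC ler_pM ?powR_ge0 ?V1//; first exact: tinorm_ge0.
    by apply: ge0_ler_powR; rewrite ?nnegrE ?ler_nat// ltW// s_gt0.
  set v := keep _ Y.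
  have vj j : v j != 0 -> (T (Rb i) <= j < T (Rb i.+1))%N.
    rewrite /v/keep; case: ifP => [/eqP e2 /Ysupp[Tj gn GgE YE]|]; last by rewrite eqxx.
    have : (Rb i <= g j < Rb i.+1)%N by rewrite -blk_eq ?Rb0// -/(G _) -GgE e2.
    move=> /andP[g1 g2]; have /andP[b1 b2] := blkP T_lt Tj; apply/andP; split.
      by apply: leq_trans b1; rewrite incr_leE.
    by apply: leq_trans b2 _; rewrite incr_leE.
  have v0 j : (T (Rb i.+1) <= j)%N -> v j = 0.
    by move=> Tj; apply/eqP; apply: contraTT Tj => /vj/andP[_]; rewrite ltnNge.
  apply: (@le_trans _ _ (\sum_(E <- l') \sum_(j < T (Rb i.+1)) `|cut E.1 E.2 v j|)).
    apply: (@le_trans _ _ (\sum_(E <- l') N (cut E.1 E.2 v))).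
      rewrite ler_piMl ?(ltW gamma_lt1)// sumr_ge0// => E _.
      exact/tinorm_ge0/finsupp_cut.
    by apply: ler_sum => E _; apply: tinorm_l1 => j /v0 vj0; rewrite /cut/keep vj0 if_same.
  rewrite exchange_big/=; apply: (@le_trans _ _ (\sum_(j < T (Rb i.+1)) `|v j|)).
    by apply: ler_sum => j _; exact: sum_cut_norm_le.
  have TR : (T (Rb i) <= T (Rb i.+1))%N by rewrite incr_leE// ltnW.
  rewrite -(big_mkord xpredT (fun j => `|v j|)) (big_cat_nat (n := T (Rb i)) (p := T (Rb i.+1)))//=.
  rewrite big1_seq ?add0r => [|j /=]; last first.
    rewrite mem_index_iota => /andP[_ jT]; apply/normr0P; apply: contraTT jT => /vj/andP[].
    by rewrite leqNgt.
  rewrite /A mulr_sumr; apply: ler_sum => j _; apply: (@le_trans _ _ `|Y j|).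
    by rewrite /v/keep; case: ifP => // _; rewrite normr0.
  by apply: le_trans (Yle j) _; rewrite ler_wpM2l ?(ltW eps0)//; case: ifP.
(* A second use of the upper estimate, now for the groups, whose norms are at most [3 * eps] by
   [V1]. *)
have HK c d : (d < r)%N ->
    N (keep (fun j => c < Gg j < d)%N Y) <= 9 * eps * (d - c.+1)%:R `^ (1 - s).
  move=> _; rewrite (_ : 9 * eps = 3 * (3 * eps)); last by ring.
  apply: upper_between => //; first by rewrite mulr_ge0// ltW.
  by move=> g' Y' th'; exact: tinorm_upper.
have eps9 : 0 <= 9 * eps by rewrite mulr_ge0// ltW.
have [m1 [m2 [sm1 sm2 hsum]]] := split_sum Gg_le Gg_lt fY al eps9 HB HK.
have sumB (mm : nat -> nat) : (\sum_(i < r) mm i <= m)%N ->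
    \sum_(i < r) B i (mm i) <= (kap + 4 * eps) * m%:R `^ s.
  move=> smm.
  apply: (@le_trans _ _ (\sum_(i < r) (eps * kap * (mm i)%:R `^ s +
      ((if i.+1 == q then 3 * eps * m%:R `^ s else 0) + (if (i < q.-1)%N then eps * A i else 0))))).
    apply: ler_sum => i _; rewrite /B; case: (leqP q i) => [qi|iq].
      rewrite lerDl addr_ge0//; case: ifP => // _; rewrite mulr_ge0 ?mulr_ge0 ?(ltW eps0)//.
    have h0 : 0 <= eps * kap * (mm i)%:R `^ s by rewrite mulr_ge0 ?powR_ge0// mulr_ge0// ltW.
    case: eqP => [e|ne]; first by rewrite addrCA lerDl addr_ge0//; case: ifP => // _; rewrite mulr_ge0// ltW.
    have -> : (i < q.-1)%N by case: (q) iq ne => //= k; rewrite ltnS leq_eqVlt => /predU1P[->|].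
    by rewrite add0r lerDr.
  rewrite !big_split/= -mulr_sumr [leRHS]mulrDl; apply: lerD.
    apply: (@le_trans _ _ (eps * kap * (r%:R `^ (1 - s) * m%:R `^ s))); last first.
      by rewrite mulrA (mulrAC eps) epsr mul1r.
    rewrite ler_wpM2l ?mulr_ge0 ?(ltW eps0)//.
    apply: le_trans (sum_powR_le (index_enum _) s_itv (fun i => ler0n _ _)) _.
    rewrite [X in size X]/index_enum -enumT size_enum_ord ler_wpM2l ?powR_ge0//.
    by apply: ge0_ler_powR; rewrite ?nnegrE -?natr_sum ?ler_nat// ltW// s_gt0.
  have -> : 4 * eps * m%:R `^ s = 3 * eps * m%:R `^ s + eps * m%:R `^ s by ring.
  have e30 : 0 <= 3 * eps * m%:R `^ s by rewrite !mulr_ge0// ltW.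
  apply: lerD.
    rewrite -big_mkcond/=; case: (q) hlt => [|k] hlt; first by rewrite big_pred0.
    by rewrite (big_pred1 (Ordinal (hlt _ (ltnSn k)).1)).
  rewrite -big_mkcond/=; case: (q) hlt => [|k] hlt/=; first by rewrite big_pred0 ?mulr_ge0// ltW.
  have [kr kd] := hlt _ (ltnSn k).
  rewrite -mulr_sumr ler_wpM2l ?(ltW eps0)// -(big_ord_widen r A (ltnW kr)).
  rewrite /A -(@sum_nat_blocks _ _ (T \o Rb)) => [|i]; last by rewrite /= incr_leE// ltnW.
  apply: (@le_trans _ _ (\sum_(j < T (Rb k)) `|u j|)).
    rewrite /= Rb0 -(big_mkord xpredT (fun j => `|u j|)).
    rewrite [leRHS](big_cat_nat (n := T 0) (p := T (Rb k)))//=; first by rewrite lerDr sumr_ge0.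
    by rewrite incr_leE.
  apply: le_trans (Rbl1 k) _; apply: ge0_ler_powR; rewrite ?nnegrE ?mulr_ge0 ?(ltW d0)//.
    by rewrite ltW// s_gt0.
  exact: ltW.
apply: (le_trans hsum); apply: le_trans (lerD (lerD (sumB _ sm1) (sumB _ sm2)) (lexx _)) _.
have -> : gamma * (9 * eps) * ((size l)%:R `^ s * r%:R `^ (1 - s)) = 9 * gamma * m%:R `^ s.
  transitivity (9 * gamma * m%:R `^ s * (eps * r%:R `^ (1 - s))); last by rewrite epsr mulr1.
  rewrite -/m; ring.
rewrite -!mulrDl mulrC ler_wpM2l//.
move: gamma_le eps80; rewrite /kap => h1 h2; lra.
Qed.

End FlatAverages.

(** * The dual norm and lower q-estimates *)

(** The bound of the dual norm by [X] ([dnorm_leP]), stated homogeneously so that neither suprema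
    nor extended reals appear in the arguments. *)
Definition dle b X := forall m a, (forall j, (m <= j)%N -> a j = 0) ->
  `|\sum_(j < m) a j * b j| <= X * N a.

Let unit_vec (i : nat) : nat -> R := fun j => (j == i)%:R.

Let unit_supp i j : (i.+1 <= j)%N -> unit_vec i j = 0.
Proof. by rewrite /unit_vec => /gtn_eqF ->. Qed.

Let finsupp_unit i : finsupp (unit_vec i).
Proof. by exists i.+1 => j; exact: unit_supp. Qed.

Let tinorm_unit i : N (unit_vec i) = 1.
Proof.
apply/eqP; rewrite eq_le; apply/andP; split; last first.
  by have := tinorm_coord i (finsupp_unit i); rewrite {1}/unit_vec eqxx normr1.
apply: le_trans (tinorm_l1 (@unit_supp i)) _.
rewrite big_ord_recr/= big1 ?add0r => [|j _]; first by rewrite /unit_vec eqxx normr1.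
by rewrite /unit_vec ltn_eqF ?normr0.
Qed.

Lemma dle_coord b X j : dle b X -> `|b j| <= X.
Proof.
move=> /(_ j.+1 _ (@unit_supp j)); rewrite tinorm_unit mulr1; apply: le_trans.
rewrite big_ord_recr/= big1 ?add0r => [|i _]; first by rewrite /unit_vec eqxx mul1r.
by rewrite /unit_vec ltn_eqF ?mul0r.
Qed.

Lemma dle_ge0 b X : dle b X -> 0 <= X.
Proof. by move/(dle_coord 0); exact: le_trans. Qed.

Lemma dle_le b X X' : X <= X' -> dle b X -> dle b X'.
Proof.
move=> XX' bX m a hm; apply: (le_trans (bX _ _ hm)).
by rewrite ler_wpM2r// tinorm_ge0//; exists m.
Qed.

Lemma dle0 : dle (fun=> 0) 0.
Proof. by move=> m a _; rewrite mul0r big1 ?normr0// => j _; rewrite mulr0. Qed.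

Lemma dleD b b' X X' : dle b X -> dle b' X' -> dle (b \+ b') (X + X').
Proof.
move=> bX bX' m a hm; under eq_bigr => j _ do rewrite mulrDr.
by rewrite big_split/= mulrDl (le_trans (ler_normD _ _))// lerD// ?bX ?bX'.
Qed.

Lemma dleZ (c : R) b X : dle b X -> dle (fun j => c * b j) (`|c| * X).
Proof.
move=> bX m a hm; under eq_bigr => j _ do rewrite mulrCA.
by rewrite -mulr_sumr normrM -mulrA ler_wpM2l// bX.
Qed.

Lemma dle_dom b b' X : dle b X -> (forall j, `|b' j| <= `|b j|) -> dle b' X.
Proof.
move=> bX b'b m a hm.
pose a' j := `|a j| * Num.sg (b j).
have ha' j : (m <= j)%N -> a' j = 0 by move=> mj; rewrite /a' hm// normr0 mul0r.
have fa : finsupp a by exists m.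
apply: (@le_trans _ _ (X * N a')); last first.
  rewrite ler_wpM2l ?(dle_ge0 bX)//; apply: tinorm_le => // j.
  by rewrite /a' normrM normr_id ler_piMr// normr_sg; case: (_ != 0).
apply: le_trans (le_trans (ler_norm _) (bX _ _ ha')).
apply: (le_trans (ler_norm_sum _ _ _)); apply: ler_sum => j _.
by rewrite /a' -mulrA -normrEsg normrM ler_wpM2l.
Qed.

Lemma dle_keep A b X : dle b X -> dle (keep A b) X.
Proof. by move/dle_dom; apply => j; rewrite /keep; case: ifP => // _; rewrite normr0. Qed.

Lemma dle_sum (I : Type) (r : seq I) (F : I -> nat -> R) (B : I -> R) :
  (forall i, dle (F i) (B i)) -> dle (fun j => \sum_(i <- r) F i j) (\sum_(i <- r) B i).
Proof.
move=> FB; elim: r => [|i r IH].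
  by rewrite big_nil; move: dle0; congr dle; apply/funext => j; rewrite big_nil.
by rewrite big_cons; move: (dleD (FB i) IH); congr dle; apply/funext => j; rewrite big_cons.
Qed.

(** Lower semicontinuity: a test vector sees only finitely many coordinates, so norm bounds pass to
    coordinatewise limits. *)
Lemma dle_closed b X : (forall m (eps : R), 0 < eps ->
    exists2 b', dle b' X & forall j, (j < m)%N -> `|b j - b' j| <= eps) -> dle b X.
Proof.
move=> hb m a hm; apply/ler_addgt0Pr => e e0.
have fa : finsupp a by exists m.
pose A := \sum_(j < m) `|a j|; have A0 : 0 <= A by exact: sumr_ge0.
have e'0 : 0 < e / (A + 1) by rewrite divr_gt0// ltr_wpDl.
have [b' b'X bb'] := hb m _ e'0.
have -> : \sum_(j < m) a j * b j = \sum_(j < m) a j * b' j + \sum_(j < m) a j * (b j - b' j).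
  by rewrite -big_split/=; apply: eq_bigr => j _; rewrite -mulrDr subrKC.
apply: (le_trans (ler_normD _ _)); apply: lerD; first exact: b'X.
apply: (le_trans (ler_norm_sum _ _ _)).
apply: (@le_trans _ _ (A * (e / (A + 1)))).
  by rewrite mulr_suml; apply: ler_sum => j _; rewrite normrM ler_wpM2l// bb'.
rewrite mulrA ler_pdivrMr ?ltr_wpDl// [leRHS]mulrC ler_wpM2r ?(ltW e0)//.
by rewrite lerDl.
Qed.

Lemma dle_fin b X : (forall m, dle (cut 0 m b) X) -> dle b X.
Proof.
move=> h; apply: dle_closed => m eps e0; exists (cut 0 m b) => // j jm.
by rewrite /cut/keep jm subrr normr0 ltW.
Qed.

Lemma dle_l1 b m : (forall j, (m <= j)%N -> b j = 0) -> dle b (\sum_(j < m) `|b j|).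
Proof.
move=> hb n a hn; have fa : finsupp a by exists n.
rewrite (@sum_supp_indep (fun j => a j * b j) n m) => [|j nj|j mj]; last 2 first.
- by rewrite hn// mul0r.
- by rewrite hb// mulr0.
apply: (le_trans (ler_norm_sum _ _ _)); rewrite mulr_suml; apply: ler_sum => j _.
by rewrite normrM mulrC ler_wpM2l// tinorm_coord.
Qed.

Lemma not_dle lo hi b X : 0 <= X -> ~ dle (cut lo hi b) X ->
  exists2 a, N (cut lo hi a) <= 1 & X < \sum_(lo <= j < hi) a j * b j.
Proof.
move=> X0 /existsNP[m /existsNP[a /not_implyP[hm /negP]]]; rewrite -ltNge => lt.
have fa : finsupp a by exists m.
pose c := cut lo hi a; have fc : finsupp c by exact: finsupp_cut.
have dE : \sum_(j < m) a j * cut lo hi b j = \sum_(lo <= j < hi) a j * b j.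
  rewrite (@sum_supp_indep (fun j => a j * cut lo hi b j) m (maxn m hi)) => [|j mj|j]; last 2 first.
  - by rewrite hm// mul0r.
  - by rewrite geq_max => /andP[/hm -> _]; rewrite mul0r.
  rewrite -(@sum_cut _ _ (maxn m hi)) ?leq_maxr//; apply: eq_bigr => j _.
  by rewrite /cut/keep; case: ifP; rewrite ?mulr0.
rewrite dE in lt; set d := (\sum_(lo <= j < hi) a j * b j) in lt *.
have cle : N c <= N a by exact: tinorm_keep.
have lt' : X * N c < `|d| by apply: le_lt_trans lt; rewrite ler_wpM2l.
have Nc0 : 0 < N c.
  rewrite lt_neqAle tinorm_ge0// andbT; apply/eqP => Nc.
  move: lt'; rewrite -Nc mulr0 normr_gt0 => /eqP; apply.
  rewrite /d big_seq big1// => j; rewrite mem_index_iota => jl.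
  have := tinorm_coord j fc; rewrite -/N -Nc normr_le0 /c/cut/keep jl => /eqP ->.
  by rewrite mul0r.
exists (fun j => (Num.sg d / N c) * a j).
  have -> : cut lo hi (fun j => (Num.sg d / N c) * a j) = (fun j => (Num.sg d / N c) * c j).
    by apply/funext => j; rewrite /c/cut/keep; case: ifP => // _; rewrite mulr0.
  apply: le_trans (tinormZ _ fc) _.
  rewrite normrM normr_sg normfV (gtr0_norm Nc0) divfK ?(gt_eqF Nc0)//.
  by case: (d != 0).
under eq_bigr => j _ do rewrite -(mulrA (Num.sg d / N c)).
by rewrite -mulr_sumr -/d mulrAC -normrEsg ltr_pdivlMr.
Qed.

Lemma dnorm_leP b X : (dnorm p gamma b <= X%:E)%E <-> dle b X.
Proof.
split => [|bX]; last first.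
  apply: ge_ereal_sup => _ [m [a [hm [a1 ->]]]]; rewrite lee_fin.
  apply: (le_trans (bX _ _ hm)); rewrite -[leRHS]mulr1 ler_wpM2l//; exact: dle_ge0 bX.
move=> bX m a hm; have fa : finsupp a by exists m.
have [Na0|Na0] := eqVneq (N a) 0.
  rewrite Na0 mulr0 big1 ?normr0// => j _; have := tinorm_coord j fa.
  by rewrite -/N Na0 normr_le0 => /eqP ->; rewrite mul0r.
have Nap : 0 < N a by rewrite lt_neqAle eq_sym Na0 tinorm_ge0.
rewrite -ler_pdivrMr// -lee_fin; apply: le_trans bX; apply: ereal_sup_ubound.
exists m, (fun j => (N a)^-1 * a j); split; first by move=> j /hm ->; rewrite mulr0.
split; first by apply: le_trans (tinormZ _ fa) _; rewrite gtr0_norm ?invr_gt0// mulVf.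
congr (_%:E); under [in RHS]eq_bigr => j _ do rewrite -mulrA.
by rewrite -mulr_sumr normrM gtr0_norm ?invr_gt0// mulrC.
Qed.

Lemma inTistarP b : inTistar p gamma b <-> exists X, dle b X.
Proof.
rewrite /inTistar; split => [|[X /dnorm_leP h]]; last exact: le_lt_trans h (ltry X).
case E : (dnorm p gamma b) => [r||]// _; first by exists r; apply/dnorm_leP; rewrite E.
by exists 0; apply/dnorm_leP; rewrite E leNye.
Qed.

(** Expresses that [b] consists of pieces of norm at most [theta] on the intervals of [l], through
    the estimate that this entails. The estimate is additive under concatenation, and the implicit
    equation turns it into a norm bound ([split_dle_dle]). *)
Definition split_dle l b (theta : R) := forall m a, (forall j, (m <= j)%N -> a j = 0) ->
  `|\sum_(j < m) a j * b j| <= theta * \sum_(E <- l) N (cut E.1 E.2 a).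

Lemma split_dle_cat l l' b b' theta : split_dle l b theta -> split_dle l' b' theta ->
  split_dle (l ++ l') (b \+ b') theta.
Proof.
move=> h h' m a hm; under eq_bigr => j _ do rewrite mulrDr.
by rewrite big_split/= big_cat mulrDr (le_trans (ler_normD _ _))// lerD// ?h ?h'.
Qed.

Lemma split_dle1 lo hi b theta : dle (cut lo hi b) theta ->
  split_dle [:: (lo, hi)] (cut lo hi b) theta.
Proof.
move=> h m a hm; rewrite big_seq1/=.
have := h m (cut lo hi a); rewrite (eq_bigr (fun j : 'I_m => a j * cut lo hi b j)) => [|j _].
  by apply => j /hm aj; rewrite /cut/keep aj if_same.
by rewrite /cut/keep; case: ifP => // _; rewrite !mulr0.
Qed.

Lemma split_dle_dle l b theta : 0 <= theta -> adm l -> split_dle l b theta ->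
  dle b (theta * gamma^-1 * (size l)%:R `^ s).
Proof.
move=> t0 al h m a hm; have fa : finsupp a by exists m.
apply: (le_trans (h _ _ hm)); rewrite -!mulrA ler_wpM2l// ler_pdivlMl ?gamma_gt0//.
exact: tinorm_cut_sum.
Qed.

(** The position of the interval containing [j] is the number of intervals that have ended by [j].
    The count is monotone in [j] and can therefore serve as a block label in [dle_lower]. *)
Lemma adm_count l k j : adm l -> (k < size l)%N ->
  ((nth (0, 0) l k).1 <= j < (nth (0, 0) l k).2)%N -> count (fun E => E.2 <= j)%N l = k.
Proof.
elim: l k => // E l IH k; rewrite adm_cons => /and3P[E12 /allP al aal].
case: k => [|k] /=; last first.
  move=> kl jk; rewrite (IH k)// ; have /andP[j1 _] := jk.
  by rewrite (leq_trans (al _ (mem_nth _ kl)) j1).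
move=> _ /andP[_ jE]; rewrite leqNgt jE/= add0n; apply/eqP.
rewrite -leqn0 leqNgt -has_count; apply/hasP => -[F Fl Fj].
move: (al _ Fl) aal => EF /andP[/allP/(_ _ Fl) F12 _].
by move: (leq_trans EF (leq_trans F12 Fj)); rewrite leqNgt jE.
Qed.

(** The dual of [tinorm_upper]. Vectors of norm at most 1 that witness norm above [theta] on the [n]
    intervals have a sum [Y] of norm at most [3 * n^(1 - s)], and [Y] pairs with [b] to at least
    [n * theta], where [n = n^s * n^(1 - s)]. *)
Lemma dle_lower l b X (theta : R) : 0 <= theta -> adm l -> dle b X ->
  (forall E, E \in l -> ~ dle (cut E.1 E.2 b) theta) -> (size l)%:R `^ s * theta <= 3 * X.
Proof.
move=> t0 al bX hl.
have X0 := dle_ge0 bX.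
have [/size0nil ->|l0] := posnP (size l).
  by rewrite powR0 ?mul0r ?mulr_ge0// gt_eqF ?s_gt0.
have /choice[U hU] : forall E, exists a, E \in l ->
    N (cut E.1 E.2 a) <= 1 /\ theta < \sum_(E.1 <= j < E.2) a j * b j.
  move=> E; have [El|_] := boolP (E \in l); last by exists (fun=> 0).
  by have [a h1 h2] := not_dle t0 (hl _ El); exists a.
pose M := \max_(E <- l) E.2.
have EM E : E \in l -> (E.2 <= M)%N by move=> El; rewrite /M (leq_bigmax_seq (F := snd) E).
pose Y j := \sum_(E <- l) cut E.1 E.2 (U E) j.
have hY j : (M <= j)%N -> Y j = 0.
  move=> Mj; rewrite /Y big1_seq// => E /= /EM EMM.
  by rewrite /cut/keep ltnNge (leq_trans EMM Mj) andbF.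
have fY : finsupp Y by exists M.
have dY : (size l)%:R * theta <= \sum_(j < M) Y j * b j.
  under [leRHS]eq_bigr => j _ do rewrite mulr_suml.
  rewrite exchange_big/=.
  have -> : (size l)%:R * theta = \sum_(E <- l) theta.
    by rewrite big_const_seq count_predT iter_addr addr0 mulr_natl.
  rewrite big_seq [leRHS]big_seq; apply: ler_sum => E El.
  apply: (le_trans (ltW (hU _ El).2)); rewrite -(sum_cut _ _ (EM _ El)).
  by apply: ler_sum => j _; rewrite /cut/keep; case: ifP; rewrite ?mul0r.
have NY : N Y <= 3 * 1 * (size l)%:R `^ (1 - s).
  pose g j := minn (count (fun E => E.2 <= j)%N l) (size l).-1.
  apply: (@tinorm_upper g) => //.
  - move=> i j ij; rewrite /g leq_min geq_minr andbT geq_min; apply/orP; left.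
    by apply: sub_count => E /= Ei; exact: leq_trans ij.
  - by move=> j; rewrite /g -[X in (_ < X)%N](prednK l0) ltnS geq_minr.
  move=> i; pose E0 := nth (0, 0)%N l i.
  have [il|li] := ltnP i (size l); last first.
    rewrite keep_nz ?tinorm0// => j /eqP gi; move: li; rewrite leqNgt => /negP; case.
    by rewrite -gi /g -[X in (_ < X)%N](prednK l0) ltnS geq_minr.
  have E0l : E0 \in l by exact: mem_nth.
  apply: le_trans (hU _ E0l).1; apply: tinorm_le => [|j]; first exact: finsupp_cut.
  rewrite {1}/keep; case: eqP => [gi|_]; last by rewrite normr0.
  suff -> : Y j = cut E0.1 E0.2 (U E0) j by [].
  rewrite /Y (big_nth (0, 0)%N) (big_mkord xpredT) (bigD1 (Ordinal il))//=.
  rewrite big1 ?addr0// => k ki; rewrite /cut {1}/keep; case: ifP => // jk; exfalso.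
  have ck := adm_count al (ltn_ord k) jk; move: ki gi; rewrite -val_eqE/= => /eqP ki.
  rewrite /g ck => gi; apply: ki; rewrite -gi; apply/esym/minn_idPl.
  by rewrite -ltnS prednK.
have lR : 0 < (size l)%:R :> R by rewrite ltr0n.
have := le_trans dY (le_trans (ler_norm _) (bX _ _ hY)).
move/le_trans/(_ (ler_wpM2l X0 NY)).
rewrite -{1}(powR_mul_compl s lR) mulrAC.
have -> : X * (3 * 1 * (size l)%:R `^ (1 - s)) = 3 * X * (size l)%:R `^ (1 - s) by ring.
by rewrite ler_pM2r// powR_gt0.
Qed.

(** Otherwise infinitely many successive intervals carry norm above [eps], against the lower
    q-estimate. *)
Lemma dle_tail b X (eps : R) : dle b X -> 0 < eps ->
  exists m, dle (keep (fun j => m <= j)%N b) eps.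
Proof.
move=> bX e0; apply: contrapT => no.
have /choice[h hh] : forall m, exists m', (m < m')%N /\ ~ dle (cut m m' b) eps.
  move=> m; apply: contrapT => no'; apply: no; exists m; apply: dle_fin => n.
  have [mn|nm] := ltnP m n.
    apply: contrapT => ne; apply: no'; exists n; split => //; apply: contra_not ne.
    by congr dle; apply/funext => j; rewrite /cut keepK /keep leq0n andbC.
  move: (dle_le (ltW e0) dle0); congr dle; apply/funext => j; rewrite /cut keepK /keep.
  case: ifP => // /andP[jn mj]; move: (leq_trans nm mj).
  by rewrite leqNgt; move: jn; rewrite leq0n/= => ->.
pose t i := iter i h 0%N.
have tS i : (t i < t i.+1)%N by case: (hh (t i)).
have t_le i k : (i <= k)%N -> (t i <= t k)%N by move=> ik; rewrite incr_leE//; exact: incr_step.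
have [n [n0 hn]] := powR_unbounded (3 * X / eps) s_gt0.
have al := adm_partition n t_le.
have : (size (partition_seq t n))%:R `^ s * eps <= 3 * X.
  by apply: dle_lower bX _ => // [|E /mapP[i _ ->]]; [exact/ltW|case: (hh (t i))].
by rewrite size_map size_iota -ler_pdivlMr// leNgt hn.
Qed.

(** * Spreading and blocks in the dual *)

Section Incr.
Variable t : nat -> nat.
Hypothesis t_lt : forall i j, (i < j)%N -> (t i < t j)%N.

Lemma sum_incr (F : nat -> R) (m : nat) : (forall j, (forall k, j <> t k) -> F j = 0) ->
  \sum_(k < m) F (t k) = \sum_(j < t m) F j.
Proof.
move=> F0; rewrite -(big_mkord xpredT F) -(big_mkord xpredT (F \o t)).
rewrite [RHS](big_cat_nat (n := t 0%N) (p := t m))//=; last by rewrite incr_leE.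
rewrite [X in X + _]big1_seq ?add0r => [|j /=]; last first.
  rewrite mem_index_iota => /andP[_ jt]; apply: F0 => k jk.
  by move: jt; rewrite jk ltnNge incr_leE.
rewrite (@sum_nat_blocks _ F t) => [|i]; last by rewrite incr_leE.
rewrite big_mkord; apply: eq_bigr => k _ /=.
rewrite big_ltn ?t_lt// big1_seq ?addr0// => j /=; rewrite mem_index_iota => /andP[j1 j2].
apply: F0 => i ji; move: j1 j2; rewrite ji !incr_ltE// ltnS => h1 h2.
by move: (leq_trans h1 h2); rewrite ltnn.
Qed.

Lemma dle_spread b X : (forall j, (forall k, j <> t k) -> b j = 0) ->
  dle (b \o t) X -> dle b X.
Proof.
move=> b0 bX m a hm; have fa : finsupp a by exists m.
have hm' j : (m <= j)%N -> (a \o t) j = 0.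
  by move=> mj /=; rewrite hm// (leq_trans mj)// incr_ge.
rewrite (@sum_supp_indep (fun j => a j * b j) m (t m)) => [|j mj|j mj]; last 2 first.
- by rewrite hm// mul0r.
- by rewrite hm ?mul0r// (leq_trans _ mj)// incr_ge.
rewrite -(sum_incr (F := fun j => a j * b j)) => [|j /b0 ->]; last by rewrite mulr0.
apply: (le_trans (bX _ _ hm')); rewrite ler_wpM2l ?(dle_ge0 bX)//.
exact: tinorm_comp_incr.
Qed.

Lemma dle_comp_incr b X : dle b X -> dle (b \o t) X.
Proof.
move=> bX m a hm.
(* Spreads [a] along [t]. The only candidate for a preimage of [j] under [t] is [blk t j], so the
   test decides whether there is one. *)
pose a' j := if t (blk t j) == j then a (blk t j) else 0.
have a't k : a' (t k) = a k.
  have bk : blk t (t k) = k by apply/eqP; rewrite blk_eq ?incr_leE ?leqnn// t_lt/=.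
  by rewrite /a' bk eqxx.
have a'0 j : (forall k, j <> t k) -> a' j = 0.
  by move=> h; rewrite /a'; case: eqP => // e; case: (h (blk t j)).
have ha' j : (t m <= j)%N -> a' j = 0.
  move=> mj; have [[k e]|ne] := pselect (exists k, j = t k).
    by rewrite e a't hm//; move: mj; rewrite e incr_leE.
  by rewrite a'0// => k e; apply: ne; exists k.
have -> : \sum_(j < m) a j * (b \o t) j = \sum_(j < t m) a' j * b j.
  rewrite -(sum_incr (F := fun j => a' j * b j)) => [|j /a'0 ->]; last by rewrite mul0r.
  by apply: eq_bigr => j _; rewrite a't.
apply: (le_trans (bX _ _ ha')); rewrite ler_wpM2l ?(dle_ge0 bX)//.
have fa' : finsupp a' by exists (t m).
apply: (le_trans (tinorm_spread t_lt fa' a'0)).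
have -> : a' \o t = a by apply/funext => k; exact: a't.
exact: lexx.
Qed.

(** The pairing is at most [M] times that of [|c|] with the sequence of block norms of [a], and this
    sequence has norm at most [N a] by [tinorm_block_norms]. *)
Lemma dle_blocks (f : nat -> nat -> R) (c : nat -> R) M X m n :
  (forall k j, ~~ (t k <= j < t k.+1)%N -> f k j = 0) -> (forall k, dle (f k) M) ->
  dle c X -> dle (fun j => \sum_(m <= k < n) c k * f k j) (M * X).
Proof.
move=> fsupp fM cX q a hq; have fa : finsupp a by exists q.
have M0 := dle_ge0 (fM 0%N).
pose A k := N (cut (t k) (t k.+1) a).
have A0 k : 0 <= A k by apply/tinorm_ge0/finsupp_cut.
have hA k : (q <= k)%N -> A k = 0.
  move=> qk; rewrite /A /cut keep_nz ?tinorm0// => j /andP[kj _]; rewrite hq//.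
  by apply: (leq_trans qk); apply: leq_trans kj; exact: incr_ge.
under eq_bigr => j _ do rewrite mulr_sumr.
rewrite exchange_big/=; apply: (le_trans (ler_norm_sum _ _ _)).
have term k : `|\sum_(j < q) a j * (c k * f k j)| <= M * (A k * `|c k|).
  under eq_bigr => j _ do rewrite mulrCA.
  rewrite -mulr_sumr normrM [leRHS]mulrA [leRHS]mulrC ler_wpM2l//.
  rewrite (eq_bigr (fun j : 'I_q => cut (t k) (t k.+1) a j * f k j)) => [|j _].
    by apply: fM => j /hq aj; rewrite /cut/keep aj if_same.
  rewrite /cut/keep; case: ifPn => // /fsupp ->; by rewrite !mulr0.
apply: (@le_trans _ _ (\sum_(m <= k < n) M * (A k * `|c k|))); first exact: ler_sum.
rewrite -mulr_sumr -mulrA ler_wpM2l//.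
apply: (@le_trans _ _ (\sum_(k < maxn n q) A k * `|c k|)).
  rewrite -(@sum_cut _ _ (maxn n q)) ?leq_maxl//; apply: ler_sum => k _.
  by case: ifP => // _; rewrite mulr_ge0.
rewrite (@sum_supp_indep (fun k => A k * `|c k|) (maxn n q) q) => [|k|k /hA ->]; last 2 first.
- by rewrite geq_max => /andP[_ /hA ->]; rewrite mul0r.
- by rewrite mul0r.
have cX' : dle (fun k => `|c k|) X by apply: dle_dom cX _ => k; rewrite normr_id.
apply: (le_trans (le_trans (ler_norm _) (cX' _ _ hA))).
rewrite ler_wpM2l ?(dle_ge0 cX)//; exact: tinorm_block_norms.
Qed.

End Incr.

(** * Convergent series in the dual and subsymmetry of the basis *)

Definition psums (x : nat -> nat -> R) (c : nat -> R) m n : nat -> R :=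
  fun j => \sum_(m <= k < n) c k * x k j.

(** Convergence without mention of the limit; equivalent to [converges] by completeness
    ([converges_cau]). *)
Definition cau x c := forall eps : R, 0 < eps ->
  exists M, forall m n, (M <= m)%N -> (m <= n)%N -> dle (psums x c m n) eps.

Lemma psumsE x c n : psum x c n = psums x c 0 n.
Proof. by apply/funext => j; rewrite /psums big_mkord. Qed.

Lemma psums_cat x c m k n : (m <= k)%N -> (k <= n)%N ->
  psums x c m n = psums x c m k \+ psums x c k n.
Proof. by move=> mk kn; apply/funext => j; rewrite /psums (big_cat_nat mk kn). Qed.

Lemma psums1 x c n : psums x c n n.+1 = fun j => c n * x n j.
Proof. by apply/funext => j; rewrite /psums big_nat1. Qed.

Lemma psums_ge x c m n : (n <= m)%N -> psums x c m n = fun=> 0.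
Proof. by move=> nm; apply/funext => j; rewrite /psums big_geq. Qed.

Lemma dle_psums x c (B : nat -> R) m n : (forall k, dle (x k) (B k)) ->
  dle (psums x c m n) (\sum_(m <= k < n) `|c k| * B k).
Proof. by move=> xB; apply: dle_sum => k; exact: dleZ. Qed.

Lemma dle_sub_opp b b' X : dle (b \- b') X -> dle (b' \- b) X.
Proof. by move/dle_dom; apply => j; rewrite /= distrC. Qed.

Lemma psums_cut x c m0 m n n0 : (m0 <= m)%N -> (n <= n0)%N ->
  psums x (cut m n c) m0 n0 = psums x c m n.
Proof.
move=> m0m nn0; apply/funext => j; rewrite /psums (big_nat_widenl _ _ _ _ _ m0m).
rewrite (big_nat_widen _ _ _ _ _ nn0) big_mkcond/= [RHS]big_mkcond/=.
by apply: eq_bigr => k _; rewrite /cut/keep; case: ifP => _; rewrite ?mul0r.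
Qed.

Lemma sum_powR_cut c (e : R) m0 m n n0 : e != 0 -> (m0 <= m)%N -> (n <= n0)%N ->
  \sum_(m0 <= k < n0) `|cut m n c k| `^ e = \sum_(m <= k < n) `|c k| `^ e.
Proof.
move=> e0 m0m nn0; rewrite [RHS](big_nat_widenl _ _ _ _ _ m0m).
rewrite (big_nat_widen _ _ _ _ _ nn0) [RHS]big_mkcond/=.
by apply: eq_bigr => k _; rewrite /cut/keep; case: ifP => _; rewrite ?normr0 ?powR0.
Qed.

Lemma sums_to_cau x c y : sums_to p gamma x c y -> cau x c.
Proof.
move=> [_ h] eps e0; have [M hM] := h _ (divr_gt0 e0 (ltr0n R 2)).
exists M => m n Mm mn.
have /dnorm_leP h1 := hM m Mm; have /dnorm_leP h2 := hM n (leq_trans Mm mn).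
rewrite [eps](splitr) addrC; move: (dleD h2 (dle_sub_opp h1)); congr dle.
apply/funext => j /=; rewrite !psumsE addrA subrK.
by rewrite (psums_cat x c (leq0n m) mn)/= addrC addKr.
Qed.

(** Completeness of the dual: the limit is taken coordinatewise, and [dle_closed] carries the Cauchy
    bounds over to it. *)
Lemma cau_sums_to x c : (forall k, exists X, dle (x k) X) -> cau x c ->
  exists y, sums_to p gamma x c y.
Proof.
move=> /choice[B xB] hc.
have /choice[y hy] : forall j, exists y : R, forall eps : R, 0 < eps ->
    exists M, forall n, (M <= n)%N -> `|psums x c 0 n j - y| <= eps.
  move=> j; apply: real_cauchy => eps e0; have [M hM] := hc _ e0; exists M => n Mn.
  have := dle_coord j (hM _ _ (leqnn M) Mn).
  by rewrite (psums_cat x c (leq0n M) Mn)/= addrAC subrr add0r.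
have lim (eps : R) : 0 < eps -> exists M, forall n, (M <= n)%N -> dle (psums x c 0 n \- y) eps.
  move=> e0; have [M hM] := hc _ e0; exists M => n Mn; apply: dle_closed => m e e1.
  have /choice[K hK] := fun j => hy j _ e1.
  pose n' := maxn n (\max_(j < m) K j).
  have nn' : (n <= n')%N by exact: leq_maxl.
  exists (psums x c 0 n \- psums x c 0 n').
    apply: dle_sub_opp; move: (hM _ _ Mn nn'); congr dle; apply/funext => j /=.
    by rewrite (psums_cat x c (leq0n n) nn')/= addrAC subrr add0r.
  move=> j jm; have -> : (psums x c 0 n \- y) j - (psums x c 0 n \- psums x c 0 n') j =
      psums x c 0 n' j - y j by rewrite /=; ring.
  apply: hK.
  apply: leq_trans (leq_maxr _ _); exact: (leq_bigmax (Ordinal jm)).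
exists y; split; last first.
  move=> eps /lim[M hM]; exists M => n /hM/dnorm_leP.
  by congr (_ <= _)%E; congr dnorm; apply/funext => j; rewrite psumsE.
apply/inTistarP; have [M /(_ M (leqnn M))/dle_sub_opp h] := lim 1 ltr01.
exists (1 + \sum_(0 <= k < M) `|c k| * B k).
move: (dleD h (dle_psums c 0 M xB)); congr dle; apply/funext => j /=; exact: subrK.
Qed.

Lemma converges_cau x c : (forall k, inTistar p gamma (x k)) ->
  converges p gamma x c <-> cau x c.
Proof.
move=> hx; split => [[y /sums_to_cau//]|h].
by apply: cau_sums_to h => k; apply/inTistarP.
Qed.

Lemma psums_estar (c : nat -> R) m n : psums (@estar R) c m n = cut m n c.
Proof.
apply/funext => j; rewrite /psums /cut /keep.
transitivity (\sum_(m <= k < n | k == j) c k); last by rewrite big_nat1_eq.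
rewrite [RHS]big_mkcond/=.
by apply: eq_bigr => k _; rewrite /estar eq_sym; case: ifP; rewrite ?mulr1 ?mulr0.
Qed.

Lemma dle_estar k : dle (@estar R k) 1.
Proof.
have h j : (k.+1 <= j)%N -> @estar R k j = 0 by rewrite /estar => /gtn_eqF ->.
move: (dle_l1 h); rewrite big_ord_recr/= big1 ?add0r => [|j _].
  by rewrite /estar eqxx normr1.
by rewrite /estar ltn_eqF ?normr0.
Qed.

(** The basis is boundedly complete: once the dual norm of [c] is finite, its tails vanish by
    [dle_tail]. *)
Lemma cau_estar (c : nat -> R) : cau (@estar R) c <-> exists X, dle c X.
Proof.
split => [h|[X cX] eps e0].
  have [M hM] := h _ ltr01; exists (1 + \sum_(j < M) `|cut 0 M c j|).
  apply: dle_fin => m; have [mM|/ltnW Mm] := leqP m M.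
    rewrite addrC; apply: dle_le (_ : \sum_(j < m) `|cut 0 m c j| <= _) _; last first.
      by apply: dle_l1 => j mj; rewrite /cut/keep ltnNge mj.
    apply: ler_wpDr => //; rewrite (big_ord_widen _ (fun j => `|cut 0 m c j|) mM) big_mkcond/=.
    by apply: ler_sum => j _; rewrite /cut/keep !leq0n ltn_ord/=; case: ifP => // ->.
  move: (hM _ _ (leqnn M) Mm); rewrite psums_estar => h1.
  have h2 : dle (cut 0 M c) (\sum_(j < M) `|cut 0 M c j|).
    by apply: dle_l1 => j Mj; rewrite /cut/keep ltnNge Mj.
  move: (dleD h1 h2); congr dle; apply/funext => j; rewrite /cut/keep/=.
  case: (leqP M j) => Mj/=; first by rewrite addr0.
  by rewrite add0r (leq_trans Mj Mm).
have [M hM] := dle_tail cX e0; exists M => m n Mm mn; rewrite psums_estar.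
apply: dle_dom hM _ => j; rewrite /cut/keep; case: ifP => [/andP[mj _]|_]; last by rewrite normr0.
by rewrite (leq_trans Mm mj).
Qed.

Lemma estar_inTistar k : inTistar p gamma (@estar R k).
Proof. by apply/inTistarP; exists 1; exact: dle_estar. Qed.

Lemma basic_estar : basic p gamma (@estar R).
Proof.
split => [|y [/inTistarP[X yX] _]]; first exact: estar_inTistar.
exists y; split => [|c [_ h]].
  split; first by apply/inTistarP; exists X.
  move=> eps e0; have [M hM] := dle_tail yX e0; exists M => n Mn; apply/dnorm_leP.
  apply: dle_dom hM _ => j; rewrite psumsE psums_estar /cut/keep/=.
  case: ltnP => nj; first by rewrite subrr normr0.
  by rewrite sub0r normrN (leq_trans Mn nj).
apply/funext => j; apply/eqP; rewrite -subr_eq0 -normr_le0; apply/ler_addgt0Pr => eps e0.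
have [M hM] := h _ e0; have /dnorm_leP := hM _ (leq_maxl M j.+1).
move/(dle_coord j); rewrite psumsE psums_estar /cut/keep/= leq_max ltnSn orbT.
by rewrite add0r distrC.
Qed.

Lemma subsymmetric_estar : subsymmetric p gamma (@estar R).
Proof.
split; first exact: basic_estar; split.
  move=> c /(converges_cau c estar_inTistar)/cau_estar[X cX] pi [rho piK rhoK].
  apply/converges_cau => [k|]; first exact: estar_inTistar.
  move=> eps e0; have [M hM] := dle_tail cX e0.
  (* From this index on, the permuted series has used up all coordinates below [M], so that the rest
     is dominated by the tail of [c]. *)
  exists (\max_(j < M) rho j).+1 => m n Mm mn; apply: dle_dom hM _ => j.
  rewrite /psums /keep (eq_bigr (fun k => if k == rho j then c j else 0)) => [|k _]; last first.
    rewrite /= /estar; have [->|ne] := eqVneq j (pi k); first by rewrite piK eqxx mulr1.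
    by rewrite ifN ?mulr0//; apply: contra_neq ne => ->; rewrite rhoK.
  rewrite -big_mkcond/= big_nat1_eq; case: ifP => [/andP[mr _]|_]; last by rewrite normr0.
  case: leqP => // jM; move: (leq_trans Mm mr); rewrite ltnNge => /negP; case.
  exact: (leq_bigmax (Ordinal jM)).
move=> sigma sigma_lt c; rewrite !converges_cau; try by move=> k; exact: estar_inTistar.
have SE m n : psums (@estar R \o sigma) c m n \o sigma = cut m n c.
  rewrite -psums_estar; apply/funext => j; apply: eq_bigr => k _; congr (_ * _).
  by rewrite /= /estar !eqn_leq !incr_leE.
have S0 m n j : (forall k, j <> sigma k) -> psums (@estar R \o sigma) c m n j = 0.
  by move=> h; rewrite /psums big1// => k _; rewrite /= /estar; case: eqP => [/h//|_]; rewrite mulr0.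
split=> h eps e0; have [M hM] := h _ e0; exists M => m n Mm mn.
  by apply: (dle_spread sigma_lt (@S0 m n)); rewrite SE -psums_estar; exact: hM.
by rewrite psums_estar -SE; apply: dle_comp_incr; last exact: hM.
Qed.

(* Cutting greedily into maximal pieces of norm at most [theta]. *)
Lemma greedy b (theta : R) lo hi : (lo <= hi)%N -> 0 <= theta -> (forall j, `|b j| <= theta) ->
  exists l l', [/\ adm l /\ adm l', all (fun E => lo <= E.1)%N l /\ all (fun E => E.2 <= hi)%N l,
    all (fun E => lo <= E.1)%N l' /\ (size l <= (size l').+1)%N,
    split_dle l (cut lo hi b) (2 * theta) &
    forall E, E \in l' -> ~ dle (cut E.1 E.2 b) theta].
Proof.
move=> + t0 bt; have [k] := ubnP (hi - lo); elim: k lo => // k IH lo lk lohi.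
have t2 : theta <= 2 * theta by rewrite mulr2n mulrDl mul1r lerDl.
have [small|big] := pselect (dle (cut lo hi b) theta).
  (* [l'] collects the pieces of norm above [theta]. Only the final piece can fail this, which
     accounts for the successor in the bound on [size l]. *)
  exists [:: (lo, hi)], [::]; split => //=; rewrite ?lohi ?leqnn//.
    by rewrite /adm/= lohi.
  by apply: split_dle1; exact: dle_le small.
have ex : exists h, `[< ~ dle (cut lo h b) theta >] by exists hi; apply/asboolP.
case: (ex_minnP ex) => h /asboolP hb hmin {ex}.
have loh : (lo < h)%N.
  rewrite ltnNge; apply/negP => hl; apply: hb; apply: dle_le t0 _; move: dle0.
  congr dle; apply/funext => j; rewrite /cut/keep; case: ifP => // /andP[h1 h2].
  by move: (leq_trans h2 (leq_trans hl h1)); rewrite ltnn.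
have hhi : (h <= hi)%N by apply: hmin; exact/asboolP.
(* By minimality of [h], the piece without its last coordinate has norm at most [theta], and that
   coordinate adds at most [theta]. *)
have hdle : dle (cut lo h b) (2 * theta).
  case: h loh hmin {hb hhi} => // h loh hmin.
  have h1 : dle (cut lo h b) theta.
    by apply: contrapT => /asboolP/hmin; rewrite ltnn.
  have h2 := dleZ theta (dle_estar h); rewrite mulr1 ger0_norm// in h2.
  rewrite mulr2n mulrDl mul1r; move: (dleD h1 h2) => /dle_dom; apply => j.
  rewrite /= /cut /keep /estar ltnS [(j <= h)%N]leq_eqVlt; have [->|ne] := eqVneq j h.
    by rewrite ltnn andbF add0r mulr1 (ger0_norm t0); case: ifP; rewrite ?normr0.
  by rewrite /= mulr0 addr0.
have [|l [l' [[al al'] [llo lhi] [l'lo sz] sp nd]]] := IH h _ hhi.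
  exact: leq_trans (ltn_sub2l (leq_trans loh hhi) loh) lk.
exists ((lo, h) :: l), ((lo, h) :: l'); split.
- by rewrite !adm_cons/= (ltnW loh) llo l'lo.
- rewrite /= leqnn hhi lhi andbT/=; split => //; apply: sub_all llo => E; exact/leq_trans/ltnW.
- rewrite /= leqnn ltnS; split => //; apply: sub_all l'lo => E; exact/leq_trans/ltnW.
- rewrite -[_ :: l]/([:: (lo, h)] ++ l).
  have -> : cut lo hi b = cut lo h b \+ cut h hi b.
    apply/funext => j; rewrite /cut/keep/=; case: (ltnP j h) => jh; last first.
      by rewrite andbF add0r (leq_trans (ltnW loh) jh).
    by rewrite andbT addr0 (leq_trans jh hhi) andbT.
  by apply: split_dle_cat sp; exact: split_dle1.
- by move=> E; rewrite inE => /predU1P[->//|]; exact: nd.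
Qed.

(** * Upper q-estimates for flat blocks *)

Lemma powR_sum_le1 (c : nat -> R) m n k : \sum_(m <= k < n) `|c k| `^ s^-1 <= 1 ->
  (m <= k < n)%N -> `|c k| <= 1.
Proof.
move=> csum /andP[mk kn]; rewrite leNgt; apply/negP => ck; have s0 := s_gt0.
have : 1 < `|c k| `^ s^-1.
  apply: (@le_lt_trans _ _ (1 `^ s^-1)); first by rewrite powR1.
  by apply: gt0_ltr_powR; rewrite ?invr_gt0 ?nnegrE.
rewrite ltNge => /negP; apply; apply: le_trans csum.
by rewrite (big_cat_nat mk (ltnW kn))/= (big_ltn kn) addrCA lerDl addr_ge0// sumr_ge0//.
Qed.

(** The bound of [split_dle_dle] for [n * (1 + (3 * M)^q)] pieces of norm [2 * n^-s], in which the
    powers of [n] cancel. *)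
Definition flat_const (M : R) : R := 2 * gamma^-1 * (1 + (3 * M) `^ s^-1) `^ s.

(* Cut [c k *: f k] greedily into pieces of norm about [n `^ - s]: by [dle_lower]
   there are at most [1 + n * (3 * M * `|c k|) `^ s^-1] of them, hence [O(n)] in all. *)
Lemma dle_flat (f : nat -> nat -> R) (t : nat -> nat) (c : nat -> R) (n : nat) (M : R) :
  (0 < n)%N -> (forall k, (t k <= t k.+1)%N) ->
  (forall k j, (k < n)%N -> ~~ (t k <= j < t k.+1)%N -> f k j = 0) ->
  (forall k, (k < n)%N -> dle (f k) M) ->
  (forall k j, (k < n)%N -> `|f k j| <= (n%:R `^ s)^-1) ->
  \sum_(0 <= k < n) `|c k| `^ s^-1 <= 1 ->
  dle (psums f c 0 n) (flat_const M).
Proof.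
move=> n0 tS fsupp fM fsmall csum.
have s0 := s_gt0; have g0 := gamma_gt0.
have M0 : 0 <= M by exact: dle_ge0 (fM 0%N n0).
set theta := (n%:R `^ s)^-1 in fsmall.
have th0 : 0 < theta by rewrite invr_gt0 powR_gt0// ltr0n.
have c1 k : (k < n)%N -> `|c k| <= 1 by exact: (powR_sum_le1 csum).
have step m : (m <= n)%N -> exists l, [/\ adm l, all (fun E => E.2 <= t m)%N l,
    split_dle l (psums f c 0 m) (2 * theta) &
    (size l)%:R <= \sum_(0 <= k < m) (1 + (3 * M) `^ s^-1 * n%:R * `|c k| `^ s^-1)].
  elim: m => [_|m IH mn].
    exists [::]; split; rewrite ?big_geq// psums_ge// => q a _.
    by rewrite big_nil mulr0 big1 ?normr0// => j _; rewrite mulr0.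
  have [l [al lm sp sz]] := IH (ltnW mn).
  have small j : `|c m * f m j| <= theta.
    by rewrite normrM -[leRHS]mul1r ler_pM// ?c1// fsmall.
  have [l1 [l1' [[al1 al1'] [l1lo l1hi] [l1'lo sz1] sp1 nd1]]] := greedy (tS m) (ltW th0) small.
  exists (l ++ l1); split.
  - exact: (adm_cat (m := t m)).
  - rewrite all_cat l1hi andbT; apply: sub_all lm => E /leq_trans; exact.
  - have -> : psums f c 0 m.+1 = psums f c 0 m \+ cut (t m) (t m.+1) (fun j => c m * f m j).
      rewrite (psums_cat f c (leq0n m) (leqnSn m)) psums1; congr (_ \+ _); apply/funext => j.
      by rewrite /cut/keep; case: ifPn => // /(fsupp m _ mn) ->; rewrite mulr0.
    exact: split_dle_cat.
  rewrite size_cat natrD big_nat_recr//=; apply: lerD => //.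
  apply: (@le_trans _ _ ((size l1').+1)%:R); first by rewrite ler_nat.
  rewrite -natr1 addrC lerD2l.
  have := dle_lower (ltW th0) al1' (dleZ (c m) (fM m mn)) nd1.
  rewrite -ler_pdivlMr// invrK => h.
  have -> : (size l1')%:R = ((size l1')%:R `^ s) `^ s^-1 :> R.
    by rewrite -powRrM mulfV ?gt_eqF// powRr1.
  have -> : (3 * M) `^ s^-1 * n%:R * `|c m| `^ s^-1 = (3 * (`|c m| * M) * n%:R `^ s) `^ s^-1.
    rewrite (_ : 3 * (`|c m| * M) = 3 * M * `|c m|); last by ring.
    rewrite (@powRM _ (3 * M * `|c m|) (n%:R `^ s) s^-1) ?mulr_ge0 ?powR_ge0//.
    rewrite -powRrM mulfV ?gt_eqF// powRr1//.
    by rewrite (@powRM _ (3 * M) `|c m| s^-1) ?mulr_ge0// mulrAC.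
  by apply: ge0_ler_powR; rewrite ?nnegrE ?invr_ge0 ?(ltW s0) ?powR_ge0// !mulr_ge0// powR_ge0.
have [l [al _ sp sz]] := step n (leqnn n).
have {}sz : (size l)%:R <= n%:R * (1 + (3 * M) `^ s^-1).
  apply: (le_trans sz); rewrite big_split/= big_const_nat subn0 iter_addr addr0.
  rewrite -mulr_sumr mulrDr mulr1 lerD2l -mulrA mulrCA ler_wpM2l//.
  by rewrite ler_piMr// powR_ge0.
apply: dle_le (split_dle_dle _ al sp); last by rewrite mulr_ge0// ltW.
have -> : flat_const M = 2 * theta * gamma^-1 * (n%:R * (1 + (3 * M) `^ s^-1)) `^ s.
  rewrite powRM ?addr_ge0 ?powR_ge0// /flat_const.
  transitivity (2 / gamma * (1 + (3 * M) `^ s^-1) `^ s * (theta * n%:R `^ s)); last by ring.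
  by rewrite mulVf ?mulr1// gt_eqF// powR_gt0// ltr0n.
rewrite ler_wpM2l ?mulr_ge0 ?invr_ge0 ?(ltW th0) ?(ltW g0)//.
apply: ge0_ler_powR; rewrite ?nnegrE ?(ltW s0) ?mulr_ge0 ?addr_ge0 ?powR_ge0//.
Qed.

(** * Failure of upper q-estimates and of symmetry *)

Hypothesis gamma_le : gamma <= 100^-1.

(* Passing to blocks that nearly attain the best upper [q]-estimate on the tails,
   their norming vectors would contradict [flat_averages]. *)
Lemma no_lq (f : nat -> nat -> R) (t : nat -> nat) (delta K0 : R) :
  (forall i j, (i < j)%N -> (t i < t j)%N) ->
  (forall k j, ~~ (t k <= j < t k.+1)%N -> f k j = 0) ->
  0 < delta -> (forall k, ~ dle (f k) delta) ->
  (forall m n (c : nat -> R), \sum_(m <= k < n) `|c k| `^ s^-1 <= 1 -> dle (psums f c m n) K0) ->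
  False.
Proof.
move=> t_lt fsupp d0 fd hK0.
have s0 := s_gt0.
have p0 : 0 < p by exact: lt_trans ltr01 hp.
(* The constants of upper q-estimates that hold on some tail. No further tail improves the infimum
   [Ks], so normalized combinations of norm close to [Ks] exist arbitrarily far out. *)
pose A : set R := [set K | exists m0, forall m n (c : nat -> R), (m0 <= m)%N ->
  \sum_(m <= k < n) `|c k| `^ s^-1 <= 1 -> dle (psums f c m n) K]%classic.
have AK0 : A K0 by exists 0%N => m n c _; exact: hK0.
have Ad K : A K -> delta <= K.
  move=> [m0 h]; rewrite leNgt; apply/negP => Kd; apply: (fd m0).
  apply: dle_le (ltW Kd) _.
  have : \sum_(m0 <= k < m0.+1) `|1 : R| `^ s^-1 <= 1 by rewrite big_nat1 normr1 powR1.
  move=> /(h _ _ (fun=> 1) (leqnn m0)); rewrite psums1; congr dle.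
  by apply/funext => j; rewrite mul1r.
have hasA : has_inf A by split; [exists K0|exists delta => K /Ad].
pose Ks := inf A.
have Ks0 : 0 < Ks by apply: lt_le_trans d0 _; apply: lb_le_inf; [exists K0|move=> K /Ad].
(* This slack leaves [4/3 * Ks] as upper and [2/3 * Ks] as lower bound; their ratio 2 is just what
   the constant 1/2 of [flat_averages] contradicts. *)
have Ks3 : 0 < Ks / 3 by rewrite divr_gt0.
have [K1 [m0 hK1] K1lt] := inf_adherent Ks3 hasA; rewrite -/Ks in K1lt.
have next q : (m0 <= q)%N -> exists n (c : nat -> R), [/\ (q < n)%N,
    \sum_(q <= k < n) `|c k| `^ s^-1 <= 1 & ~ dle (psums f c q n) (2 / 3 * Ks)].
  move=> m0q; apply: contrapT => no.
  have : A (2 / 3 * Ks).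
    exists q => m n c qm cs; apply: contrapT => nd; apply: no.
    have mn : (m < n)%N.
      rewrite ltnNge; apply/negP => nm; apply: nd; rewrite psums_ge//.
      by apply: dle_le dle0; rewrite mulr_ge0 ?divr_ge0// ltW.
    exists n, (cut m n c); split; first exact: leq_ltn_trans mn.
      by rewrite sum_powR_cut// invr_eq0 gt_eqF.
    by rewrite psums_cut.
  move=> /(ge_inf hasA.2); rewrite -/Ks leNgt => /negP; apply; lra.
have /choice[h hh] : forall q, exists nc : nat * (nat -> R), (m0 <= q)%N ->
    [/\ (q < nc.1)%N, \sum_(q <= k < nc.1) `|nc.2 k| `^ s^-1 <= 1 &
      ~ dle (psums f nc.2 q nc.1) (2 / 3 * Ks)].
  move=> q; have [/next[n [c hc]]|_] := boolP (m0 <= q)%N; last by exists (0%N, fun=> 0).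
  by exists (n, c).
pose q i := iter i (fun q => (h q).1) m0.
have qm i : (m0 <= q i)%N.
  by elim: i => // i IH; apply: (leq_trans IH); have [/ltnW] := hh _ IH.
have qS i : (q i < q i.+1)%N by have [] := hh _ (qm i).
have q_lt := incr_step qS.
pose cc i := (h (q i)).2.
pose T i := t (q i).
have T_lt i j : (i < j)%N -> (T i < T j)%N by move=> ij; apply/t_lt/q_lt.
pose g i := psums f (cc i) (q i) (q i.+1).
have gsupp i j : ~~ (T i <= j < T i.+1)%N -> g i j = 0.
  move=> nj; rewrite /g /psums big_nat big1// => k /andP[k1 k2]; rewrite fsupp ?mulr0//.
  apply: contra nj => /andP[j1 j2]; apply/andP; split.
    by apply: leq_trans j1; rewrite /T incr_leE.
  by apply: leq_trans j2 _; rewrite /T incr_leE.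
have cutg i : cut (T i) (T i.+1) (g i) = g i.
  by apply/funext => j; rewrite /cut/keep; case: ifPn => // /gsupp.
have K23 : 0 <= 2 / 3 * Ks by rewrite mulr_ge0 ?divr_ge0// ltW.
have /choice[U hU] : forall i, exists a, N (cut (T i) (T i.+1) a) <= 1 /\
    2 / 3 * Ks < \sum_(T i <= j < T i.+1) a j * g i j.
  move=> i; have [_ _ nd] := hh _ (qm i); rewrite -/(g i) -(cutg i) in nd.
  by have [a h1 h2] := not_dle K23 nd; exists a.
pose u j := U (blk T j) j.
have cutu i : cut (T i) (T i.+1) u = cut (T i) (T i.+1) (U i).
  apply/funext => j; rewrite /cut/keep; case: ifP => // Tj; rewrite /u.
  have /eqP -> // : blk T j == i.
  by rewrite blk_eq//; have /andP[Tj1 _] := Tj; apply: leq_trans Tj1; rewrite incr_leE.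
have Nu i : N (cut (T i) (T i.+1) u) <= 1 by rewrite cutu; exact: (hU i).1.
have [n [a [a0 asum Na]]] := flat_averages gamma_le T_lt Nu.
(* The l_q-normalized sequence that norms [a]: both [b i^q] and [a i * b i] equal [a i^p]. *)
pose b i := a i `^ (p - 1).
pose C k := b (blk q k) * cc (blk q k) k.
have bq i k : (q i <= k < q i.+1)%N -> blk q k = i.
  move=> qk; apply/eqP; rewrite blk_eq//; have /andP[qk1 _] := qk.
  by apply: leq_trans qk1; rewrite incr_leE.
have Csum : \sum_(q 0%N <= k < q n) `|C k| `^ s^-1 <= 1.
  rewrite (@sum_nat_blocks _ _ q) => [|i]; last exact: ltnW.
  rewrite -asum; apply: ler_sum => i _.
  have -> : \sum_(q i <= k < q i.+1) `|C k| `^ s^-1 =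
      a i `^ p * \sum_(q i <= k < q i.+1) `|cc i k| `^ s^-1.
    rewrite mulr_sumr big_nat [RHS]big_nat; apply: eq_bigr => k /bq bk.
    rewrite /C bk normrM powRM// ger0_norm ?powR_ge0// /b -powRrM; congr (a i `^ _ * _).
    have ps : p * s = p - 1 by rewrite /s mulrBr mulr1 mulfV// gt_eqF.
    by rewrite -ps mulfK// gt_eqF.
  by have [_ h1 _] := hh _ (qm i); rewrite ler_piMr ?powR_ge0.
have := hK1 _ _ _ (qm 0%N) Csum; set G := psums f C _ _ => GK.
have Gg i j : (i < n)%N -> (T i <= j < T i.+1)%N -> G j = b i * g i j.
  move=> i_n Tj; rewrite /G /psums (@sum_nat_blocks _ _ q) => [|i']; last exact: ltnW.
  have GE i' : \sum_(q i' <= k < q i'.+1) C k * f k j = b i' * g i' j.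
    rewrite /g /psums mulr_sumr big_nat [RHS]big_nat; apply: eq_bigr => k /bq bk.
    by rewrite /C bk mulrA.
  rewrite (bigD1 (Ordinal i_n))//= GE big1 ?addr0// => i' ii'; rewrite GE gsupp ?mulr0//.
  apply: contra ii' => Tj'; rewrite -val_eqE/=.
  have T0j : (T 0%N <= j)%N by have /andP[Tj1 _] := Tj; apply: leq_trans Tj1; rewrite incr_leE.
  have /eqP <- : blk T j == i by rewrite blk_eq.
  by have /eqP <- : blk T j == i' by rewrite blk_eq.
pose Y j := \sum_(0 <= i < n) a i * cut (T i) (T i.+1) u j.
have Ysupp j : (T n <= j)%N -> Y j = 0.
  move=> Tj; rewrite /Y big_nat big1// => i /andP[_ i_n].
  have Tij : (T i.+1 <= j)%N by apply: leq_trans Tj; rewrite (incr_leE T_lt).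
  by rewrite /cut/keep ltnNge Tij andbF mulr0.
have := GK _ _ Ysupp; rewrite leNgt => /negP; apply.
have fY : finsupp Y by exists (T n).
apply: (@lt_le_trans _ _ (2 / 3 * Ks)).
  apply: (@le_lt_trans _ _ (4 / 3 * Ks * N Y)).
    rewrite ler_wpM2r ?tinorm_ge0//; lra.
  have KsN : Ks * N Y < Ks * 2^-1 by rewrite ltr_pM2l.
  lra.
apply: le_trans (ler_norm _).
have -> : \sum_(j < T n) Y j * G j =
    \sum_(i < n) a i `^ p * \sum_(T i <= j < T i.+1) U i j * g i j.
  under eq_bigr => j _ do rewrite /Y big_mkord mulr_suml.
  rewrite exchange_big/=; apply: eq_bigr => i _.
  rewrite -(@sum_cut _ _ (T n)) ?(incr_leE T_lt)// mulr_sumr; apply: eq_bigr => j _.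
  rewrite cutu /cut/keep; case: ifP => [Tj|]; last by rewrite !mulr0 mul0r.
  rewrite (Gg i)// -(@mulr_powRB1 _ (a i) p)// /b; ring.
have -> : 2 / 3 * Ks = \sum_(i < n) a i `^ p * (2 / 3 * Ks) by rewrite -mulr_suml asum mul1r.
apply: ler_sum => i _.
by rewrite ler_wpM2l ?powR_ge0// ltW// (hU i).2.
Qed.

Lemma dle_upper (t : nat -> nat) n b (theta : R) : 0 <= theta ->
  (forall i k, (i <= k)%N -> (t i <= t k)%N) ->
  (forall i, (i < n)%N -> dle (cut (t i) (t i.+1) b) theta) ->
  dle (cut (t 0%N) (t n) b) (theta * gamma^-1 * n%:R `^ s).
Proof.
move=> th0 t_le ht.
have sz : size (partition_seq t n) = n by rewrite size_map size_iota.
rewrite -[in n%:R]sz; apply: split_dle_dle => //; first exact: adm_partition.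
elim: n ht {sz} => [_|n IH ht].
  rewrite /cut keep_nz => [|j /andP[j1 j2]]; last by move: (leq_trans j2 j1); rewrite ltnn.
  by move=> m a _; rewrite big_nil mulr0 big1 ?normr0// => j _; rewrite mulr0.
rewrite /partition_seq -addn1 iotaD add0n map_cat addn1.
have -> : cut (t 0%N) (t n.+1) b = cut (t 0%N) (t n) b \+ cut (t n) (t n.+1) b.
  apply/funext => j; rewrite /cut/keep/=; case: (ltnP j (t n)) => jt.
    by rewrite andbT addr0 (leq_trans jt (t_le _ _ (leqnSn n))) andbT.
  by rewrite andbF add0r (leq_trans _ jt)// t_le.
apply: split_dle_cat; first by apply: IH => i /ltnW; exact: ht.
by apply: split_dle1; exact: ht.
Qed.

Lemma dle_glue (t : nat -> nat) b (B : nat -> R) X : t 0%N = 0%N ->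
  (forall i, (t i < t i.+1)%N) -> (forall i, dle (cut (t i) (t i.+1) b) (B i)) ->
  (forall n, \sum_(i < n) B i <= X) -> dle b X.
Proof.
move=> t0 tS bB hX; have t_lt := incr_step tS.
have h n : dle (cut 0 (t n) b) (\sum_(i < n) B i).
  elim: n => [|n IH].
    rewrite big_ord0; move: dle0; congr dle; apply/funext => j.
    by rewrite /cut/keep t0 ltn0 andbF.
  rewrite big_ord_recr/=; move: (dleD IH (bB n)); congr dle; apply/funext => j.
  rewrite /cut/keep !leq0n/=; case: (ltnP j (t n)) => jt; last by rewrite add0r.
  by rewrite addr0 (ltn_trans jt (tS n)).
apply: dle_fin => m; apply: dle_le (hX m) _; apply: dle_dom (h m) _ => j.
rewrite /cut/keep !leq0n/=; case: ifP => [jm|_]; last by rewrite normr0.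
by rewrite (leq_trans jm (incr_ge t_lt m)).
Qed.

Lemma sum_geometric n : \sum_(i < n) (2^-1 : R) ^+ i <= 2.
Proof.
suff -> : \sum_(i < n) (2^-1 : R) ^+ i = 2 - 2 * 2^-1 ^+ n.
  by rewrite gerBl mulr_ge0// exprn_ge0// invr_ge0.
elim: n => [|n IH]; first by rewrite big_ord0 expr0 mulr1 subrr.
by rewrite big_ord_recr/= IH exprS; field.
Qed.

(** After division by [n^s], a run of [n] ones is bounded in the dual and exactly as flat as
    [dle_flat] demands. *)
Lemma dle_indicator lo n : dle (cut lo (lo + n) (fun=> 1)) (gamma^-1 * n%:R `^ s).
Proof.
have := @dle_upper (fun i => lo + i)%N n (fun=> 1) 1 ler01.
rewrite addn0 mul1r; apply=> [i k ik|i _]; first by rewrite leq_add2l.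
move: (dle_estar (lo + i)); congr dle; apply/funext => j.
by rewrite /estar /cut /keep addnS ltnS -eqn_leq eq_sym.
Qed.

(* If the basis is symmetric, the transpositions of [n x n] blocks of indices turn
   the upper [q]-estimate of [dle_flat] for flat blocks into one for [estar]. *)
Lemma estar_not_symmetric : ~ symmetric_seq p gamma (@estar R).
Proof.
move=> [_ sym]; have s0 := s_gt0; have g0 := gamma_gt0.
suff [K0 hK0] : exists K0, forall m n (c : nat -> R),
    \sum_(m <= k < n) `|c k| `^ s^-1 <= 1 -> dle (psums (@estar R) c m n) K0.
  apply: (no_lq (t := id) (delta := 2^-1) _ _ _ _ hK0) => //.
  - move=> k j; rewrite ltnS -eqn_leq /estar eq_sym; by case: eqP.
  - move=> k /(dle_coord k); rewrite /estar eqxx normr1; lra.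
apply: contrapT => no.
(* The growth [4^i] is chosen to beat the weights [2^-i] in [w] below, leaving [2^i]. *)
have /choice[nc hnc] : forall i : nat, exists nc : nat * (nat -> R),
    [/\ (0 < nc.1)%N, \sum_(0 <= k < nc.1) `|nc.2 k| `^ s^-1 <= 1 &
      ~ dle (cut 0 nc.1 nc.2) (4 ^+ i)].
  move=> i; apply: contrapT => no'; apply: no; exists (4 ^+ i) => m n c cs.
  apply: contrapT => nd; apply: no'; exists (n, cut m n c) => /=.
  have cutcut : cut 0 n (cut m n c) = cut m n c.
    by rewrite /cut keepK; apply/funext => j; rewrite /keep leq0n/= andbC -andbA andbb.
  have mn : (m < n)%N.
    by rewrite ltnNge; apply/negP => nm; apply: nd; rewrite psums_ge//; apply: dle_le dle0; exact: exprn_ge0.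
  split; first exact: leq_ltn_trans mn.
    by rewrite sum_powR_cut// invr_eq0 gt_eqF.
  by rewrite cutcut -psums_estar.
pose nn i := (nc i).1; pose c i := (nc i).2.
have nn0 i : (0 < nn i)%N by case: (hnc i).
pose t i := \sum_(k < i) (nn k * nn k)%N.
have t0 : t 0%N = 0%N by rewrite /t big_ord0.
have tE i : t i.+1 = (t i + nn i * nn i)%N by rewrite /t big_ord_recr.
have tS i : (t i < t i.+1)%N by rewrite tE -[X in (X < _)%N]addn0 ltn_add2l muln_gt0 nn0.
have t_lt := incr_step tS.
(* [2^-i] makes the blocks summable, and [n^-s] normalizes runs of length [n]. *)
pose w i : R := 2^-1 ^+ i * ((nn i)%:R `^ s)^-1.
have ns0 i : 0 < (nn i)%:R `^ s by rewrite powR_gt0// ltr0n.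
(* Block [i] is a square array with [nn i] rows. In [d] its [k]-th row is constant, equal to
   [w i * c i k]; [pi] transposes the array, so that every row of [d \o pi] is a copy of [w i] times
   [c i]. *)
pose d j := let i := blk t j in w i * c i ((j - t i) %/ nn i)%N.
pose pi j := let i := blk t j in
  (t i + (((j - t i) %% nn i) * nn i + (j - t i) %/ nn i))%N.
have T0 j : (t 0%N <= j)%N by rewrite t0.
have in_blk i r : (r < nn i * nn i)%N -> blk t (t i + r) = i.
  by move=> rn; apply/eqP; rewrite blk_eq// leq_addr tE ltn_add2l.
have blk_r j : (j - t (blk t j) < nn (blk t j) * nn (blk t j))%N.
  by have /andP[h1 h2] := blkP t_lt (T0 j); rewrite ltn_subLR// -tE.
have swap_lt i r : (r < nn i * nn i)%N -> (r %% nn i * nn i + r %/ nn i < nn i * nn i)%N.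
  move=> rn; have h1 : (r %/ nn i < nn i)%N by rewrite ltn_divLR.
  have h2 : (r %% nn i < nn i)%N by rewrite ltn_pmod.
  by apply: leq_trans (_ : (r %% nn i).+1 * nn i <= _)%N; rewrite ?leq_pmul2r// mulSn addnC ltn_add2r.
have piE i r : (r < nn i * nn i)%N -> pi (t i + r)%N = (t i + (r %% nn i * nn i + r %/ nn i))%N.
  by move=> rn; rewrite /pi in_blk// addKn.
have jE j : j = (t (blk t j) + (j - t (blk t j)))%N.
  by have /andP[h1 _] := blkP t_lt (T0 j); rewrite subnKC.
have blk_pi j : blk t (pi j) = blk t j.
  by rewrite {1}(jE j) piE// in_blk// swap_lt.
have piK : involutive pi.
  move=> j; rewrite [in RHS](jE j) {1}(jE j) piE// piE ?swap_lt//; congr (_ + _)%N.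
  set i := blk t j; set r := (j - t i)%N.
  have h1 : (r %/ nn i < nn i)%N by rewrite ltn_divLR// blk_r.
  by rewrite divnMDl// modnMDl (divn_small h1) (modn_small h1) addn0 -divn_eq.
have dE i r : (r < nn i * nn i)%N -> d (t i + r)%N = w i * c i (r %/ nn i)%N.
  by move=> rn; rewrite /d in_blk// addKn.
have dpiE i r : (r < nn i * nn i)%N -> d (pi (t i + r)%N) = w i * c i (r %% nn i)%N.
  move=> rn; rewrite piE// dE ?swap_lt// divnMDl// divn_small ?addn0//.
  by rewrite ltn_divLR.
have dX : dle d (flat_const gamma^-1 * 2).
  apply: (dle_glue (t := t) (B := fun i => flat_const gamma^-1 * 2^-1 ^+ i)) => // [i|n]; last first.
    rewrite -mulr_sumr ler_wpM2l ?sum_geometric// /flat_const.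
    by rewrite mulr_ge0 ?powR_ge0// mulr_ge0 ?invr_ge0// ltW.
  pose f k j : R := if (t i <= j)%N && ((j - t i) %/ nn i == k)%N then ((nn i)%:R `^ s)^-1 else 0.
  have [_ csum _] := hnc i.
  have fsupp k j : (k < nn i)%N -> ~~ (t i + k * nn i <= j < t i + k.+1 * nn i)%N -> f k j = 0.
    move=> _; apply: contraNeq; rewrite /f; case: ifP => [/andP[tj /eqP jk] _|_]; last by rewrite eqxx.
    rewrite -(subnKC tj) leq_add2l ltn_add2l; apply/andP; split.
      by rewrite -leq_divRL// jk.
    by rewrite -ltn_divLR// jk.
  have fM k : (k < nn i)%N -> dle (f k) gamma^-1.
    move=> kn; have := dleZ ((nn i)%:R `^ s)^-1 (dle_indicator (t i + k * nn i) (nn i)).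
    rewrite gtr0_norm ?invr_gt0// mulrCA mulVf ?gt_eqF// mulr1 => /dle_dom; apply => j.
    rewrite /cut/keep -addnA -mulSnr; case: ifPn => [_|/(fsupp k j kn) ->]; last by rewrite normr0.
    by rewrite mulr1 /f; case: ifP => // _; rewrite normr0.
  have fsmall k j : (k < nn i)%N -> `|f k j| <= ((nn i)%:R `^ s)^-1.
    by move=> _; rewrite /f; case: ifP => _; rewrite ?normr0 ?gtr0_norm ?invr_gt0// ltW// invr_gt0.
  have tk_le k : (t i + k * nn i <= t i + k.+1 * nn i)%N by rewrite leq_add2l leq_pmul2r.
  have := dleZ (2^-1 ^+ i) (dle_flat (nn0 i) tk_le fsupp fM fsmall csum).
  rewrite ger0_norm ?exprn_ge0 ?invr_ge0// mulrC; congr dle; apply/funext => j.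
  rewrite /cut/keep; case: (leqP (t i) j) => [tj|jt]/=; last first.
    by rewrite /psums big1 ?mulr0// => k _; rewrite /f leqNgt jt mulr0.
  rewrite /psums (eq_bigr (fun k => if (k == (j - t i) %/ nn i)%N then c i k * ((nn i)%:R `^ s)^-1 else 0)).
    rewrite -big_mkcond/= big_nat1_eq leq0n/= ltn_divLR// ltn_subLR// -tE.
    case: ifP => [jt|]; last by rewrite mulr0.
    rewrite -{2}(subnKC tj) dE ?ltn_subLR -?tE// /w; ring.
  by move=> k _; rewrite /f tj/= eq_sym; case: ifP => // _; rewrite mulr0.
have : converges p gamma (@estar R) d.
  by apply/(converges_cau d estar_inTistar)/cau_estar; exists (flat_const gamma^-1 * 2).
have bij : bijective pi by exists pi.
move/(sym _ bij d).
have inT k : inTistar p gamma ((@estar R \o pi) k) by exact: estar_inTistar.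
move/(converges_cau d inT) => /(_ 4^-1 (ltac:(lra)))[M hM].
have := hM (t M) (t M.+1) (incr_ge t_lt M) (ltnW (tS M)).
have -> : psums (@estar R \o pi) d (t M) (t M.+1) = cut (t M) (t M.+1) (d \o pi).
  apply/funext => j; rewrite /psums (eq_bigr (fun k => if k == pi j then d (pi j) else 0)) => [|k _].
    rewrite -big_mkcond/= big_nat1_eq /cut/keep -!(blk_eq t_lt)//.
    by rewrite blk_pi.
  rewrite /= /estar; have [->|ne] := eqVneq j (pi k); first by rewrite piK eqxx mulr1.
  by rewrite ifN ?mulr0//; apply: contra_neq ne => ->; rewrite piK.
move=> hdle.
pose tt k := (t M + k * nn M)%N.
have tt_le i k : (i <= k)%N -> (tt i <= tt k)%N by move=> ik; rewrite leq_add2l leq_pmul2r.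
have w0 : 0 < w M by rewrite mulr_gt0 ?exprn_gt0 ?invr_gt0.
have th0 : 0 <= w M * 4 ^+ M by rewrite mulr_ge0 ?exprn_ge0// ltW.
have := dle_lower th0 (adm_partition (nn M) tt_le) hdle.
rewrite size_map size_iota /w => h.
(* After transposition each of the [nn M] rows has norm above [w M * 4^M]; the lower q-estimate
   multiplies this by [(nn M)^s], giving [2^M], whereas the Cauchy condition was used with the bound
   1/4. *)
have {h} : 2 ^+ M <= 3 * 4^-1 :> R.
  have -> : 2 ^+ M = (nn M)%:R `^ s * (2^-1 ^+ M * ((nn M)%:R `^ s)^-1 * 4 ^+ M) :> R.
    rewrite mulrAC (mulrC _ ((nn M)%:R `^ s)^-1) mulrA mulfV ?gt_eqF// mul1r -exprMn.
    by congr (_ ^+ _); field.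
  apply: h => E /mapP[k]; rewrite mem_iota add0n => /andP[_ kn] ->/=.
  have shift_lt (i j : nat) : (i < j)%N -> (tt k + i < tt k + j)%N by rewrite ltn_add2l.
  move=> /(dle_comp_incr shift_lt) /(dleZ (w M)^-1); rewrite gtr0_norm ?invr_gt0// mulrA.
  rewrite -/(w M) mulVf ?gt_eqF// mul1r; have [_ _] := hnc M; apply: contra_not; congr dle.
  apply/funext => l; rewrite /cut keepK /keep/=.
  have ttS : tt k.+1 = (tt k + nn M)%N by rewrite /tt mulSnr addnA.
  have ttE : (tt k + l = t M + (k * nn M + l))%N by rewrite /tt addnA.
  rewrite leq_addr ttS ltn_add2l -/(nn M) -/(c M); case: (ltnP l (nn M)) => ln /=; last by rewrite mulr0.
  have kl : (k * nn M + l < nn M * nn M)%N.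
    by apply: leq_trans (_ : k.+1 * nn M <= _)%N; rewrite ?leq_pmul2r// mulSn addnC ltn_add2r.
  by rewrite ttE leq_addr tE ltn_add2l kl/= dpiE// modnMDl modn_small// mulKf// gt_eqF.
have : 1 <= 2 ^+ M :> R by rewrite exprn_ege1// ler1n.
lra.
Qed.

(** * Subsymmetric sequences in the dual *)

(** Only a termwise identity is asked of [y] and [d], so that this covers both adding vectors under
    common coefficients and adding coefficients on common vectors. *)
Lemma cauD x c x' c' : cau x c -> cau x' c' ->
  forall y d, (forall k j, d k * y k j = c k * x k j + c' k * x' k j) -> cau y d.
Proof.
move=> h h' y d yE eps e0; have e2 := divr_gt0 e0 (ltr0n R 2).
have [M hM] := h _ e2; have [M' hM'] := h' _ e2.
exists (maxn M M') => m n; rewrite geq_max => /andP[Mm M'm] mn.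
rewrite (splitr eps); move: (dleD (hM _ _ Mm mn) (hM' _ _ M'm mn)); congr dle.
by apply/funext => j; rewrite /psums /= -big_split/=; apply: eq_bigr => k _; rewrite yE.
Qed.

Lemma cauZ x c (lambda : R) : cau x c -> cau x (fun k => lambda * c k).
Proof.
move=> h eps e0; have l1 : 0 < `|lambda| + 1 by rewrite ltr_wpDl.
have [M hM] := h _ (divr_gt0 e0 l1); exists M => m n Mm mn.
have := dleZ lambda (hM m n Mm mn); have le1 : `|lambda| * (eps / (`|lambda| + 1)) <= eps.
  by rewrite mulrCA ger_pMr// ler_pdivrMr// mul1r lerDl.
move/(dle_le le1); congr dle; apply/funext => j; rewrite /psums mulr_sumr.
by apply: eq_bigr => k _; rewrite mulrA.
Qed.

Lemma geometric_tail (C eps : R) : 0 <= C -> 0 < eps ->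
  exists M, forall m n, (M <= m)%N -> (m <= n)%N -> \sum_(m <= k < n) C * 2^-1 ^+ k <= eps.
Proof.
move=> C0 e0.
have geo m n : (m <= n)%N -> \sum_(m <= k < n) C * 2^-1 ^+ k = C * (2 * 2^-1 ^+ m - 2 * 2^-1 ^+ n).
  elim: n => [|n IH]; first by rewrite leqn0 => /eqP ->; rewrite big_geq// subrr mulr0.
  rewrite leq_eqVlt => /predU1P[->|]; first by rewrite big_geq// subrr mulr0.
  by rewrite ltnS => mn; rewrite big_nat_recr//= IH// exprS; field.
have := archi_boundP (divr_ge0 (mulr_ge0 (ler0n R 2) C0) (ltW e0)).
set M := Num.bound _ => MC.
have hM : 2 * C * 2^-1 ^+ M <= eps.
  rewrite exprVn ler_pdivrMr ?exprn_gt0// -ler_pdivrMl// mulrC.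
  by apply: (le_trans (ltW MC)); rewrite -natrX ler_nat; exact/ltnW/ltn_expl.
exists M => m n Mm mn; rewrite geo//; apply: le_trans hM; rewrite mulrBr (mulrCA C) mulrA.
apply: (@le_trans _ _ (2 * C * 2^-1 ^+ m)).
  by rewrite gerBl mulr_ge0// mulr_ge0// exprn_ge0// invr_ge0.
by rewrite ler_wpM2l ?mulr_ge0// ler_wiXn2l// ?invr_ge0// invf_le1// ler1n.
Qed.

Lemma cau_geometric y c (C : R) : (forall k, dle (fun j => c k * y k j) (C * 2^-1 ^+ k)) -> cau y c.
Proof.
move=> hC eps e0; have C0 : 0 <= C by have := dle_ge0 (hC 0%N); rewrite expr0 mulr1.
have [M hM] := geometric_tail C0 e0; exists M => m n Mm mn.
exact: dle_le (hM m n Mm mn) (dle_sum (index_iota m n) hC).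
Qed.

Lemma cau_term x c : cau x c -> forall eps, 0 < eps -> exists M, forall k, (M <= k)%N ->
  dle (fun j => c k * x k j) eps.
Proof.
by move=> h eps /h[M hM]; exists M => k Mk; rewrite -psums1; exact: hM.
Qed.

(** Unconditionality speaks of permutations only. If the subseries failed to be Cauchy, successive
    blocks would contain stretches whose terms in [A] have a large sum. Permuting each block so that
    these terms come first makes the large sums consecutive sums of a permuted, hence convergent,
    series. *)
Lemma unconditional_subseries x c (A : nat -> bool) : (forall k, inTistar p gamma (x k)) ->
  unconditional p gamma x -> cau x c -> cau x (keep A c).
Proof.
move=> inT unc cx; apply: contrapT => /existsNP[eps /not_implyP[e0 no]].
have /choice[h hh] : forall M, exists mn : nat * nat, [/\ (M <= mn.1)%N, (mn.1 < mn.2)%N &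
    ~ dle (psums x (keep A c) mn.1 mn.2) eps].
  move=> M; apply: contrapT => no'; apply: no; exists M => m n Mm mn; apply: contrapT => nd.
  apply: no'; exists (m, n); split => //=; rewrite ltn_neqAle mn andbT.
  apply/eqP => e; apply: nd; rewrite e psums_ge//; exact: dle_le (ltW e0) dle0.
pose t i := iter i (fun q => (h q).2) 0%N.
have tm i : (t i <= (h (t i)).1)%N by case: (hh (t i)).
have mt i : ((h (t i)).1 < t i.+1)%N by case: (hh (t i)).
have tS i : (t i < t i.+1)%N by exact: leq_ltn_trans (mt i).
have t_lt := incr_step tS.
(* Terms of the block that precede its large stretch are excluded, as the block starts where the
   previous stretch ended. *)
pose A' k := A k && ((h (t (blk t k))).1 <= k)%N.
have [pi bij hpi] := @block_perm t A' erefl tS.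
have := unc c ((converges_cau c inT).2 cx) pi bij.
have inT' k : inTistar p gamma ((x \o pi) k) by exact: inT.
move/(converges_cau _ inT') => /(_ _ e0)[M hM].
have [_ _] := hh (t M); apply.
have [q qt hq] := hpi M.
move: (hM (t M) (t M + q)%N (incr_ge t_lt M) (leq_addr _ _)); congr dle; apply/funext => j.
rewrite /psums /= (hq R (fun k => c k * x k j)) (big_cat_nat (tm M) (ltnW (mt M)))/=.
rewrite big_nat_cond big1 ?add0r => [|k /andP[/andP[k1 k2] /andP[_ k3]]].
  rewrite big_mkcond big_nat [RHS]big_nat; apply: eq_bigr => k /andP[k1 k2].
  have bk : blk t k = M by apply/eqP; rewrite blk_eq// (leq_trans (tm M) k1).
  by rewrite /A' bk k1 andbT /keep; case: ifP; rewrite ?mul0r.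
have bk : blk t k = M by apply/eqP; rewrite blk_eq// k1 (ltn_trans k2 (mt M)).
by move: k3; rewrite /A' bk leqNgt k2.
Qed.

Lemma subsym_cau x sigma : subsymmetric p gamma x ->
  (forall i j, (i < j)%N -> (sigma i < sigma j)%N) ->
  forall c, cau x c <-> cau (x \o sigma) c.
Proof.
move=> [[inT _] [_ sub]] sl c; have inT' k : inTistar p gamma ((x \o sigma) k) by exact: inT.
by rewrite -(converges_cau c inT) -(converges_cau c inT'); exact: sub.
Qed.

(** A zero vector would give 0 several expansions. *)
Lemma basic_neq0 x k : basic p gamma x -> exists2 delta : R, 0 < delta & ~ dle (x k) delta.
Proof.
move=> [inT uniq]; apply: contrapT => no.
have x0 j : x k j = 0.
  apply/eqP; rewrite -normr_le0; apply/ler_addgt0Pr => e e0; rewrite add0r.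
  by apply: dle_coord; apply: contrapT => nd; apply: no; exists e.
have z0 : inTistar p gamma (fun=> 0 : R) by apply/inTistarP; exists 0; exact: dle0.
have [|c [_ cu]] := uniq (fun=> 0).
  split=> // eps e0; exists 0%N, (fun=> 0); apply/dnorm_leP; apply: dle_le (ltW e0) _.
  by move: dle0; congr dle; apply/funext => j; rewrite psumsE psums_ge// subrr.
have sum0 c' : (forall i, i != k -> c' i = 0) -> sums_to p gamma x c' (fun=> 0).
  move=> c'0; split=> // eps e0; exists 0%N => n _; apply/dnorm_leP; apply: dle_le (ltW e0) _.
  move: dle0; congr dle; apply/funext => j; rewrite subr0 /psum big1// => i _.
  by have [->|/c'0 ->] := eqVneq (i : nat) k; rewrite ?x0 ?mulr0 ?mul0r.
have h1 := cu _ (sum0 (fun=> 0) (fun _ _ => erefl)).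
have h2 : c = fun i => (i == k)%:R by apply: cu; apply: sum0 => i /negbTE ->.
have := congr1 (@^~ k) h1; rewrite h2 eqxx => /eqP; by rewrite oner_eq0.
Qed.

(** Otherwise some subsequence has [k]-th norm at most [d k * 2^-k], where the norm of [x k] itself
    exceeds [d k]. With coefficients [1 / d k] the series converges along the subsequence, hence for
    [x], although its terms there have norm above 1. *)
Lemma subsym_lower x : subsymmetric p gamma x -> exists2 delta : R, 0 < delta &
  forall k, ~ dle (x k) delta.
Proof.
move=> ss; have [bx _] := ss; apply: contrapT => no.
have /choice[d hd] : forall k, exists delta : R, 0 < delta /\ ~ dle (x k) delta.
  by move=> k; have [delta h1 h2] := basic_neq0 k bx; exists delta.
have small (delta : R) K : 0 < delta -> exists j, (K <= j)%N /\ dle (x j) delta.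
  elim: K delta => [|K IH] delta d0.
    apply: contrapT => no'; apply: no; exists delta => // k dk; apply: no'; exists k; split => //.
  have m0 : 0 < Num.min delta (d K) by rewrite lt_min d0; case: (hd K).
  have [j [Kj hj]] := IH _ m0; exists j; split; last first.
    by apply: dle_le hj; rewrite ge_min lexx.
  rewrite ltn_neqAle Kj andbT; apply/eqP => Kj'; rewrite -Kj' in hj; apply: (hd K).2.
  by apply: dle_le hj; rewrite ge_min lexx orbT.
have [sigma sl hs] := @pick_incr (fun k j => dle (x j) (d k * 2^-1 ^+ k)) (fun k K =>
  small _ K (mulr_gt0 (hd k).1 (exprn_gt0 k (ltac:(by rewrite invr_gt0) : 0 < 2^-1 :> R)))).
have cx : cau x (fun k => (d k)^-1).
  apply/(subsym_cau ss sl); apply: (cau_geometric (C := 1)) => k; rewrite mul1r.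
  have := dleZ (d k)^-1 (hs k); have dk := (hd k).1.
  by rewrite gtr0_norm ?invr_gt0// mulrA mulVf ?gt_eqF// mul1r.
have [M hM] := cau_term cx ltr01; have := dleZ (d M) (hM M (leqnn M)).
have dM := (hd M).1; rewrite mulr1 gtr0_norm//; apply: contra_not (hd M).2; congr dle.
by apply/funext => j; rewrite mulrA mulfV ?mul1r// gt_eqF.
Qed.

(** The reverse of the previous argument: with [B k] bounding the norm of [x k], the coefficients
    [2^-k / B k] give a series that converges for [x], but not along a subsequence with [k]-th norm
    above [2^k * B k]. *)
Lemma subsym_upper x : subsymmetric p gamma x -> exists M, forall k, dle (x k) M.
Proof.
move=> ss; have [[inT _] _] := ss; apply: contrapT => no.
have /choice[B hB] : forall k, exists X, 0 < X /\ dle (x k) X.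
  move=> k; have /inTistarP[X hX] := inT k; exists (X + 1).
  by split; [rewrite ltr_wpDl// (dle_ge0 hX)|apply: dle_le hX; rewrite lerDl].
have large (M : R) K : exists j, (K <= j)%N /\ ~ dle (x j) M.
  elim: K M => [|K IH] M.
    apply: contrapT => no'; apply: no; exists M => k; apply: contrapT => dk; apply: no'.
    by exists k.
  have [j [Kj hj]] := IH (Num.max M (B K)); exists j; split; last first.
    by apply: contra_not hj; apply: dle_le; rewrite le_max lexx.
  rewrite ltn_neqAle Kj andbT; apply/eqP => Kj'; apply: hj; rewrite -Kj'.
  by apply: dle_le (hB K).2; rewrite le_max lexx orbT.
have w0 k : 0 < 2^-1 ^+ k :> R by rewrite exprn_gt0// invr_gt0.
have [sigma sl hs] := @pick_incr (fun k j => ~ dle (x j) (B k / 2^-1 ^+ k)) (fun k K => large _ K).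
have cx : cau x (fun k => 2^-1 ^+ k / B k).
  apply: (cau_geometric (C := 1)) => k; rewrite mul1r; have Bk := (hB k).1.
  have := dleZ (2^-1 ^+ k / B k) (hB k).2.
  by rewrite gtr0_norm ?divr_gt0// divfK ?gt_eqF.
have [M hM] := cau_term ((subsym_cau ss sl _).1 cx) ltr01.
have BM := (hB M).1; apply: (hs M); have := dleZ (B M / 2^-1 ^+ M) (hM M (leqnn M)).
rewrite mulr1 gtr0_norm ?divr_gt0//; congr dle; apply/funext => j /=.
by rewrite mulrA mulf_div (mulrC (B M)) mulfV ?mul1r// mulf_neq0// gt_eqF.
Qed.

(* Gliding hump. *)
Lemma extract_blocks x (z : nat -> R) M Z (eta : R) : (forall k, dle (x k) M) -> dle z Z ->
  (forall m (eps : R) K, 0 < eps ->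
    exists k, (K <= k)%N /\ forall j, (j < m)%N -> `|x k j - z j| <= eps) -> 0 < eta ->
  exists sigma t : nat -> nat, [/\ forall i j, (i < j)%N -> (sigma i < sigma j)%N,
    forall i j, (i < j)%N -> (t i < t j)%N, t 0%N = 0%N &
    forall k, dle (x (sigma k) \- (z \+ cut (t k) (t k.+1) (x (sigma k) \- z))) (eta * 2^-1 ^+ k)].
Proof.
move=> xM zZ cl e0; have w0 k : 0 < 2^-1 ^+ k :> R by rewrite exprn_gt0// invr_gt0.
have /choice[h hh] : forall kKT : nat * (nat * nat), exists sT : nat * nat,
    [/\ (kKT.2.1 <= sT.1)%N, (kKT.2.2 < sT.2)%N &
     dle (x sT.1 \- (z \+ cut kKT.2.2 sT.2 (x sT.1 \- z))) (eta * 2^-1 ^+ kKT.1)].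
  move=> [k [K T]] /=; have ek : 0 < eta * 2^-1 ^+ k / 2 by rewrite divr_gt0// mulr_gt0.
  have T1 : 0 < T.+1%:R :> R by rewrite ltr0n.
  (* Half of the error is for the coordinates below [T], where [x s0] is close to [z], and half for
     the tail from [T'] on. *)
  have [s0 [Ks hs]] := cl T (eta * 2^-1 ^+ k / 2 / T.+1%:R) K (divr_gt0 ek T1).
  pose y := x s0 \- z.
  have yd : dle y (M + Z).
    have := dleD (xM s0) (dleZ (-1) zZ); rewrite normrN1 mul1r; congr dle.
    by apply/funext => j; rewrite /y /= mulN1r.
  have [T' hT'] := dle_tail yd ek.
  exists (s0, maxn T.+1 T'); split => //=; first exact: leq_maxl.
  have h1 : dle (cut 0 T y) (eta * 2^-1 ^+ k / 2).
    have h0 : forall j, (T <= j)%N -> cut 0 T y j = 0 by move=> j Tj; rewrite /cut/keep ltnNge Tj.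
    apply: dle_le (dle_l1 h0).
    apply: (@le_trans _ _ (\sum_(j < T) (eta * 2^-1 ^+ k / 2 / T.+1%:R))).
      by apply: ler_sum => j _; rewrite /cut/keep leq0n ltn_ord/= hs.
    rewrite sumr_const card_ord -[leLHS]mulr_natr -mulrA ger_pMr// mulrC ler_pdivrMr// mul1r ler_nat.
    exact: leqnSn.
  rewrite (splitr (eta * _)); move: (dleD h1 hT') => /dle_dom; apply => j.
  have yE : x s0 j - z j = y j by [].
  rewrite /= opprD addrA yE /cut/keep leq0n/= leq_max; case: (ltnP j T) => jT/=.
    rewrite subr0; case: ifP => _; last by rewrite addr0.
    by rewrite -mulr2n normrMn mulr2n lerDl.
  rewrite add0r; case: (leqP T' j) => T'j /=; last by rewrite orbT subrr normr0.
  by rewrite orbF; case: ifP => _; rewrite ?subrr ?normr0 ?subr0.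
(* The state holds the least index still allowed and the left end of the next block. *)
pose fix st k := if k is k'.+1 then ((h (k', st k')).1.+1, (h (k', st k')).2) else (0, 0)%N.
exists (fun k => (h (k, st k)).1), (fun k => (st k).2); split => //.
- by apply: incr_step => i; case: (hh (i.+1, st i.+1)).
- by apply: incr_step => i; case: (hh (i, st i)).
- by move=> k; case: (hh (k, st k)).
Qed.

(** The dyadic piece from [2^i - 1] on has norm at most [gamma^-1 * 2^(i * s) / 2^i], which is
    geometric as [s < 1]. Bounded blocks thus converge with coefficients of harmonic size, while
    multiples of a fixed nonzero vector do not. *)
Lemma dle_harmonic : exists X, dle (fun k => (k.+1%:R)^-1) X.
Proof.
pose rho : R := 2 `^ s / 2.
have two_s : 0 < 2 `^ (1 - s) :> R by rewrite powR_gt0.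
have rho0 : 0 <= rho by rewrite divr_ge0// powR_ge0.
have rho1 : rho < 1.
  rewrite /rho ltr_pdivrMr// mul1r -[ltRHS](@powR_mul_compl _ 2 s)//.
  rewrite ltr_pMr ?powR_gt0//; apply: (@le_lt_trans _ _ (1 `^ (1 - s))); first by rewrite powR1.
  by apply: gt0_ltr_powR; rewrite ?nnegrE ?ltr1n// subr_gt0 s_lt1.
exists (gamma^-1 / (1 - rho)).
have p2 i : (0 < 2 ^ i)%N by rewrite expn_gt0.
apply: (dle_glue (t := fun i => (2 ^ i).-1) (B := fun i => gamma^-1 * rho ^+ i)) => // [i|i|n].
- by rewrite expnS mul2n -addnn; have := p2 i; lia.
- have := dleZ (2^-1 ^+ i) (dle_indicator (2 ^ i).-1 (2 ^ i)).
  have -> : `|2^-1 ^+ i| * (gamma^-1 * (2 ^ i)%:R `^ s) = gamma^-1 * rho ^+ i.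
    rewrite ger0_norm ?exprn_ge0 ?invr_ge0// natrX -powR_mulrn// -powRrM mulrC.
    rewrite (mulrC i%:R) powRrM powR_mulrn ?powR_ge0// /rho exprMn; ring.
  move/dle_dom; apply => j; rewrite /cut/keep.
  have -> : ((2 ^ i).-1 + 2 ^ i = (2 ^ i.+1).-1)%N by rewrite expnS mul2n -addnn; have := p2 i; lia.
  case: ifP => [/andP[j1 _]|_]; last by rewrite mulr0.
  rewrite mulr1 !ger0_norm ?invr_ge0 ?exprn_ge0 ?invr_ge0// exprVn lef_pV2 ?posrE ?exprn_gt0 ?ltr0n//.
  by rewrite -natrX ler_nat -(prednK (p2 i)) ltnS.
- rewrite -mulr_sumr ler_wpM2l ?invr_ge0 ?(ltW gamma_gt0)//.
  rewrite -[leRHS]div1r ler_pdivlMr ?subr_gt0// mulrC -opprB mulNr -subrX1 opprB.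
  by rewrite gerBl exprn_ge0.
Qed.

Lemma cau_blocks (f : nat -> nat -> R) t c M X : (forall i j, (i < j)%N -> (t i < t j)%N) ->
  (forall k j, ~~ (t k <= j < t k.+1)%N -> f k j = 0) -> (forall k, dle (f k) M) ->
  dle c X -> cau f c.
Proof.
move=> t_lt fsupp fM cX eps e0; have M0 := dle_ge0 (fM 0%N).
have M1 : 0 < M + 1 by rewrite ltr_wpDl.
have /cau_estar /(_ _ (divr_gt0 e0 M1))[K hK] : exists X, dle c X by exists X.
exists K => m n Km mn; have := hK m n Km mn; rewrite psums_estar => h.
have h1 : M * (eps / (M + 1)) <= eps.
  by rewrite mulrCA ger_pMr// ler_pdivrMr// mul1r lerDl.
apply: dle_le h1 _; move: (dle_blocks t_lt m n fsupp fM h); congr dle; apply/funext => j.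
by rewrite /psums big_nat [RHS]big_nat; apply: eq_bigr => k mkn; rewrite /cut/keep mkn.
Qed.

(* Otherwise, against [z] the coefficients [(-1)^k / (k+1)] give a convergent series,
   while the subseries of even indices diverges. *)
Lemma subsym_weakly_null x (z : nat -> R) M Z eta sigma t : subsymmetric p gamma x ->
  (forall k, dle (x k) M) -> dle z Z ->
  (forall i j, (i < j)%N -> (sigma i < sigma j)%N) ->
  (forall i j, (i < j)%N -> (t i < t j)%N) ->
  (forall k, dle (x (sigma k) \- (z \+ cut (t k) (t k.+1) (x (sigma k) \- z))) (eta * 2^-1 ^+ k)) ->
  forall j, z j = 0.
Proof.
move=> ss xM zZ sl t_lt herr j0; apply/eqP; rewrite -normr_le0 leNgt; apply/negP => z0.
pose f k := cut (t k) (t k.+1) (x (sigma k) \- z).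
have fsupp k j : ~~ (t k <= j < t k.+1)%N -> f k j = 0 by rewrite /f/cut/keep => /negbTE ->.
have fM k : dle (f k) (M + Z).
  apply: dle_keep; have := dleD (xM (sigma k)) (dleZ (-1) zZ); rewrite normrN1 mul1r.
  by congr dle; apply/funext => j /=; rewrite mulN1r.
pose err k := x (sigma k) \- (z \+ f k).
pose a k : R := (-1) ^+ k / k.+1%:R.
pose b k : R := (k.+1%:R)^-1.
have ab k : `|a k| = b k by rewrite /a normrM normrX normrN1 expr1n mul1r ger0_norm.
have b0 k : 0 < b k by rewrite invr_gt0 ltr0n.
have [X bX] := dle_harmonic.
have aX : dle a X by apply: dle_dom bX _ => k; rewrite ab -/(b k) ger0_norm// ltW.
have cau_f c : (forall k, `|c k| <= b k) -> cau f c.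
  move=> cb; apply: (cau_blocks t_lt fsupp fM (X := X)); apply: dle_dom bX _ => k.
  by rewrite -/(b k) (ger0_norm (ltW (b0 k))).
have cau_err c : (forall k, `|c k| <= b k) -> cau err c.
  move=> cb; apply: (cau_geometric (C := eta)) => k.
  apply: dle_dom (herr k) _ => j; rewrite -/(f k) -/(err k) normrM ler_piMl//.
  by apply: (le_trans (cb k)); rewrite invf_le1 ?ltr0n// ler1n.
have cau_z : cau (fun=> z) a.
  have Z0 := dle_ge0 zZ; have Z1 : 0 < Z + 1 by rewrite ltr_wpDl.
  move=> eps e0; have := archi_boundP (ltW (divr_gt0 Z1 e0)); set K := Num.bound _ => hK.
  exists K => m n Km mn; have := dleZ (\sum_(m <= k < n) a k) zZ.
  have hle : `|\sum_(m <= k < n) a k| * Z <= eps.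
    apply: (@le_trans _ _ ((m.+1%:R)^-1 * (Z + 1))).
      by rewrite ler_pM ?alternating_harmonic// lerDl.
    rewrite mulrC ler_pdivrMr ?ltr0n// -ler_pdivrMl// mulrC; apply: (le_trans (ltW hK)).
    by rewrite ler_nat (leq_trans Km).
  by move/(dle_le hle); congr dle; apply/funext => j; rewrite /psums mulr_suml.
have xs_a : cau (x \o sigma) a.
  have a_le k : `|a k| <= b k by rewrite ab.
  have h1 := cauD (cau_f _ a_le) cau_z (y := fun k => f k \+ z) (d := a)
    (fun k j => mulrDr _ _ _).
  apply: (cauD h1 (cau_err _ a_le)) => k j; rewrite -mulrDr; congr (_ * _) => /=.
  by rewrite /err/=; ring.
have xa : cau x a by apply/(subsym_cau ss sl).
have [[inT _] [unc _]] := ss.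
have xeven : cau x (keep (fun k => ~~ odd k) a) by exact: unconditional_subseries.
(* [b] is twice the even part of [a], minus [a]. *)
have xb : cau x b.
  apply: (cauD (cauZ 2 xeven) (cauZ (-1) xa)) => k j.
  rewrite /keep /b /a -signr_odd; case: (odd k) => /=; rewrite ?expr1 ?expr0; ring.
have b_le k : `|b k| <= b k by rewrite ger0_norm// ltW.
have cz : cau (fun=> z) b.
  have h1 := (subsym_cau ss sl _).1 xb.
  have h2 := cauD (cauZ (-1) (cau_f _ b_le)) (cauZ (-1) (cau_err _ b_le))
    (y := fun k => f k \+ err k) (d := fun k => -1 * b k) (fun k j => mulrDr _ _ _).
  by apply: (cauD h1 h2) => k j; rewrite /= /err/=; ring.
(* The harmonic sum from [K + 1] to its double is at least 1/2, so the coordinate [j0] is at least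
   [|z j0| / 2], against the bound [|z j0| / 4]. *)
have [K hK] := cz _ (divr_gt0 z0 (ltr0n R 4)).
have K1 : (K < K.+1 + K.+1)%N by rewrite addSn ltnS (leq_trans (leqnSn K)) ?leq_addl.
have := dle_coord j0 (hK K.+1 (K.+1 + K.+1)%N (leqnSn K) (leq_addr _ _)).
rewrite /psums -mulr_suml normrM leNgt => /negP; apply.
apply: (@lt_le_trans _ _ (2^-1 * `|z j0|)); first by lra.
rewrite ler_wpM2r// ger0_norm; last by rewrite sumr_ge0// => k _; exact: ltW.
apply: (@le_trans _ _ (\sum_(K.+1 <= k < K.+1 + K.+1) ((K.+1 + K.+1)%:R)^-1)).
  rewrite big_const_nat addKn iter_addr addr0 -[leRHS]mulr_natl natrD -mulr2n -[X in _ / X]mulr_natl.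
  by rewrite invfM mulrCA mulfV ?mulr1// gt_eqF// ltr0n.
rewrite big_nat [leRHS]big_nat; apply: ler_sum => k /andP[_ k2].
by rewrite /b lef_pV2 ?posrE ?ltr0n// ler_nat.
Qed.

Lemma cau_bounded y c (delta : R) : 0 < delta -> (forall k, ~ dle (y k) delta) -> cau y c ->
  exists B : R, forall k, `|c k| <= B.
Proof.
move=> d0 yd /cau_term/(_ _ d0)[M hM].
exists (1 + \sum_(k < M) `|c k|) => k; have [kM|Mk] := ltnP k M.
  by rewrite (bigD1 (Ordinal kM))//= addrCA lerDl addr_ge0// sumr_ge0.
apply: (@le_trans _ _ 1); last by rewrite lerDl sumr_ge0.
rewrite leNgt; apply/negP => ck; apply: (yd k).
have c0 : 0 < `|c k| by exact: lt_trans ltr01 ck.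
have := dleZ (c k)^-1 (hM k Mk); rewrite normfV => h.
have le_d : `|c k|^-1 * delta <= delta by rewrite ler_piMl ?(ltW d0)// invf_le1// ltW.
move: (dle_le le_d h); congr dle; apply/funext => j.
by rewrite mulrA mulVf ?mul1r// -normr_gt0.
Qed.

Lemma dle_flat_range (f : nat -> nat -> R) (t : nat -> nat) (c : nat -> R) (m n : nat) (M : R) :
  (m < n)%N -> (forall k, (t k <= t k.+1)%N) ->
  (forall k j, ~~ (t k <= j < t k.+1)%N -> f k j = 0) -> (forall k, dle (f k) M) ->
  (forall k j, (m <= k < n)%N -> `|f k j| <= ((n - m)%:R `^ s)^-1) ->
  \sum_(m <= k < n) `|c k| `^ s^-1 <= 1 ->
  dle (psums f c m n) (flat_const M).
Proof.
move=> mn tS fsupp fM fsmall; rewrite -{1}[m]add0n big_addn => csum.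
have nm0 : (0 < n - m)%N by rewrite subn_gt0.
have : dle (psums (fun k => f (k + m)%N) (fun k => c (k + m)%N) 0 (n - m)) (flat_const M).
  apply: (dle_flat (t := fun k => t (k + m)%N)) => // [k j _|k j kn]; first exact: fsupp.
  by apply: fsmall; rewrite leq_addl/= addnC -ltn_subRL.
by congr dle; apply/funext => j; rewrite /psums -[X in \sum_(X <= _ < n) _]add0n big_addn.
Qed.

(* Were there no upper [q]-estimate, some [c] with [l_q]-norm [2^-i] on the [i]-th
   of successive intervals would make [\sum c k *: f k] diverge; yet it converges
   along a subsequence of [f] whose coordinates decrease fast enough for [dle_flat]. *)
Lemma no_vanishing_blocks (f : nat -> nat -> R) (t : nat -> nat) (delta M : R) :
  (forall i j, (i < j)%N -> (t i < t j)%N) ->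
  (forall k j, ~~ (t k <= j < t k.+1)%N -> f k j = 0) ->
  0 < delta -> (forall k, ~ dle (f k) delta) -> (forall k, dle (f k) M) ->
  (forall eps : R, 0 < eps -> exists K, forall k j, (K <= k)%N -> `|f k j| <= eps) ->
  (forall tau c, (forall i j, (i < j)%N -> (tau i < tau j)%N) -> (forall k, `|c k| <= 1) ->
    cau (f \o tau) c -> cau f c) ->
  False.
Proof.
move=> t_lt fsupp d0 fd fM fsmall spread.
have s0 := s_gt0; have sV0 : s^-1 != 0 by rewrite invr_eq0 gt_eqF.
have M0 := dle_ge0 (fM 0%N).
(* Otherwise [X] bounds all normalized combinations from [q] on, and the at most [q] earlier terms
   add at most [q * M]: an upper q-estimate, excluded by [no_lq]. *)
have next (q : nat) (X : R) : exists nc : nat * (nat -> R), [/\ (q < nc.1)%N,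
    \sum_(q <= k < nc.1) `|nc.2 k| `^ s^-1 <= 1 & ~ dle (psums f nc.2 q nc.1) X].
  apply: contrapT => no; apply: (no_lq t_lt fsupp d0 fd (K0 := q%:R * M + Num.max 0 X)) => m n c.
  rewrite -(sum_powR_cut c sV0 (leq0n m) (leqnn n)) -(psums_cut f c (leq0n m) (leqnn n)).
  move: (cut m n c) => {m} {}c csum.
  have head k : (k <= q)%N -> (k <= n)%N -> dle (psums f c 0 k) (q%:R * M).
    move=> kq kn; apply: dle_le (dle_psums c 0 k fM).
    apply: (@le_trans _ _ (\sum_(0 <= i < k) M)).
      rewrite big_nat [leRHS]big_nat; apply: ler_sum => i /andP[_ ik].
      by rewrite ler_piMl// (powR_sum_le1 csum)//= (leq_trans ik).
    by rewrite big_const_nat subn0 iter_addr addr0 -[leLHS]mulr_natl ler_wpM2r// ler_nat.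
  have [nq|qn] := leqP n q.
    by apply: dle_le (head n nq (leqnn n)); rewrite lerDl le_max lexx.
  rewrite (psums_cat f c (leq0n q) (ltnW qn)); apply: dleD; first exact: head (ltnW qn).
  apply: (@dle_le _ X); first by rewrite le_max lexx orbT.
  apply: contrapT => nd; apply: no; exists (n, c); split=> //.
  by apply: le_trans csum; rewrite (big_cat_nat (leq0n q) (ltnW qn))/= lerDr sumr_ge0.
have /choice[h hh] := fun iq : nat * nat => next iq.2 (2 ^+ iq.1).
pose fix q i := if i is i'.+1 then (h (i', q i')).1 else 0%N.
pose cc i := (h (i, q i)).2.
have qS i : (q i < q i.+1)%N by case: (hh (i, q i)).
have csum i : \sum_(q i <= k < q i.+1) `|cc i k| `^ s^-1 <= 1 by case: (hh (i, q i)).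
have nd i : ~ dle (psums f (cc i) (q i) (q i.+1)) (2 ^+ i) by case: (hh (i, q i)).
have q_lt := incr_step qS.
have bq i k : (q i <= k < q i.+1)%N -> blk q k = i.
  by move=> qk; apply/eqP; rewrite blk_eq.
have w0 i : 0 < 2^-1 ^+ i :> R by rewrite exprn_gt0// invr_gt0.
pose c k := 2^-1 ^+ blk q k * cc (blk q k) k.
have c1 k : `|c k| <= 1.
  rewrite normrM mulr_ile1 ?(powR_sum_le1 (csum _)) ?blkP// gtr0_norm//.
  by rewrite exprn_ile1// ?invr_ge0// invf_le1// ler1n.
have blockE x m n i : psums x (cut m n c) (q i) (q i.+1) =
    fun j => 2^-1 ^+ i * psums x (cut m n (cc i)) (q i) (q i.+1) j.
  apply/funext => j; rewrite /psums mulr_sumr big_nat [RHS]big_nat; apply: eq_bigr => k /bq bk.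
  by rewrite /cut/keep; case: ifP => _; rewrite ?mul0r ?mulr0// mulrA /c bk.
have not_cau : ~ cau f c.
  move=> /(_ _ ltr01)[K /(_ (q K) (q K.+1) (incr_ge q_lt K) (ltnW (qS K)))].
  rewrite -(psums_cut f c (leqnn _) (leqnn _)) blockE (psums_cut _ _ (leqnn _) (leqnn _)).
  move/(dleZ (2 ^+ K)); rewrite mulr1 ger0_norm ?exprn_ge0//.
  apply: contra_not (nd K); congr dle; apply/funext => j.
  by rewrite mulrA -exprMn mulfV// expr1n mul1r.
have n0 i : 0 < ((q i.+1 - q i)%:R `^ s)^-1 :> R.
  by rewrite invr_gt0 powR_gt0// ltr0n subn_gt0.
(* The coordinates of [f (tau k)] are to be at most [L^-s], where [L] is the length of the interval
   of indices containing [k]; this is the flatness required to apply [dle_flat] on each interval. *)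
have [tau tau_lt htau] := @pick_incr
  (fun k n => forall j, `|f n j| <= ((q (blk q k).+1 - q (blk q k))%:R `^ s)^-1)
  (fun k K => let: ex_intro K' hK' := fsmall _ (n0 (blk q k)) in
    ex_intro _ (maxn K K') (conj (leq_maxl K K') (fun j => hK' _ j (leq_maxr K K')))).
apply/not_cau/(spread tau) => // eps e0.
have C0 : 0 <= flat_const M.
  by rewrite /flat_const mulr_ge0 ?powR_ge0// mulr_ge0// invr_ge0 ltW// gamma_gt0.
have [K hK] := geometric_tail C0 e0; exists (q K) => m n Km mn.
have am : (q (blk q m) <= m)%N by have /andP[] : (q (blk q m) <= m < q (blk q m).+1)%N by exact: blkP.
have nb : (n <= q (blk q n).+1)%N.
  by have /andP[_ /ltnW] : (q (blk q n) <= n < q (blk q n).+1)%N by exact: blkP.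
have ab : (blk q m <= (blk q n).+1)%N by rewrite leqW// blk_homo.
have Ka : (K <= blk q m)%N by rewrite -(bq K (q K)) ?blk_homo// leqnn qS.
(* The range [[m, n)] is widened to whole intervals, with the coefficients cut to 0 outside it; the
   cut does not increase their l_q norms. *)
set a := blk q m in am ab Ka; set b := (blk q n).+1 in nb ab.
rewrite -(psums_cut _ _ am nb); apply: dle_le (hK a b Ka ab) _.
have blockle i : dle (psums (f \o tau) (cut m n c) (q i) (q i.+1)) (flat_const M * 2^-1 ^+ i).
  rewrite blockE mulrC -[X in X * _](ger0_norm (ltW (w0 i))); apply: dleZ.
  apply: (dle_flat_range (t := t \o tau)) => //=.
  - by move=> k; rewrite (incr_leE t_lt) ltnW// tau_lt.
  - move=> k j nj; apply: fsupp; apply: contra nj => /andP[-> j2]/=.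
    by apply: leq_trans j2 _; rewrite incr_leE// tau_lt.
  - by move=> k j /bq bk; have := htau k j; rewrite bk.
  - apply: le_trans (csum i); apply: ler_sum => k _; rewrite /cut/keep.
    by case: ifP => // _; rewrite normr0 powR0// powR_ge0.
have := dle_sum (index_iota a b) blockle; congr dle; apply/funext => j.
rewrite /psums -{1}[a]add0n big_addn big_mkord.
have := @sum_nat_blocks _ (fun k => cut m n c k * f (tau k) j) (fun i => q (i + a)%N) (b - a)
  (fun i => ltnW (qS _)).
by rewrite add0n subnK// => ->.
Qed.

(** One coordinate [J k] of modulus at least [delta] is picked in each block. Reading the sum along
    [J] does not increase the norm and recovers [c k] up to factors of modulus at least [delta]. *)
Lemma cau_large_coord (f : nat -> nat -> R) (t : nat -> nat) (delta : R) c :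
  (forall i j, (i < j)%N -> (t i < t j)%N) ->
  (forall k j, ~~ (t k <= j < t k.+1)%N -> f k j = 0) ->
  0 < delta -> (forall k, exists j, delta <= `|f k j|) -> cau f c -> cau (@estar R) c.
Proof.
move=> t_lt fsupp d0 /choice[J hJ] cf eps e0.
have JP k : (t k <= J k < t k.+1)%N.
  apply/negPn/negP => /fsupp fJ; have := hJ k; by rewrite fJ normr0 leNgt d0.
have J_lt : forall i j, (i < j)%N -> (J i < J j)%N.
  apply: incr_step => i; have /andP[_ h1] := JP i; have /andP[h2 _] := JP i.+1.
  exact: leq_trans h2.
have [K hK] := cf _ (mulr_gt0 d0 e0); exists K => m n Km mn; rewrite psums_estar.
have := dleZ delta^-1 (dle_comp_incr J_lt (hK m n Km mn)).
rewrite gtr0_norm ?invr_gt0// mulKf ?gt_eqF// => /dle_dom; apply => k.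
rewrite /cut/keep; case: ifP => [mkn|_]; last by rewrite normr0.
have -> : (psums f c m n \o J) k = c k * f k (J k).
  rewrite /= /psums (bigD1_seq k) ?mem_index_iota ?iota_uniq//= big1 ?addr0// => i ik.
  rewrite fsupp ?mulr0//; apply: contra ik => Ji.
  have T0 : (t 0 <= J k)%N by have /andP[h _] := Ji; apply: leq_trans h; rewrite incr_leE.
  by rewrite -(eqP (_ : blk t (J k) == i)) ?blk_eq// -(eqP (_ : blk t (J k) == k)) ?blk_eq.
rewrite mulrCA !normrM ler_peMr// normfV (gtr0_norm d0) -ler_pdivrMl ?invr_gt0// invrK mulr1.
exact: hJ.
Qed.

Lemma subsym_equivalent_estar x : subsymmetric p gamma x -> equivalent p gamma x (@estar R).
Proof.
move=> ss c; have [[inT _] _] := ss.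
rewrite (converges_cau c inT) (converges_cau c estar_inTistar).
have [delta d0 xd] := subsym_lower ss; have [M xM] := subsym_upper ss.
have [z cl] := cluster_point (fun k j => dle_coord j (xM k)).
have zM : dle z M.
  apply: dle_closed => m eps e0; have [k [_ hk]] := cl m eps 0%N e0.
  by exists (x k) => // j jm; rewrite distrC hk.
(* Errors of at most [delta / 4] leave the blocks with norm above [delta / 2]. *)
have d4 : 0 < delta / 4 by rewrite divr_gt0.
have [sigma [t [sl t_lt _ herr]]] := extract_blocks xM zM cl d4.
have z0 := subsym_weakly_null ss xM zM sl t_lt herr.
pose f k := cut (t k) (t k.+1) (x (sigma k) \- z).
have fsupp k j : ~~ (t k <= j < t k.+1)%N -> f k j = 0 by rewrite /f/cut/keep => /negbTE ->.
have ferr k : dle (x (sigma k) \- f k) (delta / 4 * 2^-1 ^+ k).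
  by have := herr k; congr dle; apply/funext => j /=; rewrite z0 add0r.
have fM k : dle (f k) M.
  by apply: dle_keep; have := xM (sigma k); congr dle; apply/funext => j /=; rewrite z0 subr0.
have fd k : ~ dle (f k) (delta / 2).
  have w1 : 2^-1 ^+ k <= 1 :> R by rewrite exprn_ile1// ?invr_ge0// invf_le1// ler1n.
  move=> h; apply: (xd (sigma k)); have := dleD h (ferr k).
  move/(@dle_le _ _ delta); have -> : f k \+ (x (sigma k) \- f k) = x (sigma k).
    by apply/funext => j /=; rewrite addrC subrK.
  apply; nra.
have d2 : 0 < delta / 2 by rewrite divr_gt0.
have cau_err tau d : (forall i j, (i < j)%N -> (tau i < tau j)%N) ->
    (exists B : R, forall k, `|d k| <= B) -> cau (fun k => x (sigma (tau k)) \- f (tau k)) d.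
  move=> tau_lt [B dB]; apply: (cau_geometric (C := B * (delta / 4))) => k.
  have B0 : 0 <= B by apply: le_trans (dB 0%N).
  apply: dle_le (dleZ (d k) (ferr (tau k))); rewrite -[leRHS]mulrA.
  apply: ler_pM => //; first by rewrite mulr_ge0 ?(ltW d4)// exprn_ge0// invr_ge0.
  rewrite ler_wpM2l ?(ltW d4)//.
  by rewrite ler_wiXn2l ?invr_ge0// ?invf_le1// ?ler1n// incr_ge.
(* By subsymmetry [x] may be replaced by its subsequence along [sigma \o tau], which differs from
   the blocks by a geometric error; bounded coefficients keep that error summable. *)
have transfer tau d : (forall i j, (i < j)%N -> (tau i < tau j)%N) ->
    (exists B : R, forall k, `|d k| <= B) -> cau x d <-> cau (f \o tau) d.
  move=> tau_lt dB; have st_lt i j : (i < j)%N -> ((sigma \o tau) i < (sigma \o tau) j)%N.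
    by move=> ij; apply/sl/tau_lt.
  have cerr := cau_err _ _ tau_lt dB.
  rewrite (subsym_cau ss st_lt); split => h.
    by apply: (cauD h (cauZ (-1) cerr)) => k j /=; ring.
  by apply: (cauD h cerr) => k j /=; ring.
have id_lt : forall i j : nat, (i < j)%N -> (id i < id j)%N by [].
split => [cx|/cau_estar[X cX]]; last first.
  have cB : exists B : R, forall k, `|c k| <= B by exists X => k; exact: dle_coord.
  exact: (transfer id c id_lt cB).2 (cau_blocks t_lt fsupp fM cX).
have cB := cau_bounded d0 xd cx.
have [[delta' [d'0 large]]|vanish] := pselect (exists delta' : R, 0 < delta' /\
    forall K, exists k, (K <= k)%N /\ exists j, delta' <= `|f k j|).
  have [tau tau_lt htau] := @pick_incr (fun _ n => exists j, delta' <= `|f n j|) (fun _ => large).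
  have h := (transfer tau c tau_lt cB).1 cx.
  apply: (cau_large_coord (t := t \o tau) (delta := delta')) h => //= [i j ij|k j nj].
    by apply/t_lt/tau_lt.
  apply: fsupp; apply: contra nj => /andP[-> j2]/=.
  by apply: leq_trans j2 _; rewrite incr_leE// tau_lt.
case: (no_vanishing_blocks t_lt fsupp d2 fd fM) => [eps e0|tau d tau_lt d1 h].
  apply: contrapT => no; apply: vanish; exists eps; split=> // K.
  apply: contrapT => no'; apply: no; exists K => k j Kk; rewrite leNgt; apply/negP => fe.
  by apply: no'; exists k; split=> //; exists j; exact: ltW.
have dB : exists B : R, forall k, `|d k| <= B by exists 1.
exact: (transfer id d id_lt dB).1 ((transfer tau d tau_lt dB).2 h).
Qed.

End Norm.

Theorem theorem10 (R : realType) (p : R) (hp : 1 < p) :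
  exists gamma0 : R, 0 < gamma0 /\ gamma0 <= 1 /\
    forall gamma : R, 0 < gamma -> gamma < gamma0 ->
      subsymmetric p gamma (@estar R) /\
      ~ symmetric_seq p gamma (@estar R) /\
      (forall x : nat -> nat -> R,
         subsymmetric p gamma x -> equivalent p gamma x (@estar R)).
Proof.
(* This value gives the bound 7/20, below 1/2, in [flat_averages]. *)
exists 100^-1; split; first by rewrite invr_gt0.
split; first by rewrite invf_le1 ?ler1n.
move=> gamma g0 g100.
have g1 : 0 < gamma < 1 by rewrite g0 (lt_le_trans g100)// invf_le1// ler1n.
have g3 : gamma <= 3^-1 by apply: (le_trans (ltW g100)); rewrite lef_pV2 ?posrE// ler_nat.
split; first exact: subsymmetric_estar.
split; first exact: (estar_not_symmetric hp g1 g3 (ltW g100)).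
move=> x; exact: (subsym_equivalent_estar hp g1 g3 (ltW g100)).
Qed.
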